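(* Let $d\in\mathbb{N}$, let $\alpha>0$ be real, let $s\in\{a,b,c,d,e,x\}$ (where the letters denote the approximation, Bernstein, Gelfand, Kolmogorov, entropy and Weyl numbers, respectively), and let $I_\gamma:\mathcal{H}^\alpha\to L_2(\mathbb{R}^d,\gamma)$ be the embedding operator. Then $$s_n\big(I_\gamma:\mathcal{H}^\alpha\to L_2(\mathbb{R}^d,\gamma)\big)\asymp n^{-\frac{\alpha}{2}}(\log n)^{\frac{(d-1)\alpha}{2}},\qquad n\to\infty.$$ Moreover, if $s\in\{a,b,c,d,x\}$, then $$\lim_{n\to\infty}\frac{s_n\big(I_\gamma:\mathcal{H}^\alpha\to L_2(\mathbb{R}^d,\gamma)\big)}{n^{-\frac{\alpha}{2}}(\ln n)^{\frac{\alpha(d-1)}{2}}}=\bigg(\frac{1}{(d-1)!}\bigg)^{\alpha/2}.$$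
   Context: Asymptotic notation: $A_n\ll B_n$ means there is a constant $C>0$ independent of $n$ with $A_n\le CB_n$; $A_n\asymp B_n$ means $A_n\ll B_n$ and $B_n\ll A_n$. With ''$n\to\infty$'' these are understood for all sufficiently large $n$. Spaces: $g(\boldsymbol{x})=(2\pi)^{-d/2}\exp(-|\boldsymbol{x}|^2/2)$ for $\boldsymbol{x}\in\mathbb{R}^d$ ($|\cdot|$ the Euclidean norm), and $\gamma(\mathrm{d}\boldsymbol{x})=g(\boldsymbol{x})\,\mathrm{d}\boldsymbol{x}$ is the standard Gaussian measure; $L_2(\mathbb{R}^d,\gamma)$ is the corresponding $L_2$ space. For $k\in\mathbb{N}_0$ the normalized probabilistic Hermite polynomial is $H_k(x)=\frac{(-1)^k}{\sqrt{k!}}\exp\left(\frac{x^2}{2}\right)\frac{\mathrm{d}^k}{\mathrm{d}x^k}\exp\left(-\frac{x^2}{2}\right)$, and for $\boldsymbol{k}\in\mathbb{N}_0^d$, $H_{\boldsymbol{k}}(\boldsymbol{x})=\prod_{j=1}^dH_{k_j}(x_j)$. The $H_{\boldsymbol{k}}$ form an orthonormal basis of $L_2(\mathbb{R}^d,\gamma)$, and each $f\in L_2(\mathbb{R}^d,\gamma)$ has the Hermite series $f=\sum_{\boldsymbol{k}\in\mathbb{N}_0^d}\hat f(\boldsymbol{k})H_{\boldsymbol{k}}$ with $\hat f(\boldsymbol{k})=\int_{\mathbb{R}^d}f(\boldsymbol{x})H_{\boldsymbol{k}}(\boldsymbol{x})\,\gamma(\mathrm{d}\boldsymbol{x})$.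 For $\alpha>0$ put $\rho_{\alpha,\boldsymbol{k}}=\prod_{j=1}^d(k_j+1)^\alpha$. $\mathcal{H}^\alpha$ is the space of all $f\in L_2(\mathbb{R}^d,\gamma)$ for which the norm $\|f\|_{\mathcal{H}^\alpha}=\big(\sum_{\boldsymbol{k}\in\mathbb{N}_0^d}\rho_{\alpha,\boldsymbol{k}}|\hat f(\boldsymbol{k})|^2\big)^{1/2}$ is finite. For Banach spaces $X,Y$, $T\in\mathcal{L}(X,Y)$ (bounded linear operators) and $n\in\mathbb{N}$: Approximation numbers: $a_n(T)=\inf\{\|T-A\|: A\in\mathcal{L}(X,Y),\ \mathrm{rank}(A)<n\}$. Kolmogorov numbers: $d_n(T)=\inf_{L_{n-1}}\sup_{\|x\|_X\le1}\inf_{y\in L_{n-1}}\|Tx-y\|_Y$, the outer infimum over all linear subspaces $L_{n-1}$ of $Y$ of dimension $n-1$. Gelfand numbers: $c_n(T)=\inf\{\|TJ_M^X\|:\ \mathrm{codim}(M)<n\}$, where $M$ runs over subspaces of $X$ and $J_M^X:M\to X$ is the canonical injection. Weyl numbers: $x_n(T)=\sup\{a_n(TA): A\in\mathcal{L}(\ell_2,X),\ \|A\|\le1\}$. (Dyadic) entropy numbers: $e_n(T)=\inf\{\varepsilon>0: T(B_X)\text{ can be covered by }2^{n-1}\text{ balls in }Y\text{ of radius }\varepsilon\}$, where $B_X$ is the closed unit ball of $X$. Bernstein numbers: $b_n(T)=\sup_{L_n}\inf_{x\in L_n,\,x\ne0}\frac{\|Tx\|_Y}{\|x\|_X}$, the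 supremum over all subspaces $L_n$ of $X$ of dimension $n$. (The letter $d$ as a member of the set $\{a,b,c,d,e,x\}$ refers to Kolmogorov numbers; elsewhere $d$ is the dimension.) *)

(* Defs.v *)
From HB Require Import structures.
From mathcomp Require Import all_boot all_order all_algebra.
From mathcomp Require Import all_classical all_reals all_analysis.
From mathcomp Require Import measurable_realfun ess_sup_inf.
From mathcomp Require Import ring lra zify.

Set Implicit Arguments.
Unset Strict Implicit.
Unset Printing Implicit Defensive.
Import Order.TTheory GRing.Theory Num.Theory.
Import numFieldNormedType.Exports.

Local Open Scope classical_set_scope.
Local Open Scope ring_scope.

(* Definiteness of [snorm] is deliberately not a field: for the Hermite space
   it is the completeness of the Hermite system, and no definition of an
   s-number below refers to it. *)
Record snormedSpace (R : realType) := SNormedSpace {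
  carrier :> lmodType R;
  snorm : carrier -> R;
  snormD : forall x y, snorm (x + y) <= snorm x + snorm y;
  snormZ : forall a x, snorm (a *: x) = `|a| * snorm x }.

Section dimension.
Context {R : realType} {V : lmodType R}.
Implicit Types (M L : set V) (n : nat).

Definition is_subspace M :=
  M 0 /\ forall (a : R) x y, M x -> M y -> M (a *: x + y).

Definition has_dim L n := exists v : 'I_n -> V,
  (forall c : 'I_n -> R, \sum_i c i *: v i = 0 -> forall i, c i = 0) /\
  L = [set \sum_i c i *: v i | c in [set: 'I_n -> R]].

(* the classes of the [v i] form a basis of the quotient of [V] by [M] *)
Definition has_codim M n := is_subspace M /\ exists v : 'I_n -> V,
  (forall c : 'I_n -> R, M (\sum_i c i *: v i) -> forall i, c i = 0) /\
  (forall x, exists c : 'I_n -> R, M (x - \sum_i c i *: v i)).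

End dimension.

Section operators.
Context {R : realType}.
Implicit Types X Y : snormedSpace R.

Definition unit_ball X : set X := [set x | snorm x <= 1].

Definition is_bounded X Y (T : X -> Y) :=
  exists C : R, forall x, snorm (T x) <= C * snorm x.

Definition opnorm_on X Y (M : set X) (T : X -> Y) : \bar R :=
  ereal_sup [set (snorm (T x))%:E | x in M `&` @unit_ball X].

Definition opnorm X Y (T : X -> Y) : \bar R := opnorm_on setT T.

Definition rank_lt X Y (A : X -> Y) (n : nat) :=
  exists2 m, (m < n)%N & has_dim (range A) m.

End operators.

(* The numbers are indexed by [n >= 1].  Suprema and infima are taken in the
   extended reals, where they always exist. *)
Section s_numbers.
Context {R : realType} {X Y : snormedSpace R}.
Variables (T : {linear X -> Y}) (n : nat).

Definition approximation_number : \bar R :=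
  ereal_inf [set opnorm (fun x => T x - A x) |
    A in [set A : {linear X -> Y} | is_bounded A /\ rank_lt A n]].

Definition kolmogorov_number : \bar R :=
  ereal_inf [set
    ereal_sup [set
      ereal_inf [set (snorm (T x - y))%:E | y in L]
    | x in @unit_ball _ X]
  | L in [set L : set Y | has_dim L n.-1]].

Definition gelfand_number : \bar R :=
  ereal_inf [set opnorm_on M T |
    M in [set M : set X | exists2 m, (m < n)%N & has_codim M m]].

(* closed balls; open balls of the same radii give the same infimum *)
Definition entropy_number : \bar R :=
  ereal_inf [set e%:E | e in [set e : R | 0 < e /\
    exists y : 'I_(2 ^ n.-1) -> Y,
      forall x, unit_ball x -> exists i, snorm (T x - y i) <= e]].

Definition bernstein_number : \bar R :=
  ereal_sup [set
    ereal_inf [set (snorm (T x) / snorm x)%:E | x in L `\ 0]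
  | L in [set L : set X | has_dim L n]].

End s_numbers.

(* [LspaceType mu p1] consists of classes of a.e. equal functions, with no
   algebraic structure: the operations are defined on representatives. *)
Section Lspace_lmod.
Context d (T : measurableType d) (R : realType).
Variables (mu : {measure set T -> \bar R}) (p : \bar R) (p1 : (1 <= p)%E).

Local Notation L := (LspaceType mu p1).
Local Notation F := (LfunType mu p1).
Local Notation Q := {mfun_ mu, T >-> measurableTypeR R}.
Local Open Scope quotient_scope.

Lemma Lspace_Lfun (f : L) : (f : T -> R) \in Lfun mu p.
Proof.
rewrite !inE; apply/andP; split; rewrite inE/=; last exact: Lebesgue_finite.
exact: (@measurable_funPT _ _ _ _ (repr (f : Q))).
Qed.

Definition Lrepr (f : L) : F := Lfun_Sub p1 (Lspace_Lfun f).

(* [R] and [measurableTypeR R] have the same measurable sets but distinct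
   structures *)
Definition mfunR (g : F) : {mfun T >-> measurableTypeR R} :=
  HB.pack_for {mfun T >-> measurableTypeR R} (g : T -> measurableTypeR R)
    (isMeasurableFun.Build _ _ T (measurableTypeR R) g
      (@measurable_funPT _ _ _ _ (g : {mfun T >-> R}))).

Lemma repr_mfunR (g : F) : (repr (\pi_Q (mfunR g)) : T -> R) = g %[ae mu].
Proof.
have /eqP : \pi_Q (repr (\pi_Q (mfunR g))) = \pi_Q (mfunR g) by rewrite reprK.
by rewrite eqmodE => /asboolP.
Qed.

Lemma ae_eq_Lnorm (f g : T -> R) :
  measurable_fun setT f -> measurable_fun setT g -> f = g %[ae mu] ->
  ('N[mu]_p[EFin \o f] = 'N[mu]_p[EFin \o g])%E.
Proof.
move=> mf mg fg; rewrite unlock /Lnorm.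
case: p p1 => [r r1|_|]; last by [].
- congr (_ `^ _)%E; apply: ae_eq_integral.
  + exact: measurableT.
  + apply/measurable_EFinP; apply: (measurableT_comp (measurable_powR _)).
    exact: measurableT_comp.
  + apply/measurable_EFinP; apply: (measurableT_comp (measurable_powR _)).
    exact: measurableT_comp.
  + by apply: filterS fg => x /(_ I) /= ->.
- case: ifP => // _; apply: eq_ess_sup.
  by apply: filterS fg => x /(_ I) /= ->.
Qed.

Lemma Lclass_finite (g : F) : finite_norm mu p (repr (\pi_Q (mfunR g)) : T -> R).
Proof.
rewrite /finite_norm (ae_eq_Lnorm _ _ (repr_mfunR g)).
- exact: Lfunction_finite.
- exact: (@measurable_funPT _ _ _ _ (repr (\pi_Q (mfunR g)))).
- exact: (@measurable_funPT _ _ _ _ (g : {mfun T >-> R})).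
Qed.

Definition Lclass (g : F) : L :=
  HB.pack_for L (\pi_Q (mfunR g)) (isFinLebesgue.Build _ T R mu p p1
    (\pi_Q (mfunR g)) (Lclass_finite g)).

Lemma LreprE (f : L) : (Lrepr f : T -> R) = f.
Proof. by []. Qed.

Lemma LclassK (g : F) : Lrepr (Lclass g) = g %[ae mu].
Proof. exact: repr_mfunR. Qed.

Lemma Lspace_inj (f g : L) : (f : Q) = (g : Q) -> f = g.
Proof.
case: f g => [f [[cf]]] [g [[cg]]] /= fg; case: _ / fg in cg *.
by rewrite (Prop_irrelevance cf cg).
Qed.

Lemma Lclass_eq (g h : F) : Lclass g = Lclass h <-> (g : T -> R) = h %[ae mu].
Proof.
split=> [gh|gh].
  apply: (ae_eq_trans (ae_eq_sym (LclassK g))).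
  by rewrite gh; exact: LclassK.
by apply: Lspace_inj; apply/eqP; rewrite /= eqmodE; apply/asboolP.
Qed.

Lemma LreprK (f : L) : Lclass (Lrepr f) = f.
Proof.
apply: Lspace_inj; rewrite /= -[RHS]reprK; apply/eqP; rewrite eqmodE.
by apply/asboolP; exact: ae_eq_refl.
Qed.


HB.instance Definition _ := gen_eqMixin L.
HB.instance Definition _ := gen_choiceMixin L.

Definition Ladd (f g : L) : L := Lclass (Lrepr f + Lrepr g).
Definition Lopp (f : L) : L := Lclass (- Lrepr f).
Definition Lscale (a : R) (f : L) : L := Lclass (a *: Lrepr f).

Lemma Lclass_add (g h : F) : Ladd (Lclass g) (Lclass h) = Lclass (g + h).
Proof.
apply/Lclass_eq; have := LclassK g; have := LclassK h.
by apply: filterS2 => x /= hx gx _; rewrite !fctE/= hx// gx.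
Qed.

Lemma Lclass_opp (g : F) : Lopp (Lclass g) = Lclass (- g).
Proof.
apply/Lclass_eq; have := LclassK g.
by apply: filterS => x /= gx _; rewrite !fctE/= gx.
Qed.

Lemma Lclass_scale a (g : F) : Lscale a (Lclass g) = Lclass (a *: g).
Proof.
apply/Lclass_eq; have := LclassK g.
by apply: filterS => x /= gx _; rewrite !fctE/= gx.
Qed.

Lemma Lspace_ind (P : L -> Prop) : (forall g, P (Lclass g)) -> forall f, P f.
Proof. by move=> Pg f; rewrite -(LreprK f). Qed.

Fact LaddA : associative Ladd.
Proof.
elim/Lspace_ind=> f; elim/Lspace_ind=> g; elim/Lspace_ind=> h.
by rewrite !Lclass_add addrA.
Qed.

Fact LaddC : commutative Ladd.
Proof.
by elim/Lspace_ind=> f; elim/Lspace_ind=> g; rewrite !Lclass_add addrC.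
Qed.

Fact Ladd0 : left_id (Lclass 0) Ladd.
Proof. by elim/Lspace_ind=> f; rewrite !Lclass_add add0r. Qed.

Fact LaddN : left_inverse (Lclass 0) Lopp Ladd.
Proof. by elim/Lspace_ind=> f; rewrite Lclass_opp Lclass_add addNr. Qed.

HB.instance Definition _ := GRing.isZmodule.Build L LaddA LaddC Ladd0 LaddN.

Fact LscaleA a b f : Lscale a (Lscale b f) = Lscale (a * b) f.
Proof. by elim/Lspace_ind: f => f; rewrite !Lclass_scale scalerA. Qed.

Fact Lscale1 : left_id 1 Lscale.
Proof. by elim/Lspace_ind=> f; rewrite Lclass_scale scale1r. Qed.

Fact LscaleDr : right_distributive Lscale +%R.
Proof.
move=> a; elim/Lspace_ind=> f; elim/Lspace_ind=> g.
by rewrite /GRing.add/= Lclass_add !Lclass_scale Lclass_add scalerDr.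
Qed.

Fact LscaleDl f : {morph Lscale^~ f : a b / a + b}.
Proof.
move=> a b; elim/Lspace_ind: f => f.
by rewrite /(_ + _ : L)/= !Lclass_scale Lclass_add scalerDl.
Qed.

HB.instance Definition _ := GRing.Zmodule_isLmodule.Build R L
  LscaleA Lscale1 LscaleDr LscaleDl.

Lemma LclassD (f g : F) : Lclass (f + g) = Lclass f + Lclass g.
Proof. by rewrite -Lclass_add. Qed.

Lemma LclassZ a (f : F) : Lclass (a *: f) = a *: Lclass f.
Proof. by rewrite -Lclass_scale. Qed.

Definition Lspace_norm (f : L) : R := fine 'N[mu]_p[EFin \o (f : T -> R)].

Lemma Lspace_norm_class (g : F) :
  Lspace_norm (Lclass g) = fine 'N[mu]_p[EFin \o g].
Proof.
rewrite /Lspace_norm -LreprE; congr fine; apply: ae_eq_Lnorm => //.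
exact: LclassK.
Qed.

Lemma Lspace_normD f g : Lspace_norm (f + g) <= Lspace_norm f + Lspace_norm g.
Proof.
elim/Lspace_ind: f => f; elim/Lspace_ind: g => g.
by rewrite -LclassD !Lspace_norm_class ler_LnormD.
Qed.

Lemma Lspace_normZ a f : Lspace_norm (a *: f) = `|a| * Lspace_norm f.
Proof.
elim/Lspace_ind: f => f; rewrite -LclassZ !Lspace_norm_class.
have := LnormZ f a; rewrite -finite_norm_fine => -/(congr1 fine) /= <-.
by [].
Qed.

Definition Lspace_snormed : snormedSpace R :=
  SNormedSpace Lspace_normD Lspace_normZ.

End Lspace_lmod.

(* Lebesgue measure on [R^n], as the iterated product of the one on [R] *)
Section lebesgue_tuple.
Context {R : realType}.

Definition tcons n (z : measurableTypeR R * n.-tuple R) : n.+1.-tuple R :=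
  [tuple of (z.1 : R) :: z.2].

Lemma measurable_tcons n : measurable_fun setT (@tcons n).
Proof.
apply: (@measurable_cons _ _ _ R (fst : measurableTypeR R * n.-tuple R -> R) n snd).
  exact: (@measurable_fst _ _ (measurableTypeR R) (n.-tuple R)).
exact: measurable_snd.
Qed.

Section succ.
Variables (n : nat) (m : {sigma_finite_measure set (n.-tuple R) -> \bar R}).
Local Open Scope ereal_scope.

Definition lebesgue_succ : set (n.+1.-tuple R) -> \bar R :=
  pushforward (lebesgue_measure \x m) (@tcons n).

Let succ0 : lebesgue_succ set0 = 0.
Proof. by rewrite /lebesgue_succ /pushforward preimage_set0 measure0. Qed.

Let succ_ge0 A : 0 <= lebesgue_succ A.
Proof. exact: (measure_ge0 (lebesgue_measure \x m)). Qed.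

Let succ_sigma_additive : semi_sigma_additive lebesgue_succ.
Proof.
move=> F mF tF mUF; rewrite /lebesgue_succ /pushforward preimage_bigcup.
have mtF i : measurable (@tcons n @^-1` F i).
  by rewrite -[X in measurable X]setTI; exact: measurable_tcons.
apply: measure_semi_sigma_additive => //; last exact: bigcupT_measurable.
apply/trivIsetP => /= i j _ _ ij; rewrite -preimage_setI.
by move/trivIsetP : tF => /(_ _ _ _ _ ij) ->//; rewrite preimage_set0.
Qed.

HB.instance Definition _ := isMeasure.Build _ _ _ lebesgue_succ
  succ0 succ_ge0 succ_sigma_additive.

Let succ_sigma_finite : sigma_finite setT lebesgue_succ.
Proof.
have /sigma_finiteP[F [TF ndF Foo]] := sigma_finiteT (@lebesgue_measure R).
have /sigma_finiteP[G [TG ndG Goo]] := sigma_finiteT m.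
exists (fun k => [set t : n.+1.-tuple R |
    F k (tnth t ord0) /\ G k [tuple of behead t]]).
  apply/esym/seteqP; split=> // t _.
  have [i _ Fi] : (\bigcup_i F i) (tnth t ord0) by rewrite -TF.
  have [j _ Gj] : (\bigcup_j G j) [tuple of behead t] by rewrite -TG.
  exists (maxn i j) => //; split.
    by move: Fi; exact/subsetPset/ndF/leq_maxl.
  by move: Gj; exact/subsetPset/ndG/leq_maxr.
move=> k; have [mF Fk] := Foo k; have [mG Gk] := Goo k; split.
  apply: measurableI.
    rewrite -[X in measurable X]setTI.
    exact: (@measurable_tnth _ R n.+1 ord0).
  rewrite -[X in measurable X]setTI.
  exact: (@measurable_behead _ R n).
rewrite /lebesgue_succ /pushforward (_ : _ @^-1` _ = F k `*` G k).
  by rewrite product_measure1E// lte_mul_pinfty// ge0_fin_numE.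
apply/seteqP; split=> -[x t] /=; rewrite /tcons tnth0/=.
  by move=> [Fx Gt]; split=> //; rewrite (_ : t = [tuple of behead (x :: t)]) //; exact: val_inj.
by move=> [Fx Gt]; split=> //; rewrite (_ : [tuple of behead (x :: t)] = t) //; exact: val_inj.
Qed.

HB.instance Definition _ := Measure_isSigmaFinite.Build _ _ _ lebesgue_succ
  succ_sigma_finite.

End succ.

Fixpoint lebesgue_tuple n : {sigma_finite_measure set (n.-tuple R) -> \bar R} :=
  if n is m.+1 then lebesgue_succ (lebesgue_tuple m) else \d_([tuple] : 0.-tuple R).

End lebesgue_tuple.

Section gaussian_measure.
Context {R : realType} (d : nat).
Local Notation leb := (@lebesgue_tuple R d).

Definition euclidean_norm (x : d.-tuple R) : R :=
  Num.sqrt (\sum_(j < d) tnth x j ^+ 2).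

Definition gauss_density (x : d.-tuple R) : R :=
  (2 * pi) `^ (- (d%:R / 2)) * expR (- (euclidean_norm x ^+ 2 / 2)).

Lemma gauss_density_ge0 x : 0 <= gauss_density x.
Proof. by rewrite mulr_ge0 ?powR_ge0 ?expR_ge0. Qed.

Lemma euclidean_normE x : euclidean_norm x ^+ 2 = \sum_(j < d) tnth x j ^+ 2.
Proof. by rewrite sqr_sqrtr// sumr_ge0// => j _; rewrite sqr_ge0. Qed.

Lemma gauss_densityE x : gauss_density x =
  (2 * pi) `^ (- (d%:R / 2)) * \prod_(j < d) expR (- (tnth x j ^+ 2 / 2)).
Proof.
by rewrite /gauss_density euclidean_normE mulr_suml -sumrN expR_sum.
Qed.

Lemma measurable_gauss_density : measurable_fun setT gauss_density.
Proof.
rewrite (_ : gauss_density = fun x => (2 * pi) `^ (- (d%:R / 2)) *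
    expR (- ((\sum_(j < d) tnth x j ^+ 2) / 2))); last first.
  by apply/funext => x; rewrite /gauss_density euclidean_normE.
apply: measurable_funM => //; apply: measurableT_comp => //.
apply: measurableT_comp => //; apply: measurable_funM => //.
apply: measurable_sum => j; apply: measurable_funX.
exact: measurable_tnth.
Qed.

Definition gaussian (A : set (d.-tuple R)) : \bar R :=
  (\int[leb]_(x in A) (gauss_density x)%:E)%E.

Let gaussian0 : gaussian set0 = 0%E.
Proof. by rewrite /gaussian integral_set0. Qed.

Let gaussian_ge0 A : (0 <= gaussian A)%E.
Proof. by apply: integral_ge0 => x _; rewrite lee_fin gauss_density_ge0. Qed.

Let gaussian_sigma_additive : semi_sigma_additive gaussian.
Proof.
move=> F mF tF mUF; rewrite /gaussian; apply: cvg_toP.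
  apply: ereal_nondecreasing_is_cvgn => m n mn.
  apply: lee_sum_nneg_natr => // k _ _; apply: integral_ge0 => x _.
  by rewrite lee_fin gauss_density_ge0.
rewrite ge0_integral_bigcup//.
- apply/measurable_funTS/measurable_EFinP; exact: measurable_gauss_density.
- by move=> x _; rewrite lee_fin gauss_density_ge0.
Qed.

HB.instance Definition _ := isMeasure.Build _ _ _ gaussian
  gaussian0 gaussian_ge0 gaussian_sigma_additive.

Import HBNNSimple.

Lemma ge0_integral_gaussian_le (f : d.-tuple R -> \bar R) :
  measurable_fun setT f -> (forall x, 0 <= f x)%E ->
  (\int[gaussian]_x f x <= \int[leb]_x (f x * (gauss_density x)%:E))%E.
Proof.
move=> mf f0; rewrite ge0_integralTE//; apply: ge_ereal_sup => _ [h hf <-].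
rewrite sintegralE.
have mg : measurable_fun setT (EFin \o gauss_density).
  apply/measurable_EFinP; exact: measurable_gauss_density.
have g0 x : (0 <= (gauss_density x)%:E)%E by rewrite lee_fin gauss_density_ge0.
have mi r : measurable_fun setT (fun x => (\1_(h @^-1` [set r]) x)%:E : \bar R).
  by apply/measurable_EFinP.
have mri r : measurable_fun setT
    (fun x => (r * \1_(h @^-1` [set r]) x)%:E : \bar R).
  by apply/measurable_EFinP; apply: measurable_funM => //; exact/measurable_EFinP/mi.
have E r : (r%:E * gaussian (h @^-1` [set r]) =
    \int[leb]_x ((r * \1_(h @^-1` [set r]) x)%:E * (gauss_density x)%:E))%E.
  have [r0|r0] := leP 0 r; last first.
    rewrite preimage_nnfun0// measure0 mule0 integral0_eq// => x _.
    by rewrite indicE in_set0 mulr0 mul0e.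
  under eq_integral do rewrite EFinM -muleA.
  rewrite ge0_integralZl//; last 2 first.
  - by apply: emeasurable_funM.
  - by move=> x _; rewrite mule_ge0// lee_fin.
  congr (_ * _)%E; rewrite /gaussian [LHS]integral_mkcond epatch_indic.
  by apply: eq_integral => x _; rewrite muleC.
under eq_fsbigr do rewrite E.
rewrite -ge0_integral_fsum//; last 2 first.
- by move=> r; apply: emeasurable_funM; [exact: mri|exact: mg].
- by move=> r x _; rewrite mule_ge0// nnfun_muleindic_ge0.
apply: ge0_le_integral => //.
- move=> x _; apply: fsume_ge0 => r _.
  by rewrite mule_ge0// nnfun_muleindic_ge0.
- apply: emeasurable_fsum => // r; apply: emeasurable_funM; [exact: mri|exact: mg].
- exact: emeasurable_funM.
- move=> x _; rewrite -ge0_mule_fsuml; last first.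
    by move=> r; exact: nnfun_muleindic_ge0.
  rewrite fsumEFin//. rewrite -(fimfunE h). exact: (lee_wpmul2r (g0 x) (hf x)).
Qed.

End gaussian_measure.

Section hermite.
Context {R : realType}.

Let w (x : R) : R := expR (- (x ^+ 2 / 2)).

(* normalized probabilists' Hermite polynomial, by Rodrigues' formula *)
Definition hermite (k : nat) (x : R) : R :=
  (-1) ^+ k / Num.sqrt k`!%:R * expR (x ^+ 2 / 2) *
  derive1n k (fun t : R => expR (- (t ^+ 2 / 2))) x.

Let is_derive_horner (p : {poly R}) (x : R) :
  is_derive x (1 : R) (horner p) (p^`()).[x].
Proof.
apply: DeriveDef; first exact: derivable_horner.
by rewrite -derive1E -derivE.
Qed.

Let w_is_derive (x : R) : is_derive x (1 : R) w (- x * w x).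
Proof.
have h := is_derive_horner (- 2^-1 *: 'X^2) x.
have -> : w = expR \o horner (- 2^-1 *: 'X^2).
  by apply/funext => t; rewrite /w /= hornerZ hornerXn mulNr mulrC.
have := @is_derive1_comp _ expR _ x _ _ (is_derive_expR _) h.
congr is_derive => /=; rewrite derivZ derivXn hornerZ hornerMn hornerXn. lra.
Qed.

Lemma hermite_poly k : exists p : {poly R}, forall x, hermite k x = p.[x].
Proof.
have [p Hp] : exists p : {poly R}, derive1n k w = (fun x => p.[x] * w x).
  elim: k => [|k [p Hp]].
    by exists 1; apply/funext => x; rewrite /derive1n/= hornerC mul1r.
  exists (p^`() - 'X * p); rewrite derive1nS Hp; apply/funext => x.
  rewrite derive1E.
  have -> : (fun x => p.[x] * w x) = (horner p) * w by [].
  have [_ ->] := is_deriveM (is_derive_horner p x) (w_is_derive x).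
  by rewrite !hornerE /GRing.scale/=; ring.
exists (((-1) ^+ k / Num.sqrt k`!%:R) *: p) => x.
rewrite /hermite -/w Hp hornerZ mulrACA.
by rewrite /w -expRD subrr expR0 mulr1.
Qed.

Lemma measurable_hermite k : measurable_fun setT (hermite k).
Proof.
have [p /funext ->] := hermite_poly k.
apply: continuous_measurable_fun => x.
exact/differentiable_continuous/derivable1_diffP/derivable_horner.
Qed.

Let exp_bound (m : nat) : exists2 C : R, 0 <= C &
  forall x : R, `|x| ^+ m <= C * expR (x ^+ 2 / 4).
Proof.
exists (1 + m.+1`!%:R * 4 ^+ m.+1) => [|x].
  by rewrite addr_ge0// mulr_ge0// exprn_ge0.
have e1 : 1 <= expR (x ^+ 2 / 4).
  by rewrite -[leLHS]expR0 ler_expR divr_ge0// sqr_ge0.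
rewrite mulrDl mul1r.
have [x1|x1] := leP `|x| 1.
  apply: (@le_trans _ _ 1); first by rewrite exprn_ile1.
  by rewrite (le_trans e1)// lerDl !mulr_ge0// ?exprn_ge0// expR_ge0.
have y0 : 0 <= x ^+ 2 / 4 by rewrite divr_ge0// sqr_ge0.
have := expR_ge1Dxn m y0; move: (expR _) e1 => e e1 h.
have {}h : (x ^+ 2) ^+ m.+1 <= m.+1`!%:R * 4 ^+ m.+1 * e.
  have : (x ^+ 2 / 4) ^+ m.+1 / m.+1`!%:R <= e by rewrite (le_trans _ h)// lerDr.
  rewrite ler_pdivrMr ?ltr0n ?fact_gt0// expr_div_n ler_pdivrMr ?exprn_gt0//.
  by move=> h'; apply: (le_trans h'); rewrite le_eqVlt; apply/orP; left; apply/eqP; ring.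
have : `|x| ^+ m <= (x ^+ 2) ^+ m.+1.
  rewrite -normrX -[x ^+ 2]ger0_norm ?sqr_ge0// !normrX -exprM.
  by rewrite ler_weXn2l// ?ltW// mulnS; lia.
lra.
Qed.

Let poly_bound (p : {poly R}) : exists2 C : R, 0 <= C &
  forall x : R, `|p.[x]| <= C * expR (x ^+ 2 / 4).
Proof.
have /choice[C HC] : forall m, exists C : R, 0 <= C /\
  forall x : R, `|x| ^+ m <= C * expR (x ^+ 2 / 4).
  by move=> m; have [C] := exp_bound m; exists C.
exists (\sum_(i < size p) `|p`_i| * C i) => [|x].
  by apply: sumr_ge0 => i _; rewrite mulr_ge0//; have [] := HC i.
rewrite horner_coef mulr_suml (le_trans (ler_norm_sum _ _ _))//.
apply: ler_sum => i _; rewrite normrM normrX -mulrA ler_wpM2l//.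
by have [] := HC i.
Qed.

Lemma hermite_sqr_integral k :
  (\int[@lebesgue_measure R]_x (hermite k x ^+ 2 * expR (- (x ^+ 2 / 2)))%:E
    < +oo)%E.
Proof.
have [p hp] := hermite_poly k.
have [C C0 hC] := poly_bound (p ^+ 2).
pose s : R := Num.sqrt 2.
have s2 : s ^+ 2 = 2 by rewrite sqr_sqrtr.
have s0 : s != 0 by rewrite gt_eqF// sqrtr_gt0.
have mN : measurable_fun setT (fun x : R => (normal_pdf 0 s x)%:E).
  by apply/measurable_EFinP; exact: measurable_normal_pdf.
have pk : 0 < normal_peak s by exact: normal_peak_gt0.
apply: (@le_lt_trans _ _ (\int[lebesgue_measure]_x
    ((C / normal_peak s)%:E * (normal_pdf 0 s x)%:E))%E).
  apply: ge0_le_integral => //.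
  - by move=> x _; rewrite lee_fin mulr_ge0 ?sqr_ge0 ?expR_ge0.
  - apply/measurable_EFinP; apply: measurable_funM.
      by apply: measurable_funX; exact: measurable_hermite.
    apply: measurableT_comp => //; apply: measurableT_comp => //.
    by apply: measurable_funM => //; exact: measurable_funX.
  - by apply: emeasurable_funM.
  - move=> x _; rewrite -EFinM lee_fin normal_pdfE// mulrA divfK ?gt_eqF//.
    rewrite /normal_fun subr0 s2 hp.
    have := hC x; rewrite horner_exp ger0_norm ?sqr_ge0// => h.
    apply: (@le_trans _ _ (C * expR (x ^+ 2 / 4) * expR (- (x ^+ 2 / 2)))).
      by rewrite ler_wpM2r ?expR_ge0.
    rewrite -mulrA -expRD ler_wpM2l// ler_expR.
    have -> : (2 : R) *+ 2 = 4 by ring.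
    lra.
rewrite ge0_integralZl//; first last.
- by rewrite lee_fin divr_ge0// ltW.
- by move=> x _; rewrite lee_fin normal_pdf_ge0.
by rewrite integral_normal_pdf mule1 ltry.
Qed.

End hermite.

Section hermite_tuple.
Context {R : realType}.

Lemma measurable_prod_tuple n (F : 'I_n -> R -> R) :
  (forall j, measurable_fun setT (F j)) ->
  measurable_fun setT (fun x : n.-tuple R => \prod_(j < n) F j (tnth x j)).
Proof.
move=> mF; apply: measurable_prod => j _.
by apply: measurableT_comp; [exact: mF|exact: measurable_tnth].
Qed.

Lemma lebesgue_prod_lty n (F : 'I_n -> R -> R) :
  (forall j x, 0 <= F j x) -> (forall j, measurable_fun setT (F j)) ->
  (forall j, \int[@lebesgue_measure R]_x (F j x)%:E < +oo)%E ->
  (\int[@lebesgue_tuple R n]_x (\prod_(j < n) F j (tnth x j))%:E < +oo)%E.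
Proof.
elim: n F => [|n IH] F F0 mF iF.
  rewrite /= integral_dirac//; last first.
    by apply/measurable_EFinP; exact: measurable_prod_tuple.
  by rewrite big_ord0 diracT mul1e ltry.
rewrite /= /lebesgue_succ ge0_integral_pushforward//; first last.
- by move=> x _; rewrite lee_fin prodr_ge0.
- by apply/measurable_EFinP; exact: measurable_prod_tuple.
- exact: measurable_tcons.
set m := lebesgue_tuple n.
pose G (t : n.-tuple R) : R := \prod_(j < n) F (lift ord0 j) (tnth t j).
have G0 t : 0 <= G t by exact: prodr_ge0.
have mG : measurable_fun setT G.
  by apply: (@measurable_prod_tuple n (fun j => F (lift ord0 j))).
rewrite preimage_setT.
rewrite (eq_integral (fun z : measurableTypeR R * n.-tuple R =>
    ((F ord0 z.1)%:E * (G z.2)%:E)%E)); last first.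
  move=> [x t] _; rewrite /= -EFinM big_ord_recl /tcons tnth0; congr (_ * _)%:E.
  by apply: eq_bigr => j _; rewrite tnthS.
have mF1 : measurable_fun setT (fun z : measurableTypeR R * n.-tuple R => (F ord0 z.1)%:E).
  apply/measurable_EFinP; apply: (measurableT_comp (mF ord0)).
  exact: (@measurable_fst _ _ (measurableTypeR R) (n.-tuple R)).
have mG2 : measurable_fun setT (fun z : measurableTypeR R * n.-tuple R => (G z.2)%:E).
  apply/measurable_EFinP; apply: (measurableT_comp mG).
  exact: (@measurable_snd _ _ (measurableTypeR R) (n.-tuple R)).
rewrite fubini_tonelli1//; first last.
- by move=> z; rewrite mule_ge0// lee_fin.
- exact: emeasurable_funM.
rewrite /fubini_F /=.
under eq_integral => x _.
  rewrite ge0_integralZl//; last 3 first.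
  - exact/measurable_EFinP.
  - by move=> t _; rewrite lee_fin.
  - by rewrite lee_fin.
  over.
rewrite ge0_integralZr//; first last.
- by apply: integral_ge0 => t _; rewrite lee_fin.
- by move=> x _; rewrite lee_fin.
- by apply/measurable_EFinP; exact: mF.
apply: lte_mul_pinfty.
- by apply: integral_ge0 => x _; rewrite lee_fin.
- rewrite ge0_fin_numE//.
  by apply: integral_ge0 => x _; rewrite lee_fin.
- exact: (IH (fun j => F (lift ord0 j))).
Qed.

Variable d : nat.

Definition hermite_tuple (k : d.-tuple nat) (x : d.-tuple R) : R :=
  \prod_(j < d) hermite (tnth k j) (tnth x j).

Lemma measurable_hermite_tuple k : measurable_fun setT (hermite_tuple k).
Proof.
exact: (@measurable_prod_tuple d (fun j => hermite (tnth k j))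
  (fun j => measurable_hermite _)).
Qed.

Lemma hermite_tuple_Lfun k : hermite_tuple k \in Lfun (@gaussian R d) 2%:E.
Proof.
rewrite inE; apply/andP; split; rewrite inE/=.
  exact: measurable_hermite_tuple.
rewrite /finite_norm unlock /Lnorm; apply: poweR_lty.
under eq_integral => x _.
  rewrite /= powR_mulrn// -normrX ger0_norm ?sqr_ge0//; over.
have m2 : measurable_fun setT (fun x => (hermite_tuple k x ^+ 2)%:E : \bar R).
  by apply/measurable_EFinP/measurable_funX; exact: measurable_hermite_tuple.
apply: le_lt_trans (ge0_integral_gaussian_le m2 _) _.
  by move=> x; rewrite lee_fin sqr_ge0.
pose F (j : 'I_d) (x : R) := hermite (tnth k j) x ^+ 2 * expR (- (x ^+ 2 / 2)).
have F0 j x : 0 <= F j x by rewrite mulr_ge0 ?sqr_ge0 ?expR_ge0.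
have mF j : measurable_fun setT (F j).
  apply: measurable_funM.
    by apply: measurable_funX; exact: measurable_hermite.
  apply: measurableT_comp => //; apply: measurableT_comp => //.
  by apply: measurable_funM => //; exact: measurable_funX.
rewrite (eq_integral (fun x => ((2 * pi) `^ (- (d%:R / 2)))%:E *
    (\prod_(j < d) F j (tnth x j))%:E)%E); last first.
  move=> x _; rewrite gauss_densityE -!EFinM mulrCA; congr (_ * _)%:E.
  by rewrite /hermite_tuple -prodrXl -big_split.
rewrite ge0_integralZl//; first last.
- by rewrite lee_fin powR_ge0.
- by move=> x _; rewrite lee_fin prodr_ge0.
- by apply/measurable_EFinP; exact: measurable_prod_tuple.
apply: lte_mul_pinfty; rewrite ?lee_fin ?powR_ge0//.
apply: lebesgue_prod_lty => // j; exact: hermite_sqr_integral.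
Qed.

End hermite_tuple.

Lemma esumZl_EFin (R : realType) (I : choiceType) (c : R) (a : I -> \bar R) :
  0 <= c -> (forall i, 0 <= a i)%E ->
  (\esum_(i in [set: I]) (c%:E * a i) = c%:E * \esum_(i in [set: I]) a i)%E.
Proof.
have le (c' : R) (b : I -> \bar R) : 0 <= c' -> (forall i, 0 <= b i)%E ->
    (\esum_(i in [set: I]) (c'%:E * b i) <= c'%:E * \esum_(i in [set: I]) b i)%E.
  move=> c0 b0; apply: ge_ereal_sup => _ [X [finX _] <-].
  rewrite -ge0_mule_fsumr//; apply: lee_wpmul2l; first by rewrite lee_fin.
  by apply: ereal_sup_ubound; exists X.
move=> c0 a0; apply/eqP; rewrite eq_le le//=.
have [->|cn0] := eqVneq c 0.
  by rewrite mul0e esum_ge0// => i _; rewrite mul0e.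
have c_gt0 : 0 < c by rewrite lt_neqAle eq_sym cn0.
have cK (y : \bar R) : (c^-1%:E * (c%:E * y) = y)%E.
  by rewrite muleA -EFinM mulVf// mul1e.
have := @le c^-1 (fun i => c%:E * a i)%E.
rewrite invr_ge0 => /(_ c0 (fun i => mule_ge0 (c0 : 0 <= c%:E)%E (a0 i))).
under eq_esum do rewrite cK.
move=> /(lee_wpmul2l (c0 : 0 <= c%:E)%E) /le_trans; apply.
by rewrite muleA -EFinM mulfV// mul1e.
Qed.

Lemma ler_add_of_sqr (R : realType) (c a b : R) :
  0 <= c -> 0 <= a -> 0 <= b ->
  (forall t, 0 < t -> c ^+ 2 <= (1 + t) * a ^+ 2 + (1 + t^-1) * b ^+ 2) ->
  c <= a + b.
Proof.
move=> c0 a0 b0 h; apply/ler_addgt0Pr => e e0.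
set A := a + e / 2; set B := b + e / 2.
have A0 : 0 < A by rewrite /A; lra.
have B0 : 0 < B by rewrite /B; lra.
have BA : 0 < B / A by rewrite divr_gt0.
have AB0 : 0 <= a + b + e by lra.
rewrite -(@ler_pXn2r _ 2)// ?nnegrE//; apply: le_trans (h _ BA) _.
have -> : a + b + e = A + B by rewrite /A /B; lra.
have -> : (A + B) ^+ 2 = (1 + B / A) * A ^+ 2 + (1 + (B / A)^-1) * B ^+ 2.
  by field; rewrite !gt_eqF.
have i0 : 0 < (B / A)^-1 by rewrite invr_gt0.
apply: lerD; apply: ler_wpM2l.
- by rewrite addr_ge0 ?ltW.
- by rewrite ler_pXn2r ?nnegrE//; [rewrite /A; lra|exact: ltW].
- by rewrite addr_ge0 ?ltW.
- by rewrite ler_pXn2r ?nnegrE//; [rewrite /B; lra|exact: ltW].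
Qed.

Section hermite_space.
Context {R : realType} (d : nat) (alpha : R).
Local Notation gauss := (@gaussian R d).
Local Notation L := (LspaceType2 gauss).

Definition hermite_coef (f : L) (k : d.-tuple nat) : R :=
  \int[gauss]_x ((f : d.-tuple R -> R) x * hermite_tuple k x).

Definition hermite_weight (k : d.-tuple nat) : R :=
  \prod_(j < d) (tnth k j).+1%:R `^ alpha.

Definition hermite_energy (f : L) : \bar R :=
  \esum_(k in [set: d.-tuple nat])
    (hermite_weight k * `|hermite_coef f k| ^+ 2)%:E.

Let integrable_coef (f : LfunType gauss (lee1n 2)) k :
  gauss.-integrable setT (EFin \o (fun x => f x * hermite_tuple k x)).
Proof.
apply/Lfun1_integrable; apply: Lfun2_mul_Lfun1; first exact: LfunP.
exact: hermite_tuple_Lfun.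
Qed.

Lemma hermite_coef_class (g : LfunType gauss (lee1n 2)) k :
  hermite_coef (Lclass g) k = \int[gauss]_x (g x * hermite_tuple k x).
Proof.
congr fine; apply: ae_eq_integral => //.
- exact: measurable_int (integrable_coef (Lrepr (Lclass g)) k).
- exact: measurable_int (integrable_coef g k).
- have := LclassK g.
  by apply: filterS => x /= gx _; rewrite gx.
Qed.

Lemma hermite_coefD f g k :
  hermite_coef (f + g) k = hermite_coef f k + hermite_coef g k.
Proof.
elim/Lspace_ind: f => f; elim/Lspace_ind: g => g.
rewrite -LclassD !hermite_coef_class -RintegralD//.
by apply: eq_Rintegral => x _; rewrite /= mulrDl.
Qed.

Lemma hermite_coefZ a f k : hermite_coef (a *: f) k = a * hermite_coef f k.
Proof.
elim/Lspace_ind: f => f.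
rewrite -LclassZ !hermite_coef_class -RintegralZl//.
by apply: eq_Rintegral => x _; rewrite /= mulrA.
Qed.

Lemma hermite_weight_ge0 k : 0 <= hermite_weight k.
Proof. by apply: prodr_ge0 => j _; rewrite powR_ge0. Qed.

Let term_ge0 f k : (0 <= (hermite_weight k * `|hermite_coef f k| ^+ 2)%:E)%E.
Proof. by rewrite lee_fin mulr_ge0 ?hermite_weight_ge0// exprn_ge0. Qed.

Lemma hermite_energy_ge0 f : (0 <= hermite_energy f)%E.
Proof. by apply: esum_ge0 => k _; exact: term_ge0. Qed.

Lemma hermite_energyZ a f :
  hermite_energy (a *: f) = ((a ^+ 2)%:E * hermite_energy f)%E.
Proof.
rewrite /hermite_energy -(esumZl_EFin (sqr_ge0 a) (term_ge0 f)).
apply: eq_esum => k _; rewrite hermite_coefZ -EFinM; congr (_%:E).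
by rewrite normrM exprMn mulrCA; congr (_ * _); rewrite real_normK ?num_real.
Qed.

Lemma hermite_energyD (t : R) f g : 0 < t ->
  (hermite_energy (f + g)%R <=
   (1 + t)%:E * hermite_energy f + (1 + t^-1)%:E * hermite_energy g)%E.
Proof.
move=> t0; have ti0 : 0 < t^-1 by rewrite invr_gt0.
have t1 : 0 <= 1 + t by rewrite addr_ge0// ltW.
have ti1 : 0 <= 1 + t^-1 by rewrite addr_ge0// ltW.
rewrite /hermite_energy -(esumZl_EFin t1 (term_ge0 f)).
rewrite -(esumZl_EFin ti1 (term_ge0 g)) -esumD; first last.
- by move=> k _; rewrite mule_ge0// lee_fin.
- by move=> k _; rewrite mule_ge0// lee_fin.
apply: le_esum => k _; rewrite -!EFinM -EFinD lee_fin hermite_coefD.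
rewrite !(mulrCA _ (hermite_weight k)) -mulrDr ler_wpM2l ?hermite_weight_ge0//.
rewrite !real_normK ?num_real//.
move: (hermite_coef f k) (hermite_coef g k) => x y.
have : 0 <= t^-1 * (t * x - y) ^+ 2 by rewrite mulr_ge0 ?sqr_ge0 ?ltW.
suff -> : t^-1 * (t * x - y) ^+ 2 = t * x ^+ 2 - 2 * x * y + t^-1 * y ^+ 2.
  nra.
by field; rewrite gt_eqF.
Qed.

Definition hermite_pred : {pred L} := fun f => (hermite_energy f < +oo)%E.

Lemma hermite_submod_closed : submod_closed hermite_pred.
Proof.
have scale a f : f \in hermite_pred -> a *: f \in hermite_pred.
  rewrite /in_mem /= /hermite_pred => h; rewrite hermite_energyZ.
  by apply: lte_mul_pinfty => //; rewrite ?lee_fin ?sqr_ge0.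
split.
  have : (0 : R) *: (0 : L) \in hermite_pred.
    rewrite /in_mem /= /hermite_pred hermite_energyZ expr0n mul0e; exact: ltry.
  by rewrite scale0r.
move=> a f g /(scale a) hf hg; rewrite /in_mem /= /hermite_pred.
apply: le_lt_trans (hermite_energyD _ _ (@ltr01 R)) _.
by apply: lte_add_pinfty; apply: lte_mul_pinfty; rewrite ?lee_fin ?addr_ge0//
  ?invr_ge0//; move: hf hg; rewrite /in_mem.
Qed.

HB.instance Definition _ := GRing.isSubmodClosed.Build _ _ hermite_pred
  hermite_submod_closed.

Record hermite_space := HermiteSpace {
  hermite_val : L;
  hermite_valP : hermite_val \in hermite_pred }.

HB.instance Definition _ := [isSub for hermite_val].
HB.instance Definition _ := [Choice of hermite_space by <:].
HB.instance Definition _ := [SubChoice_isSubLmodule of hermite_space by <:].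

Definition hermite_norm (f : hermite_space) : R :=
  Num.sqrt (fine (hermite_energy (hermite_val f))).

Let hfin (f : hermite_space) : hermite_energy (hermite_val f) =
  (hermite_norm f ^+ 2)%:E.
Proof.
rewrite /hermite_norm sqr_sqrtr ?fine_ge0 ?hermite_energy_ge0// fineK//.
by rewrite ge0_fin_numE ?hermite_energy_ge0//; exact: hermite_valP.
Qed.

Lemma hermite_normZ a f : hermite_norm (a *: f) = `|a| * hermite_norm f.
Proof.
rewrite {1}/hermite_norm (_ : hermite_val _ = a *: hermite_val f)//.
rewrite hermite_energyZ hfin -EFinM/= -exprMn sqrtr_sqr normrM.
by rewrite [`|hermite_norm f|]ger0_norm// sqrtr_ge0.
Qed.

Lemma hermite_normD f g :
  hermite_norm (f + g) <= hermite_norm f + hermite_norm g.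
Proof.
apply: ler_add_of_sqr; rewrite ?sqrtr_ge0// => t t0.
have := hermite_energyD (hermite_val f) (hermite_val g) t0.
by rewrite (_ : hermite_val f + _ = hermite_val (f + g))// !hfin -!EFinM -EFinD.
Qed.

End hermite_space.

Section spaces.
Context (R : realType).

Definition L2_gauss (d : nat) : snormedSpace R :=
  Lspace_snormed (@gaussian R d) (lee1n 2).

(* the only null set of the counting measure is the empty set, hence the
   classes are singletons *)
Definition ell2 : snormedSpace R :=
  Lspace_snormed (@counting nat R) (lee1n 2).

Definition hermite_snormed (d : nat) (alpha : R) : snormedSpace R :=
  SNormedSpace (@hermite_normD R d alpha) (@hermite_normZ R d alpha).

Definition embedding (d : nat) (alpha : R) (f : hermite_snormed d alpha) :
  L2_gauss d := hermite_val f.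

Let embedding_is_linear d alpha : linear (@embedding d alpha).
Proof. by []. Qed.

HB.instance Definition _ d alpha :=
  GRing.isLinear.Build R (hermite_snormed d alpha) (L2_gauss d) _
    (@embedding d alpha) (@embedding_is_linear d alpha).

End spaces.
Arguments embedding {R} d alpha f.

Section weyl.
Context {R : realType} {X Y : snormedSpace R}.

Definition weyl_number (T : {linear X -> Y}) (n : nat) : \bar R :=
  ereal_sup [set approximation_number (T \o A) n |
    A in [set A : {linear ell2 R -> X} | is_bounded A /\ (opnorm A <= 1)%E]].

End weyl.

(* [s_d] stands for the Kolmogorov numbers *)
Inductive s_kind := s_a | s_b | s_c | s_d | s_e | s_x.

Definition s_number {R : realType} {X Y : snormedSpace R} (s : s_kind)
    (T : {linear X -> Y}) (n : nat) : \bar R :=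
  match s with
  | s_a => approximation_number T n
  | s_b => bernstein_number T n
  | s_c => gelfand_number T n
  | s_d => kolmogorov_number T n
  | s_e => entropy_number T n
  | s_x => weyl_number T n
  end.

Definition lesssim {R : realType} (A B : nat -> \bar R) :=
  exists2 C : R, 0 < C & \forall n \near \oo, (A n <= C%:E * B n)%E.

Definition asymp {R : realType} (A B : nat -> \bar R) :=
  lesssim A B /\ lesssim B A.

(* Main.v *)
Require Import Defs.
From HB Require Import structures.
From mathcomp Require Import all_boot all_order all_algebra.
From mathcomp Require Import all_classical all_reals all_analysis.
From mathcomp Require Import measurable_realfun ring lra zify.
Import Order.TTheory GRing.Theory Num.Theory.
Import numFieldNormedType.Exports.
Local Open Scope classical_set_scope.
Local Open Scope ring_scope.
Set Implicit Arguments.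
Unset Strict Implicit.
Unset Printing Implicit Defensive.

(** The Hermite functions diagonalize the embedding: on coefficients it is the
    identity from the weighted space, with weights the powers of order alpha of
    the products of the k_j + 1, into the unweighted square summable sequences.
    Its singular values are therefore the numbers pi(k) ^ (- alpha / 2), where
    pi(k) is the product of the k_j + 1, listed in decreasing order.  Three
    ingredients give the theorem.

    Analysis: the Hermite functions are orthonormal and complete for the Gaussian
    measure, so that the L2 norm is the sum of squares of the coefficients
    ([parseval]).  Orthonormality is integration by parts in one variable and
    Fubini.  For completeness, let W be the set of the L2 limits of polynomials,
    and call a bounded function a multiplier when multiplication by it preserves
    W.  Multipliers form an algebra closed under bounded pointwise limits, so
    the sets with multiplier indicator form a sigma-algebra.  The functions
    (x_j - s) exp (- x_j ^ 2 / 8) are multipliers, because the Taylor series of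
    the exponential converges in L2 after multiplication by any polynomial, and
    the indicator of the positivity set of a multiplier is again one.  Hence all
    half-spaces, then all measurable sets belong to the sigma-algebra, W contains
    the simple functions, and W is everything ([hermite_dense]).  Density in this
    form yields Parseval by best approximation, without completeness of L2.

    Operator theory: if n indices of a diagonal operator have weight at most t
    and all indices outside n - 1 of them have weight at least t, then its n-th
    approximation, Bernstein, Gelfand, Kolmogorov and Weyl numbers all equal
    t ^ (- 1 / 2) ([diag_s_number]).  The upper bounds use the projection on the
    n - 1 coordinates.  The lower bounds find, by counting dimensions, a nonzero
    combination of the n basis vectors in the kernel, subspace or orthogonal
    complement at hand.  For entropy numbers, the signed sums of 4 n basis
    vectors are too many and too far apart for a cover by small balls
    ([diag_entropy_ge]), and rounding the coordinates to a grid gives an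
    economical cover ([diag_entropy_le]).

    Counting: the number N(T) of multi-indices in d + 1 variables with pi(k) at
    most T lies, by induction on d with a telescoping comparison of sums of
    logarithms, between explicit bounds equivalent to T (ln T) ^ d / d!
    ([hcount_upper], [hcount_lower]).  The n-th singular value is
    T_n ^ (- alpha / 2) with T_n the least T such that N(T) is at least n, and
    inverting the asymptotics gives T_n (ln n) ^ d / n --> d! ([hthr_limit]).
    This is the limit in the theorem.  For entropy numbers, the same asymptotics
    together with the bound 4 ^ N(T) on the product of the quotients T / pi(k)
    ([prod_hcross]) make the size of the grid exponential in N(T), so that the
    entropy numbers follow the singular values up to constants. *)

(** * Counting multi-indices in hyperbolic crosses *)

Section hyperbolic_cross.
Local Open Scope nat_scope.

Definition hprod d (k : d.-tuple nat) := \prod_(j < d) (tnth k j).+1.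

(** The hyperbolic cross, enumerated by its first coordinate: the other
    coordinates range over a cross of parameter T / (m + 1).  With no coordinate
    the product is 1, hence the test on T. *)
Fixpoint hcross d T : seq (d.-tuple nat) :=
  if d is d'.+1 then
    [seq cons_tuple m k | m <- iota 0 T, k <- hcross d' (T %/ m.+1)]
  else if 0 < T then [:: [tuple]] else [::].

Lemma hprod_gt0 d (k : d.-tuple nat) : 0 < hprod k.
Proof. by apply: prodn_gt0. Qed.

Lemma hprod_cons d m (k : d.-tuple nat) : hprod (cons_tuple m k) = m.+1 * hprod k.
Proof.
rewrite /hprod big_ord_recl tnth0; congr (_ * _).
by apply: eq_bigr => j _; rewrite tnthS.
Qed.

Lemma mem_hcross d T (k : d.-tuple nat) : (k \in hcross d T) = (hprod k <= T).
Proof.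
elim: d T k => [|d IH] T k.
  rewrite tuple0 /hprod big_ord0 /=; case: ltnP => // T0; rewrite inE //.
case/tupleP: k => m k; rewrite hprod_cons mulnC -leq_divRL// -IH /=.
apply/allpairsPdep/idP => [[m' [k' [_ k'T E]]]|kT].
  have Em := congr1 (fun t => tnth t ord0) E; rewrite !tnth0 in Em.
  suff -> : k = k' by rewrite Em.
  apply: val_inj; by have := congr1 (fun t => behead (val t)) E.
exists m, k; split=> //; rewrite mem_iota /=.
move: kT; rewrite IH => kT; have := leq_trans (hprod_gt0 k) kT.
by rewrite divn_gt0.
Qed.

Lemma hcross_uniq d T : uniq (hcross d T).
Proof.
elim: d T => [|d IH] T /=; first by case: ifP.
apply: allpairs_uniq_dep => [|m _|[m k] [m' k'] _ _ /= E]; rewrite ?iota_uniq ?IH//.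
have Em := congr1 (fun t => tnth t ord0) E; rewrite !tnth0 in Em; rewrite Em in E *.
congr (existT _ _ _); apply: val_inj; by have := congr1 (fun t => behead (val t)) E.
Qed.

Definition hcount d T := size (hcross d T).

Lemma hcountS d T : hcount d.+1 T = \sum_(m < T) hcount d (T %/ m.+1).
Proof.
rewrite /hcount /= size_allpairs_dep sumnE big_map -(big_mkord xpredT (fun m => size (hcross d (T %/ m.+1)))).
by rewrite /index_iota subn0.
Qed.

Lemma hcount1 T : hcount 1 T = T.
Proof.
rewrite hcountS (eq_bigr (fun=> 1)) ?sum1_card ?card_ord// => m _.
by rewrite /hcount /= divn_gt0// ltn_ord.
Qed.

Arguments hcross : simpl never.

Lemma leq_hcount d S T : S <= T -> hcount d S <= hcount d T.
Proof.
move=> ST; apply: uniq_leq_size (hcross_uniq d S) _ => k.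
by rewrite !mem_hcross => /leq_trans; apply.
Qed.

Lemma hcount_0 d : hcount d 0 = 0.
Proof. by case: d => [//|d]; rewrite hcountS big_ord0. Qed.

Lemma hcount_ge d T : T <= hcount d.+1 T.
Proof.
rewrite hcountS -[X in X <= _]card_ord -sum1_card; apply: leq_sum => m _.
apply: (@leq_trans (hcount d 1)); last by rewrite leq_hcount// divn_gt0.
suff : nseq_tuple d 0 \in hcross d 1 by rewrite /hcount; case: (hcross d 1).
by rewrite mem_hcross /hprod big1// => j _; rewrite tnth_nseq.
Qed.

(** In one variable this is the definition of the quotient; the recursion on the
    number of variables preserves it, as successive quotients commute. *)
Lemma hcount_divn d T m : 0 < m -> m * hcount d.+1 (T %/ m) <= hcount d.+1 T.
Proof.
move=> m0; elim: d T => [|d IH] T; first by rewrite !hcount1 mulnC leq_trunc_div.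
rewrite [hcount d.+2 T]hcountS hcountS big_distrr /=.
have Tm : T %/ m <= T by rewrite leq_div.
rewrite (big_ord_widen _ (fun i => m * hcount d.+1 (T %/ m %/ i.+1)) Tm) big_mkcond /=.
apply: leq_sum => i _; case: ifP => // _.
by rewrite -divnMA [m * i.+1]mulnC divnMA; exact: IH.
Qed.

Lemma sum_halves N J : \sum_(j < J) N %/ 2 ^ j.+1 <= N.
Proof.
suff : \sum_(j < J) N %/ 2 ^ j.+1 + N %/ 2 ^ J <= N by apply: leq_trans; exact: leq_addr.
elim: J => [|J IH]; first by rewrite big_ord0 expn0 divn1.
rewrite big_ord_recr /=; apply: leq_trans IH; rewrite -addnA leq_add2l.
have := leq_trunc_div (N %/ 2 ^ J) 2; rewrite -divnMA -expnSr; lia.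
Qed.

(** The product of the T / pi(k) over the cross is at most exponential in the
    number of its elements: T / pi(k) is at most 2 ^ (L(k) + 1), where L(k) counts
    the j > 0 with 2 ^ j pi(k) <= T, and by [hcount_divn] the sum of the L(k) is at
    most the sum of the N / 2 ^ j, that is N. *)
Lemma prod_hcross d T :
  T ^ hcount d.+1 T <= 4 ^ hcount d.+1 T * \prod_(k <- hcross d.+1 T) hprod k.
Proof.
set N := hcount _ _.
pose L (k : d.+1.-tuple nat) := trunc_log 2 (T %/ hprod k).
have Llog k : k \in hcross d.+1 T -> T <= hprod k * 2 ^ (L k).+1 /\
    L k <= \sum_(j < T) (hprod k <= T %/ 2 ^ j.+1).
  rewrite mem_hcross => kT; have P0 := hprod_gt0 k.
  have q0 : 0 < T %/ hprod k by rewrite divn_gt0.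
  have /andP[h1 h2] := trunc_log_bounds (ltnSn 1) q0; rewrite -/(L k) in h1 h2.
  split; first by move: h2; rewrite ltn_divLR// mulnC => /ltnW.
  have LT : L k <= T.
    have := ltn_expl (L k) (ltnSn 1); have := leq_div T (hprod k); lia.
  apply: (@leq_trans (\sum_(j < L k) 1)); first by rewrite sum1_card card_ord.
  rewrite (big_ord_widen _ (fun=> 1) LT) big_mkcond; apply: leq_sum => j _.
  case: ifP => // jL; rewrite leq_divRL ?expn_gt0// mulnC -leq_divRL//.
  by rewrite (leq_trans _ h1)// leq_exp2l.
have sumL : \sum_(k <- hcross d.+1 T) L k <= N.
  apply: (@leq_trans (\sum_(k <- hcross d.+1 T) \sum_(j < T) (hprod k <= T %/ 2 ^ j.+1))).
    rewrite big_seq [X in _ <= X]big_seq; apply: leq_sum => k /Llog[] //.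
  rewrite exchange_big /=; apply: leq_trans (sum_halves N T); apply: leq_sum => j _.
  rewrite leq_divRL ?expn_gt0// mulnC.
  apply: leq_trans (hcount_divn d T (expn_gt0 2 j.+1)).
  rewrite leq_mul2l; apply/orP; right.
  rewrite (eq_bigr (fun k => if hprod k <= T %/ 2 ^ j.+1 then 1 else 0)); last by move=> k _; case: leqP.
  rewrite -big_mkcond sum1_count -size_filter; apply: uniq_leq_size => [|k].
    by rewrite filter_uniq// hcross_uniq.
  by rewrite mem_filter !mem_hcross => /andP[].
have -> : T ^ N = \prod_(k <- hcross d.+1 T) T.
  by rewrite big_const_seq count_predT iter_muln_1.
apply: (@leq_trans (\prod_(k <- hcross d.+1 T) (hprod k * 2 ^ (L k).+1))).
  rewrite big_seq [X in _ <= X]big_seq; apply: leq_prod => k /Llog[] //.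
rewrite big_split /= mulnC leq_mul2r -expn_sum; apply/orP; right.
rewrite (_ : 4 = 2 ^ 2)// -expnM leq_exp2l//.
rewrite (eq_bigr (fun k => L k + 1)); last by move=> k _; rewrite addn1.
by rewrite big_split /= sum1_size mul2n -addnn leq_add2r.
Qed.

End hyperbolic_cross.
Arguments hcross : simpl never.

Section hyperbolic_cross_bounds.
Context {R : realType}.
Implicit Types (x a b eps : R).

(** Tangent bounds for the convex power function, here and in the next lemma: they
    compare the sums of the induction below with telescoping ones. *)
Lemma subrXX_ge n a b : 0 <= b -> b <= a ->
  n.+1%:R * b ^+ n * (a - b) <= a ^+ n.+1 - b ^+ n.+1.
Proof.
move=> b0 ba; have a0 := le_trans b0 ba; elim: n => [|n IH].
  by rewrite expr0 !expr1 mulr1 mul1r.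
have bn : 0 <= b ^+ n.+1 by rewrite exprn_ge0.
rewrite -natr1 [a ^+ n.+2]exprS [b ^+ n.+2]exprS.
have : b ^+ n.+1 * (a - b) <= a * (a ^+ n.+1 - b ^+ n.+1) - n.+1%:R * b ^+ n.+1 * (a - b) + b ^+ n.+1 * (a - b).
  rewrite lerDr subr_ge0 [b ^+ n.+1]exprS.
  apply: (@le_trans _ _ (b * (n.+1%:R * b ^+ n * (a - b)))).
    by rewrite le_eqVlt; apply/orP; left; apply/eqP; ring.
  apply: (@le_trans _ _ (b * (a ^+ n.+1 - b ^+ n.+1))); first by rewrite ler_wpM2l// IH.
  by rewrite -exprS ler_wpM2r// subr_ge0 lerXn2r.
by nra.
Qed.

Lemma subrXX_le n a b : 0 <= b -> b <= a ->
  a ^+ n.+1 - b ^+ n.+1 <= n.+1%:R * a ^+ n * (a - b).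
Proof.
move=> b0 ba; have a0 := le_trans b0 ba; elim: n => [|n IH].
  by rewrite expr0 !expr1 mulr1 mul1r.
have h : a * (a ^+ n.+1 - b ^+ n.+1) <= a * (n.+1%:R * a ^+ n * (a - b)) by rewrite ler_wpM2l.
have h2 : b ^+ n.+1 * (a - b) <= a ^+ n.+1 * (a - b) by rewrite ler_wpM2r ?subr_ge0// lerXn2r.
rewrite -natr1 [a ^+ n.+2]exprS [b ^+ n.+2]exprS.
have e : a * (n.+1%:R * a ^+ n * (a - b)) = n.+1%:R * a ^+ n.+1 * (a - b) by rewrite exprS; ring.
by rewrite e in h; nra.
Qed.

Lemma ln_succ_le (m : nat) : ln (m.+2%:R / m.+1%:R) <= m.+1%:R^-1 :> R.
Proof.
have m0 : (0 : R) < m.+1%:R by rewrite ltr0n.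
have -> : m.+2%:R / m.+1%:R = 1 + m.+1%:R^-1 :> R.
  by rewrite -natr1 mulrDl mulfV ?gt_eqF// mul1r.
by apply: le_ln1Dx; rewrite (@lt_trans _ _ 0)// invr_gt0.
Qed.

Lemma ln_succ_ge (m : nat) : m.+2%:R^-1 <= ln (m.+2%:R / m.+1%:R) :> R.
Proof.
have m0 : (0 : R) < m.+1%:R by rewrite ltr0n.
have m2 : (0 : R) < m.+2%:R by rewrite ltr0n.
rewrite -[m.+2%:R / _]invrK lnV ?posrE ?invr_gt0 ?divr_gt0// lerNr.
have -> : (m.+2%:R / m.+1%:R)^-1 = 1 + (- m.+2%:R^-1) :> R.
  by rewrite invf_div -[- m.+2%:R^-1]mulN1r -[X in _ = X + _](mulfV (lt0r_neq0 m2)) -mulrDl; congr (_ / _); rewrite -[m.+2%:R]natr1 addrK.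
apply: le_ln1Dx; rewrite ltrN2 invf_lt1// ltr1n//.
Qed.

(** By the recursion, the count in d + 1 variables is a sum over m of terms
    (x / m) v_m ^ d / d! with v_m = ln (x / m) + d.  Each term with m > 1 is at most
    the increment of x v ^ (d + 1) / (d + 1)! between m and m - 1, so the sum
    telescopes; the term m = 1 is absorbed by the passage from d to d + 1 inside
    the power. *)
Lemma hcount_upper d q x : 1 <= x -> q%:R <= x ->
  (hcount d.+1 q)%:R <= x * (ln x + d%:R) ^+ d / d`!%:R.
Proof.
elim: d q x => [|d IH] q x x1 qx; first by rewrite hcount1 expr0 mulr1 divr1.
have x0 : 0 < x by exact: lt_le_trans x1.
rewrite hcountS natr_sum.
pose v (m : nat) : R := ln (x / m.+1%:R) + d%:R.
have v_ge0 m : (m < q)%N -> 0 <= v m.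
  move=> mq; rewrite /v addr_ge0 ?ler0n// ln_ge0// ler_pdivlMr ?ltr0n// mul1r.
  by apply: le_trans qx; rewrite ler_nat.
have vS m : v m - v m.+1 = ln (m.+2%:R / m.+1%:R).
  rewrite /v !ln_div ?posrE ?ltr0n//; ring.
have f0 k : (0 : R) < k`!%:R by rewrite ltr0n fact_gt0.
have S m : (m < q)%N -> \sum_(i < m.+1) i.+1%:R^-1 * v i ^+ d <=
    v 0 ^+ d + (v 0 ^+ d.+1 - v m ^+ d.+1) / d.+1%:R.
  elim: m => [|m IHm] mq; first by rewrite big_ord_recl big_ord0 /= invr1 mul1r subrr mul0r.
  rewrite big_ord_recr /=; apply: le_trans (lerD (IHm (ltnW mq)) (lexx _)) _.
  rewrite -addrA lerD2l -lerBrDl -mulrBl ler_pdivlMr ?ltr0n//.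
  have vle : v m.+1 <= v m by rewrite -subr_ge0 vS (le_trans _ (ln_succ_ge m))// invr_ge0.
  apply: le_trans (le_trans (subrXX_ge d (v_ge0 _ mq) vle) _).
    rewrite vS -mulrA [leLHS]mulrC ler_wpM2l// mulrC ler_wpM2l ?exprn_ge0 ?v_ge0//.
    exact: ln_succ_ge.
  by rewrite le_eqVlt; apply/orP; left; apply/eqP; ring.
apply: (@le_trans _ _ (x / d`!%:R * \sum_(m < q) m.+1%:R^-1 * v m ^+ d)).
  rewrite mulr_sumr; apply: ler_sum => m _.
  have y1 : 1 <= x / m.+1%:R.
    rewrite ler_pdivlMr ?ltr0n// mul1r; apply: le_trans qx; rewrite ler_nat; exact: ltn_ord.
  apply: le_trans (IH _ (x / m.+1%:R) y1 _) _.
    rewrite ler_pdivlMr ?ltr0n// -natrM; apply: le_trans qx.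
    by rewrite ler_nat leq_trunc_div.
  by rewrite le_eqVlt; apply/orP; left; apply/eqP; rewrite /v; ring.
have v0E : v 0 = ln x + d%:R by rewrite /v divr1.
have -> : ln x + d.+1%:R = v 0 + 1 by rewrite v0E -natr1 addrA.
have v00 : 0 <= v 0 by rewrite v0E addr_ge0 ?ler0n// ln_ge0.
apply: (@le_trans _ _ (x / d`!%:R * ((v 0 + 1) ^+ d.+1 / d.+1%:R))).
  apply: ler_wpM2l; first by rewrite divr_ge0 ?ltW.
  case: q qx v_ge0 S => [|q] qx v_ge0 S.
    by rewrite big_ord0 divr_ge0 ?ler0n// exprn_ge0// addr_ge0.
  apply: le_trans (S q (ltnSn q)) _; rewrite ler_pdivlMr ?ltr0n// mulrDl divfK ?pnatr_eq0//.
  have h1 := @subrXX_ge d (v 0 + 1) (v 0) v00; rewrite lerDl ler01 in h1.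
  have e1 : v 0 + 1 - v 0 = 1 by ring.
  have := h1 isT; rewrite e1 mulr1.
  have := exprn_ge0 d.+1 (v_ge0 q (ltnSn q)); lra.
rewrite le_eqVlt; apply/orP; left; apply/eqP; rewrite factS natrM.
by field; rewrite !gt_eqF// ltr0n.
Qed.

(** In one variable the count q is at least x - 1, which is at least
    (1 - eps) x as soon as x >= 1 / eps; this is the reason for the shift of the
    logarithm by ln eps.  In the induction the shifted logarithms, truncated at
    0, telescope down to 0 because x <= q + 1. *)
Lemma hcount_lower d q x eps : 0 < eps -> eps < 1 -> 0 < x -> x <= q.+1%:R ->
  - ln eps <= ln x ->
  (1 - eps) * x * (ln x + ln eps) ^+ d / d`!%:R <= (hcount d.+1 q)%:R.
Proof.
move=> e0 e1; elim: d q x => [|d IH] q x x0 xq ex.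
  rewrite hcount1 expr0 mulr1 divr1.
  have : 1 <= eps * x.
    by rewrite -ler_ln ?posrE ?mulr_gt0// ln1 lnM ?posrE//; lra.
  by rewrite -natr1 in xq; nra.
have c0 : ln eps <= 0 by apply: ln_le0; exact: ltW.
rewrite hcountS natr_sum.
pose v (m : nat) : R := Num.max (ln (x / m.+1%:R) + ln eps) 0.
have f0 k : (0 : R) < k`!%:R by rewrite ltr0n fact_gt0.
have vq : v q = 0.
  apply/max_idPr; have : ln (x / q.+1%:R) <= 0.
    by apply: ln_le0; rewrite ler_pdivrMr ?ltr0n// mul1r.
  by lra.
have v0 : v 0 = ln x + ln eps by rewrite /v divr1; apply/max_idPl; lra.
have lnS m : ln (x / m.+1%:R) - ln (x / m.+2%:R) = ln (m.+2%:R / m.+1%:R).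
  by rewrite !ln_div ?posrE ?ltr0n//; ring.
apply: (@le_trans _ _ (\sum_(m < q) (1 - eps) * x / d.+1`!%:R * (v m ^+ d.+1 - v m.+1 ^+ d.+1))).
  rewrite -mulr_sumr -(big_mkord xpredT (fun m => v m ^+ d.+1 - v m.+1 ^+ d.+1)).
  rewrite (eq_bigr (fun m => - (v m.+1 ^+ d.+1 - v m ^+ d.+1))); last by move=> m _; rewrite opprB.
  rewrite sumrN telescope_sumr// vq v0 expr0n sub0r opprK.
  by rewrite le_eqVlt; apply/orP; left; apply/eqP; ring.
apply: ler_sum => m _; have mp : (0 : R) < m.+1%:R by rewrite ltr0n.
have vS0 : 0 <= v m.+1 by rewrite le_max lexx orbT.
have lns0 : 0 <= ln (m.+2%:R / m.+1%:R) :> R by rewrite (le_trans _ (ln_succ_ge m))// invr_ge0.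
have [cx|cx] := leP 0 (ln (x / m.+1%:R) + ln eps); last first.
  have -> : v m = 0 by apply/max_idPr; exact: ltW.
  have -> : v m.+1 = 0 by apply/max_idPr; have := lnS m; lra.
  by rewrite subrr mulr0 ler0n.
have vm : v m = ln (x / m.+1%:R) + ln eps by apply/max_idPl.
have vle : v m.+1 <= v m.
  by rewrite vm ge_max cx andbT lerD2r -subr_ge0 lnS.
have vdiff : v m - v m.+1 <= m.+1%:R^-1.
  apply: le_trans (ln_succ_le m); rewrite -lnS vm.
  have : ln (x / m.+2%:R) + ln eps <= v m.+1 by rewrite le_max lexx.
  lra.
apply: le_trans (IH (q %/ m.+1)%N (x / m.+1%:R) _ _ _); last 3 first.
- by rewrite divr_gt0.
- rewrite ler_pdivrMr// -natrM; apply: le_trans xq _; rewrite ler_nat.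
  exact: ltn_ceil.
- by lra.
rewrite -vm.
have h : v m ^+ d.+1 - v m.+1 ^+ d.+1 <= d.+1%:R * v m ^+ d * m.+1%:R^-1.
  apply: le_trans (subrXX_le d vS0 vle) _; rewrite ler_wpM2l// mulr_ge0 ?ler0n// exprn_ge0//.
  exact: le_trans vle.
apply: (@le_trans _ _ ((1 - eps) * x / d.+1`!%:R * (d.+1%:R * v m ^+ d * m.+1%:R^-1))).
  by rewrite ler_wpM2l// divr_ge0 ?ler0n// mulr_ge0 ?(ltW x0)// subr_ge0 ltW.
rewrite le_eqVlt; apply/orP; left; apply/eqP; rewrite factS natrM.
by field; rewrite !gt_eqF// ?ltr0n.
Qed.

End hyperbolic_cross_bounds.

Lemma hthr_exists d n : exists T, (n <= hcount d.+1 T)%N.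
Proof. by exists n; exact: hcount_ge. Qed.

(** The threshold T_n: the n-th smallest value of pi, since T_n - 1 leaves fewer
    than n multi-indices below it. *)
Definition hthr d n := ex_minn (hthr_exists d n).

Lemma hthrP d n : (n <= hcount d.+1 (hthr d n))%N.
Proof. by rewrite /hthr; case: ex_minnP. Qed.

Lemma hthr_min d n T : (n <= hcount d.+1 T)%N -> (hthr d n <= T)%N.
Proof. by rewrite /hthr; case: ex_minnP => m _ h /h. Qed.

Lemma hthr_gt0 d n : (0 < n)%N -> (0 < hthr d n)%N.
Proof.
move=> n0; rewrite lt0n; apply/eqP => h0; have := hthrP d n.
by rewrite h0 hcount_0 leqn0; case: n n0 {h0}.
Qed.

Lemma hthr_pred d n : (0 < n)%N -> (hcount d.+1 (hthr d n).-1 < n)%N.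
Proof.
move=> n0; rewrite ltnNge; apply/negP => /hthr_min.
by have := hthr_gt0 d n0; case: hthr => // T _ /=; rewrite ltnn.
Qed.

Lemma hthr_large d n T : (hcount d.+1 T < n)%N -> (T < hthr d n)%N.
Proof.
move=> h; rewrite ltnNge; apply/negP => /(leq_hcount d.+1) h2.
by have := hthrP d n; lia.
Qed.

Section threshold_limit.
Context {R : realType} (d : nat).
Let L n : R := ln (hthr d n)%:R.

Lemma hthr_ln_cvg : L n @[n --> \oo] --> +oo.
Proof.
apply/cvgryPge => A; near=> n.
have : ((Num.truncn (expR A)).+1 < hthr d n)%N.
  apply: hthr_large; near: n.
  by exists (hcount d.+1 (Num.truncn (expR A)).+1).+1.
move=> h; rewrite -[A]expRK ler_ln ?posrE ?expR_gt0 ?ltr0n; last exact: leq_ltn_trans h.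
apply: ltW; apply: lt_le_trans (truncnS_gt _) _; rewrite ler_nat; exact: ltnW.
Unshelve. all: by end_near.
Qed.

Let Lgt A : \forall n \near \oo, A < L n.
Proof. by have /cvgryPgt := hthr_ln_cvg; apply. Qed.

Let Linv : (L n)^-1 @[n --> \oo] --> (0 : R).
Proof. exact: (gtr0_cvgV0 (Lgt 0)).2 hthr_ln_cvg. Qed.

Lemma cvg_expn (u : nat -> R) (l : R) p : u n @[n --> \oo] --> l ->
  u n ^+ p @[n --> \oo] --> l ^+ p.
Proof.
move=> ul; elim: p => [|p IH]; first by under eq_fun do rewrite expr0; exact: cvg_cst.
by rewrite exprS; under eq_fun do rewrite exprS; exact: cvgM.
Qed.

Let f0 : (0 : R) < d`!%:R. Proof. by rewrite ltr0n fact_gt0. Qed.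

Lemma hthr_upper n : (0 < n)%N -> n%:R <= (hthr d n)%:R * (L n + d%:R) ^+ d / d`!%:R.
Proof.
move=> n0; apply: (@le_trans _ _ (hcount d.+1 (hthr d n))%:R).
  by rewrite ler_nat hthrP.
by apply: hcount_upper => //; rewrite ler1n hthr_gt0.
Qed.

Lemma hthr_lower eps n : 0 < eps -> eps < 1 -> (0 < n)%N -> - ln eps <= L n ->
  (1 - eps) * (hthr d n)%:R * (L n + ln eps) ^+ d / d`!%:R <= n%:R.
Proof.
move=> e0 e1 n0 eL; apply: (@le_trans _ _ (hcount d.+1 (hthr d n).-1)%:R).
  apply: hcount_lower => //; first by rewrite ltr0n hthr_gt0.
  by rewrite prednK// hthr_gt0.
by rewrite ler_nat ltnW// hthr_pred.
Qed.

(** By definition of T_n, n lies between the counts at T_n - 1 and at T_n, for which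
    [hcount_lower] and [hcount_upper] have the same leading term up to 1 - eps. *)
Lemma hthr_ratio_L : n%:R / ((hthr d n)%:R * L n ^+ d) @[n --> \oo] --> (d`!%:R^-1 : R).
Proof.
have Lpos := Lgt 0.
have up : (1 + d%:R * (L n)^-1) ^+ d / d`!%:R @[n --> \oo] --> (d`!%:R^-1 : R).
  have h : (1 + d%:R * (L n)^-1) ^+ d @[n --> \oo] --> ((1 + d%:R * 0) ^+ d : R).
    by apply: cvg_expn; apply: cvgD; [exact: cvg_cst|exact: cvgMr].
  rewrite mulr0 addr0 expr1n in h.
  by rewrite -[X in _ --> X]mul1r; apply: cvgMl.
apply/cvgrPdist_le => e e0.
pose eps := Num.min (1 / 2) (e / 2).
have eps0 : 0 < eps by rewrite lt_min; apply/andP; split; lra.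
have eps1 : eps < 1 by rewrite gt_min; apply/orP; left; lra.
have epse : eps <= e / 2 by rewrite ge_min lexx orbT.
have lo : (1 - eps) * (1 + ln eps * (L n)^-1) ^+ d / d`!%:R @[n --> \oo] --> ((1 - eps) / d`!%:R : R).
  have h : (1 + ln eps * (L n)^-1) ^+ d @[n --> \oo] --> ((1 + ln eps * 0) ^+ d : R).
    by apply: cvg_expn; apply: cvgD; [exact: cvg_cst|exact: cvgMr].
  rewrite mulr0 addr0 expr1n in h.
  by apply: cvgMl; rewrite -[X in _ --> X]mulr1; apply: cvgMr.
have f1 : (d`!%:R)^-1 <= 1 :> R by rewrite invf_le1// ler1n fact_gt0.
have fV0 : 0 < (d`!%:R)^-1 :> R by rewrite invr_gt0.
have e2 : 0 < e / 2 by lra.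
near=> n.
have n0 : (0 < n)%N by near: n; exists 1%N.
have T0 : 0 < (hthr d n)%:R :> R by rewrite ltr0n hthr_gt0.
have L0 : 0 < L n by near: n.
have den0 : 0 < (hthr d n)%:R * L n ^+ d by rewrite mulr_gt0// exprn_gt0.
have h1 : n%:R / ((hthr d n)%:R * L n ^+ d) <= (1 + d%:R * (L n)^-1) ^+ d / d`!%:R.
  rewrite ler_pdivrMr//; apply: le_trans (hthr_upper n0) _.
  rewrite (_ : L n + d%:R = L n * (1 + d%:R * (L n)^-1)); last by field; rewrite gt_eqF.
  by rewrite exprMn le_eqVlt; apply/orP; left; apply/eqP; ring.
have h2 : (1 - eps) * (1 + ln eps * (L n)^-1) ^+ d / d`!%:R <= n%:R / ((hthr d n)%:R * L n ^+ d).
  have Leps : - ln eps <= L n by apply: ltW; near: n; exact: Lgt.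
  rewrite ler_pdivlMr//; apply: le_trans (hthr_lower eps0 eps1 n0 Leps).
  rewrite (_ : L n + ln eps = L n * (1 + ln eps * (L n)^-1)); last by field; rewrite gt_eqF.
  by rewrite exprMn le_eqVlt; apply/orP; left; apply/eqP; ring.
have h3 : `|d`!%:R^-1 - (1 + d%:R * (L n)^-1) ^+ d / d`!%:R| <= e / 2.
  by near: n; have /cvgrPdist_le := up; apply.
have h4 : `|(1 - eps) / d`!%:R - (1 - eps) * (1 + ln eps * (L n)^-1) ^+ d / d`!%:R| <= e / 2.
  by near: n; have /cvgrPdist_le := lo; apply.
move: h3 h4; rewrite !ler_norml => /andP[h3 _] /andP[_ h4].
have h5 : (d`!%:R)^-1 - e / 2 <= (1 - eps) / d`!%:R by nra.
by apply/andP; split; lra.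
Unshelve. all: by end_near.
Qed.

(** n and T_n differ by a power of ln T_n, hence their logarithms are equivalent. *)
Lemma hthr_ln_ratio : ln n%:R / L n @[n --> \oo] --> (1 : R).
Proof.
apply/cvgrPdist_le => e e0.
(* ln (L + d) is bounded by a linear function of slope del. *)
pose del := e / (2 * (d%:R + 1)).
have d1 : 0 < d%:R + 1 :> R by rewrite ltr_wpDl.
have del0 : 0 < del by rewrite divr_gt0// mulr_gt0.
have dd : d%:R * del <= e / 2.
  rewrite /del invfM mulrA mulrA ler_pdivrMr//; have : 0 <= (d%:R : R) by []. nra.
have half0 : (0 : R) < 1 / 2 by lra.
have half1 : (1 / 2 : R) < 1 by lra.
pose K : R := `|ln (1 / 2)| + ln d`!%:R.
pose K' : R := d%:R * (del * d%:R - ln del).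
near=> n.
have n0 : (0 < n)%N by near: n; exists 1%N.
have T0 : 0 < (hthr d n)%:R :> R by rewrite ltr0n hthr_gt0.
have L0 : 0 < L n by near: n; exact: Lgt.
have L1 : 1 - ln (1 / 2) <= L n by apply: ltW; near: n; exact: Lgt.
have LK : K / e <= L n by apply: ltW; near: n; exact: Lgt.
have LK' : 2 * K' / e <= L n by apply: ltW; near: n; exact: Lgt.
have np : 0 < n%:R :> R by rewrite ltr0n.
have Ld0 : 0 < L n + d%:R by rewrite ltr_pwDl.
have fac1 : (1 : R) <= d`!%:R by rewrite ler1n fact_gt0.
have up : ln n%:R <= L n + d%:R * ln (L n + d%:R).
  apply: (@le_trans _ _ (ln ((hthr d n)%:R * (L n + d%:R) ^+ d))).
    rewrite ler_ln ?posrE ?mulr_gt0 ?exprn_gt0//; apply: le_trans (hthr_upper n0) _.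
    by rewrite ler_pdivrMr// ler_peMr// mulr_ge0 ?(ltW T0)// exprn_ge0// ltW.
  by rewrite lnM ?posrE ?exprn_gt0// lnXn// mulr_natl.
have lnlin : ln (L n + d%:R) <= del * (L n + d%:R) - ln del.
  have p0 : 0 < del * (L n + d%:R) by rewrite mulr_gt0.
  have : ln (1 + (del * (L n + d%:R) - 1)) <= del * (L n + d%:R) - 1 by apply: le_ln1Dx; lra.
  rewrite (_ : 1 + _ = del * (L n + d%:R)); last by ring.
  by rewrite lnM ?posrE//; lra.
have lo : L n - K <= ln n%:R.
  have h12 : - ln (1 / 2) <= L n by lra.
  have := hthr_lower half0 half1 n0 h12.
  have x1 : 1 <= L n + ln (1 / 2) by lra.
  have x2 : 1 <= (L n + ln (1 / 2)) ^+ d by rewrite exprn_ege1.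
  move=> h; apply: (@le_trans _ _ (ln ((1 / 2) * (hthr d n)%:R / d`!%:R))).
    rewrite lnM ?posrE ?mulr_gt0 ?invr_gt0// lnM ?posrE// lnV ?posrE// /K.
    have := ler_norm (- ln (1 / 2 : R)); rewrite normrN; rewrite /L; lra.
  rewrite ler_ln ?posrE ?mulr_gt0 ?invr_gt0//; apply: le_trans h.
  rewrite ler_wpM2r ?invr_ge0 ?(ltW f0)// (_ : 1 - 1 / 2 = 1 / 2); last by lra.
  by rewrite ler_peMr// mulr_ge0// ltW.
rewrite ler_norml; apply/andP; split.
  suff : ln n%:R / L n <= 1 + e by lra.
  rewrite ler_pdivrMr//; apply: le_trans up _.
  have h1 : d%:R * ln (L n + d%:R) <= d%:R * (del * (L n + d%:R) - ln del).
    by rewrite ler_wpM2l ?ler0n.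
  have h2 : d%:R * (del * (L n + d%:R) - ln del) = d%:R * del * L n + K' by rewrite /K'; ring.
  have h3 : d%:R * del * L n <= e / 2 * L n by rewrite ler_wpM2r// ltW.
  move: LK'; rewrite ler_pdivrMr//; nra.
suff : 1 - e <= ln n%:R / L n by lra.
rewrite ler_pdivlMr//; apply: le_trans lo.
move: LK; rewrite ler_pdivrMr//; nra.
Unshelve. all: by end_near.
Qed.

(** In [hthr_ratio_L] the logarithm of T_n may be replaced by the logarithm of n. *)
Theorem hthr_limit : n%:R / ((hthr d n)%:R * ln n%:R ^+ d) @[n --> \oo] --> (d`!%:R^-1 : R).
Proof.
have h : (ln n%:R / L n)^-1 @[n --> \oo] --> (1^-1 : R).
  by apply: cvgV; [exact: oner_neq0|exact: hthr_ln_ratio].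
have H : n%:R / ((hthr d n)%:R * L n ^+ d) * (ln n%:R / L n)^-1 ^+ d @[n --> \oo] -->
    (d`!%:R^-1 : R).
  rewrite -[X in _ --> X]mulr1 -[X in _ * X](expr1n R d) -[X in X ^+ d]invr1.
  by apply: cvgM; [exact: hthr_ratio_L|exact: cvg_expn].
apply: cvg_trans H; apply: near_eq_cvg; near=> n.
have L0 : 0 < L n by near: n; exact: Lgt.
have Lne : L n ^+ d != 0 by rewrite expf_neq0// gt_eqF.
rewrite /= invf_div expr_div_n !invfM.
transitivity (n%:R * ((hthr d n)%:R^-1 / ln n%:R ^+ d) * ((L n ^+ d)^-1 * L n ^+ d)).
  by move: (_ ^- d) => a; ring.
by rewrite mulVf// mulr1.
Unshelve. all: by end_near.
Qed.

End threshold_limit.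

(** * Integration against the Gaussian measure *)

Section integrals.
Context {R : realType}.
Import HBNNSimple.

Lemma integral_lebesgue_prod n (F : 'I_n -> R -> R) :
  (forall j, measurable_fun setT (F j)) ->
  (forall j, (@lebesgue_measure R).-integrable setT (EFin \o F j)) ->
  (\int[@lebesgue_tuple R n]_x (\prod_(j < n) F j (tnth x j))%:E =
   (\prod_(j < n) \int[@lebesgue_measure R]_x F j x)%:E)%E.
Proof.
elim: n F => [|n IH] F mF iF.
  rewrite /= integral_dirac//; last first.
    by apply/measurable_EFinP; exact: measurable_prod_tuple.
  by rewrite !big_ord0 diracT mul1e.
have mP : measurable_fun setT (fun x : n.+1.-tuple R => (\prod_(j < n.+1) F j (tnth x j))%:E).
  by apply/measurable_EFinP; exact: measurable_prod_tuple.
pose G (t : n.-tuple R) : R := \prod_(j < n) F (lift ord0 j) (tnth t j).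
have mG : measurable_fun setT G.
  by apply: (@measurable_prod_tuple _ n (fun j => F (lift ord0 j))).
have IHG := IH _ (fun j => mF (lift ord0 j)) (fun j => iF (lift ord0 j)).
have E0 (z : measurableTypeR R * n.-tuple R) :
    \prod_(j < n.+1) F j (tnth (tcons z) j) = F ord0 z.1 * G z.2.
  case: z => x t; rewrite big_ord_recl /tcons tnth0; congr (_ * _).
  by apply: eq_bigr => j _; rewrite tnthS.
have absG : (\int[lebesgue_tuple n]_t `|(G t)%:E| < +oo)%E.
  rewrite (eq_integral (fun t : n.-tuple R => (\prod_(j < n) `|F (lift ord0 j) (tnth t j)|)%:E)); last first.
    by move=> t _; rewrite /= /G normr_prod.
  apply: (@lebesgue_prod_lty _ n (fun j x => `|F (lift ord0 j) x|)) => // j.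
    exact: measurableT_comp.
  by have /integrableP[] := iF (lift ord0 j).
have iG : (lebesgue_tuple n).-integrable setT (EFin \o G).
  by apply/integrableP; split => //; exact/measurable_EFinP.
have mf : measurable_fun setT (fun z : measurableTypeR R * n.-tuple R => (F ord0 z.1 * G z.2)%:E).
  apply/measurable_EFinP; apply: measurable_funM.
    apply: (measurableT_comp (mF ord0)).
    exact: (@measurable_fst _ _ (measurableTypeR R) (n.-tuple R)).
  apply: (measurableT_comp mG).
  exact: (@measurable_snd _ _ (measurableTypeR R) (n.-tuple R)).
have if_ : ((@lebesgue_measure R) \x (lebesgue_tuple n))%E.-integrable setT
    (fun z : measurableTypeR R * n.-tuple R => (F ord0 z.1 * G z.2)%:E).
  apply/(integrable12ltyP _ _ mf).
  under eq_integral => x _.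
    under eq_integral => t _ do rewrite /= normrM EFinM.
    rewrite ge0_integralZl//; last first.
      by apply/measurable_EFinP; exact: measurableT_comp.
    over.
  rewrite ge0_integralZr//; last 2 first.
  - by apply/measurable_EFinP; apply: measurableT_comp; [exact: normr_measurable|exact: mF].
  - by apply: integral_ge0 => t _; rewrite lee_fin.
  have /integrableP[_ i0] := iF ord0.
  apply: lte_mul_pinfty => //.
    by apply: integral_ge0 => t _; rewrite lee_fin.
  by rewrite ge0_fin_numE//; apply: integral_ge0 => t _; rewrite lee_fin.
rewrite /= /lebesgue_succ integral_pushforward//; last 2 first.
- exact: measurable_tcons.
- rewrite preimage_setT.
  by apply: eq_integrable if_ => // z _; rewrite /= E0.
rewrite preimage_setT.
under eq_integral do rewrite /= E0.
rewrite -(integral12_prod_meas1 if_) /fubini_F /=.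
under eq_integral => x _.
  under eq_integral => t _ do rewrite EFinM.
  rewrite integralZl// IHG -EFinM.
  over.
rewrite /= big_ord_recl.
under eq_integral do rewrite mulrC EFinM.
rewrite integralZl//.
rewrite mulrC EFinM; congr (_ * _)%E.
  by rewrite /Rintegral fineK//; apply: integrable_fin_num => //; exact: iF.
exact: iF.
Qed.

Variable d : nat.
Local Notation leb := (@lebesgue_tuple R d).
Local Notation gauss := (@gaussian R d).

(** True for simple functions by linearity, then in general by monotone
    convergence on both sides. *)
Lemma ge0_integral_gaussian (f : d.-tuple R -> \bar R) :
  measurable_fun setT f -> (forall x, 0 <= f x)%E ->
  (\int[gauss]_x f x = \int[leb]_x (f x * (gauss_density x)%:E))%E.
Proof.
move=> mf f0.
have mg : measurable_fun setT (EFin \o @gauss_density R d).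
  apply/measurable_EFinP; exact: measurable_gauss_density.
have g0 x : (0 <= (@gauss_density R d x)%:E)%E by rewrite lee_fin gauss_density_ge0.
pose h := nnsfun_approx measurableT mf.
have hcvg x : EFin (h n x) @[n --> \oo] --> f x.
  by apply: cvg_nnsfun_approx.
have hnd : {homo (fun n => h n : d.-tuple R -> R) : n m / (n <= m)%N >-> (forall x, n x <= m x)}.
  by move=> n m nm x; have /lefP := nd_nnsfun_approx measurableT mf nm; apply.
have hint (k : {nnsfun d.-tuple R >-> R}) :
    (\int[gauss]_x (k x)%:E = \int[leb]_x ((k x)%:E * (gauss_density x)%:E))%E.
  rewrite integralT_nnsfun sintegralE.
  have mi r : measurable_fun setT (fun x => (\1_(k @^-1` [set r]) x)%:E : \bar R).
    by apply/measurable_EFinP.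
  have mri r : measurable_fun setT
      (fun x => (r * \1_(k @^-1` [set r]) x)%:E : \bar R).
    apply/measurable_EFinP; apply: measurable_funM => //.
  have E r : (r%:E * gauss (k @^-1` [set r]) =
      \int[leb]_x ((r * \1_(k @^-1` [set r]) x)%:E * (gauss_density x)%:E))%E.
    have [r0|r0] := leP 0 r; last first.
      rewrite preimage_nnfun0// measure0 mule0 integral0_eq// => x _.
      by rewrite indicE in_set0 mulr0 mul0e.
    under eq_integral do rewrite EFinM -muleA.
    rewrite ge0_integralZl//; last 2 first.
    - by apply: emeasurable_funM.
    - by move=> x _; rewrite mule_ge0// lee_fin.
    congr (_ * _)%E; rewrite [LHS]integral_mkcond epatch_indic.
    by apply: eq_integral => x _; rewrite muleC.
  under eq_fsbigr do rewrite E.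
  rewrite -ge0_integral_fsum//; last 2 first.
  - by move=> r; apply: emeasurable_funM; [exact: mri|exact: mg].
  - by move=> r x _; rewrite mule_ge0// nnfun_muleindic_ge0.
  apply: eq_integral => x _.
  rewrite -ge0_mule_fsuml; last by move=> r; exact: nnfun_muleindic_ge0.
  by rewrite fsumEFin// -(fimfunE k).
have mh n : measurable_fun setT (EFin \o h n) by exact/measurable_EFinP.
have mhg n : measurable_fun setT (fun x => ((h n x)%:E * (gauss_density x)%:E)%E).
  by apply: emeasurable_funM; [exact: mh|exact: mg].
have L1 : (\int[gauss]_x (EFin \o h n) x)%E @[n --> \oo] --> (\int[gauss]_x f x)%E.
  rewrite (_ : (\int[gauss]_x f x = \int[gauss]_x limn (fun n => (EFin \o h n) x))%E); last first.
    by apply: eq_integral => x _; apply/esym/cvg_lim => //; exact: hcvg.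
  apply: cvg_monotone_convergence => //.
  - by move=> n x _; rewrite lee_fin.
  - by move=> x _ n m nm; rewrite lee_fin; exact: hnd.
have L2 : (\int[leb]_x ((h n x)%:E * (gauss_density x)%:E))%E @[n --> \oo] -->
    (\int[leb]_x (f x * (gauss_density x)%:E))%E.
  rewrite (_ : (\int[leb]_x (f x * (gauss_density x)%:E) =
    \int[leb]_x limn (fun n => (h n x)%:E * (gauss_density x)%:E))%E); last first.
    apply: eq_integral => x _; apply/esym/cvg_lim => //.
    by apply: cvgeZr => //; exact: hcvg.
  apply: cvg_monotone_convergence => //.
  - by move=> n x _; rewrite mule_ge0// lee_fin.
  - by move=> x _ n m nm; rewrite lee_wpmul2r// lee_fin; exact: hnd.
apply: cvg_unique L1 _ => //.
move: L2; apply: cvg_trans; apply: near_eq_cvg; near=> n.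
exact/esym/(hint (h n)).
Unshelve. all: by end_near.
Qed.

Lemma integral_gaussian (f : d.-tuple R -> R) : measurable_fun setT f ->
  (\int[gauss]_x (f x)%:E = \int[leb]_x (f x * gauss_density x)%:E)%E.
Proof.
move=> mf; rewrite [LHS]integralE [RHS]integralE.
have mE : measurable_fun setT (EFin \o f) by exact/measurable_EFinP.
congr (_ - _)%E.
- rewrite ge0_integral_gaussian//; last exact: measurable_funepos.
  apply: eq_integral => x _.
  rewrite !funeposE -!EFin_max -EFinM maxr_pMl ?gauss_density_ge0// mul0r.
  by [].
- rewrite ge0_integral_gaussian//; last exact: measurable_funeneg.
  apply: eq_integral => x _.
  rewrite !funenegE -!EFin_max -EFinM maxr_pMl ?gauss_density_ge0// mul0r.
  by rewrite mulNr.
Qed.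

End integrals.

(** * Hermite polynomials in one variable *)

Section hermite_polynomials.
Context {R : realType}.
Implicit Types (p q : {poly R}) (x : R).

Definition gauss_weight x : R := expR (- (x ^+ 2 / 2)).

(** The monic Hermite polynomials.  The recursion is the one produced by
    differentiating p exp (- x ^ 2 / 2). *)
Fixpoint He (k : nat) : {poly R} :=
  if k is j.+1 then 'X * He j - (He j)^`() else 1.

Arguments He : simpl never.

Lemma He0 : He 0 = 1. Proof. by []. Qed.

Lemma He1 : He 1 = 'X.
Proof. by rewrite /He mulr1 -polyC1 derivC subr0. Qed.

Lemma HeS k : He k.+1 = 'X * He k - (He k)^`(). Proof. by []. Qed.

Lemma is_derive_horner p x : is_derive x (1 : R) (horner p) (p^`()).[x].
Proof.
apply: DeriveDef; first exact: derivable_horner.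
by rewrite -derive1E -derivE.
Qed.

Lemma is_derive_gauss_weight x :
  is_derive x (1 : R) gauss_weight (- x * gauss_weight x).
Proof.
have h := is_derive_horner (- 2^-1 *: 'X^2) x.
have -> : gauss_weight = expR \o horner (- 2^-1 *: 'X^2).
  by apply/funext => t; rewrite /gauss_weight /= hornerZ hornerXn mulNr mulrC.
have := @is_derive1_comp _ expR _ x _ _ (is_derive_expR _) h.
congr is_derive => /=; rewrite derivZ derivXn hornerZ hornerMn hornerXn. lra.
Qed.

Lemma is_derive_poly_weight p x :
  is_derive x (1 : R) (fun t => p.[t] * gauss_weight t)
    ((p^`() - 'X * p).[x] * gauss_weight x).
Proof.
have := is_deriveM (is_derive_horner p x) (is_derive_gauss_weight x).
congr is_derive; rewrite !hornerE /GRing.scale/=; ring.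
Qed.

Lemma hermiteE k x : hermite k x = (He k).[x] / Num.sqrt k`!%:R.
Proof.
have H : derive1n k gauss_weight =
    (fun x => ((-1) ^+ k *: He k).[x] * gauss_weight x).
  elim: k => [|k IH].
    by apply/funext => y; rewrite /derive1n/= hornerZ hornerC !mul1r.
  rewrite derive1nS IH; apply/funext => y; rewrite derive1E.
  have [_ ->] := is_derive_poly_weight ((-1) ^+ k *: He k) y.
  by rewrite derivZ HeS !(hornerZ, hornerD, hornerN, hornerM, hornerX) exprS; ring.
rewrite /hermite -/gauss_weight H hornerZ.
have := signrMK k (1 : R); rewrite mulr1 => s1.
transitivity ((-1) ^+ k * (-1) ^+ k * (He k).[x] / Num.sqrt k`!%:R *
  (expR (x ^+ 2 / 2) * gauss_weight x)); first by ring.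
by rewrite /gauss_weight -expRD subrr expR0 s1 mulr1 mul1r.
Qed.

Lemma deriv_He k : (He k.+1)^`() = k.+1%:R *: He k.
Proof.
elim: k => [|k IH].
  by rewrite He1 He0 derivX scale1r.
rewrite HeS derivB derivM derivX mul1r IH derivZ.
rewrite -scalerAr -addrA -scalerBr -HeS.
by rewrite -[X in X + _]scale1r -scalerDl nat1r.
Qed.

Lemma mulX_He k : 'X * He k.+1 = He k.+2 + k.+1%:R *: He k.
Proof. by rewrite [He k.+2]HeS deriv_He subrK. Qed.

(** The three-term recurrence in normalized form: it makes the span of the Hermite
    functions stable under multiplication by a coordinate. *)
Lemma mulX_hermite k x : x * hermite k.+1 x =
  Num.sqrt k.+2%:R * hermite k.+2 x + Num.sqrt k.+1%:R * hermite k x.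
Proof.
have := congr1 (fun p => p.[x]) (mulX_He k); rewrite hornerM hornerX hornerD hornerZ.
rewrite !hermiteE => H.
have f0 m : (0 : R) < Num.sqrt m`!%:R by rewrite sqrtr_gt0 ltr0n fact_gt0.
have s0 m : (0 : R) < Num.sqrt m.+1%:R by rewrite sqrtr_gt0 ltr0n.
have fS m : Num.sqrt (m.+1`!%:R : R) = Num.sqrt m.+1%:R * Num.sqrt m`!%:R.
  by rewrite factS natrM sqrtrM ?ler0n.
have sS m : (Num.sqrt (m.+1%:R : R)) ^+ 2 = m.+1%:R by rewrite sqr_sqrtr ?ler0n.
have a1 := sS k; have a2 := sS k.+1.
rewrite !fS [LHS]mulrA H; move: (s0 k) (s0 k.+1) (f0 k) a1.
set a := Num.sqrt _; set b := Num.sqrt _; set c := Num.sqrt _ => a0 b0 c0 <-.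
by field; rewrite !gt_eqF.
Qed.

Lemma mulX_hermite0 x : x * hermite 0 x = hermite 1 x.
Proof. by rewrite !hermiteE He1 He0 hornerX hornerC mulrA mulr1. Qed.

Lemma hermite0 x : hermite 0 x = 1.
Proof. by rewrite hermiteE /= hornerC fact0 sqrtr1 divr1. Qed.

(** Any positive constant would do in the exponent; 1 / 8 leaves room, below the
    1 / 2 of the weight, for a factor exp (x ^ 2 / 4). *)
Lemma poly_gauss_bound p : exists2 C : R, 0 <= C &
  forall x : R, `|p.[x]| <= C * expR (x ^+ 2 / 8).
Proof.
have exp_bound (m : nat) : exists C : R, 0 <= C /\
    forall x : R, `|x| ^+ m <= C * expR (x ^+ 2 / 8).
  exists (1 + m.+1`!%:R * 8 ^+ m.+1); split=> [|x].
    by rewrite addr_ge0// mulr_ge0// exprn_ge0.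
  have e1 : 1 <= expR (x ^+ 2 / 8).
    by rewrite -[leLHS]expR0 ler_expR divr_ge0// sqr_ge0.
  rewrite mulrDl mul1r.
  have [x1|x1] := leP `|x| 1.
    apply: (@le_trans _ _ 1); first by rewrite exprn_ile1.
    by rewrite (le_trans e1)// lerDl !mulr_ge0// ?exprn_ge0// expR_ge0.
  have y0 : 0 <= x ^+ 2 / 8 by rewrite divr_ge0// sqr_ge0.
  have := expR_ge1Dxn m y0; move: (expR _) e1 => e e1 h.
  have {}h : (x ^+ 2) ^+ m.+1 <= m.+1`!%:R * 8 ^+ m.+1 * e.
    have : (x ^+ 2 / 8) ^+ m.+1 / m.+1`!%:R <= e by rewrite (le_trans _ h)// lerDr.
    rewrite ler_pdivrMr ?ltr0n ?fact_gt0// expr_div_n ler_pdivrMr ?exprn_gt0//.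
    by move=> h'; apply: (le_trans h'); rewrite le_eqVlt; apply/orP; left; apply/eqP; ring.
  have : `|x| ^+ m <= (x ^+ 2) ^+ m.+1.
    rewrite -normrX -[x ^+ 2]ger0_norm ?sqr_ge0// !normrX -exprM.
    by rewrite ler_weXn2l// ?ltW// mulnS; lia.
  lra.
have /choice[C HC] := exp_bound.
exists (\sum_(i < size p) `|p`_i| * C i) => [|x].
  by apply: sumr_ge0 => i _; rewrite mulr_ge0//; have [] := HC i.
rewrite horner_coef mulr_suml (le_trans (ler_norm_sum _ _ _))//.
apply: ler_sum => i _; rewrite normrM normrX -mulrA ler_wpM2l//.
by have [] := HC i.
Qed.

Lemma measurable_horner p : measurable_fun setT (horner p).
Proof.
apply: continuous_measurable_fun => x.
exact/differentiable_continuous/derivable1_diffP/derivable_horner.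
Qed.

Lemma measurable_gauss_weight : measurable_fun setT gauss_weight.
Proof.
apply: measurableT_comp => //; apply: measurableT_comp => //.
by apply: measurable_funM => //; exact: measurable_funX.
Qed.

(** The bound is a multiple of the normal density of standard deviation 2. *)
Lemma integrable_gauss_bound (F : R -> R) (C : R) : measurable_fun setT F ->
  (forall x, `|F x| <= C * expR (- (x ^+ 2 / 8))) ->
  (@lebesgue_measure R).-integrable setT (EFin \o F).
Proof.
move=> mF hF.
have mE : measurable_fun setT (EFin \o F : measurableTypeR R -> \bar R).
  exact/measurable_EFinP.
have iN : (@lebesgue_measure R).-integrable setT
    (fun x => ((C / normal_peak 2)%:E * (normal_pdf 0 2 x)%:E)%E).
  by apply: integrableZl => //; exact: integrable_normal_pdf.
apply: (le_integrable measurableT mE _ iN) => x _; rewrite /= lee_fin.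
apply: (le_trans (hF x)); apply: le_trans (ler_norm _).
have s0 : (2 : R) != 0 by rewrite pnatr_eq0.
rewrite normal_pdfE// mulrA divfK ?gt_eqF ?normal_peak_gt0//.
rewrite /normal_fun subr0 (_ : - x ^+ 2 / _ = - (x ^+ 2 / 8))//.
by rewrite -mulr_natr; field.
Qed.

Lemma integrable_poly_weight p :
  (@lebesgue_measure R).-integrable setT (EFin \o (fun x => p.[x] * gauss_weight x)).
Proof.
have [C C0 hC] := poly_gauss_bound p.
apply: (@integrable_gauss_bound _ C).
  by apply: measurable_funM; [exact: measurable_horner|exact: measurable_gauss_weight].
move=> x; rewrite normrM [`|gauss_weight x|]ger0_norm ?expR_ge0//.
apply: (@le_trans _ _ (C * expR (x ^+ 2 / 8) * gauss_weight x)).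
  by rewrite ler_wpM2r ?expR_ge0.
rewrite -mulrA -expRD ler_wpM2l// ler_expR; have := sqr_ge0 x; lra.
Qed.

Definition gauss_mean p : R := \int[@lebesgue_measure R]_x (p.[x] * gauss_weight x).

Lemma gauss_meanB p q : gauss_mean (p - q) = gauss_mean p - gauss_mean q.
Proof.
rewrite /gauss_mean -RintegralB//; try exact: integrable_poly_weight.
by apply: eq_Rintegral => x _; rewrite hornerD hornerN mulrBl.
Qed.

Lemma gauss_meanZ a p : gauss_mean (a *: p) = a * gauss_mean p.
Proof.
rewrite /gauss_mean -RintegralZl//; try exact: integrable_poly_weight.
by apply: eq_Rintegral => x _; rewrite hornerZ mulrA.
Qed.

Lemma gauss_mean1 : gauss_mean 1 = Num.sqrt (2 * pi).
Proof.
have pk : (0 : R) < normal_peak 1 by apply: normal_peak_gt0; exact: oner_neq0.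
have : (\int[@lebesgue_measure R]_x
    ((normal_peak 1)%:E * ((1 : {poly R}).[x] * gauss_weight x)%:E) = 1)%E.
  rewrite -[RHS](@integral_normal_pdf R 0 1); apply: eq_integral => x _.
  rewrite normal_pdfE ?oner_neq0// -EFinM hornerC mul1r.
  congr (_ * expR _)%:E; rewrite subr0 expr1n -mulr_natr; by field.
rewrite (integralZl measurableT (integrable_poly_weight 1)) /=.
rewrite -[X in (_ * X)%E]fineK; last first.
  by apply: integrable_fin_num => //; exact: integrable_poly_weight.
rewrite -EFinM => -[] /(congr1 (fun y => (normal_peak 1)^-1 * y)).
rewrite mulrA mulVf ?gt_eqF// mul1r mulr1 => H.
rewrite /gauss_mean /Rintegral H /normal_peak invrK expr1n mul1r.
by rewrite mulr_natl.
Qed.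

End hermite_polynomials.

Section ortho.
Context {R : realType}.
Implicit Types (p q : {poly R}) (x : R).

Lemma poly_weight_small p : exists2 C : R, 0 <= C &
  forall x, `|x| * `|p.[x] * gauss_weight x| <= C.
Proof.
have [C C0 hC] := poly_gauss_bound ('X * p).
exists C => // x; rewrite normrM mulrA -normrM.
rewrite [`|gauss_weight x|]ger0_norm ?expR_ge0//.
apply: (@le_trans _ _ (C * expR (x ^+ 2 / 8) * gauss_weight x)).
  by rewrite ler_wpM2r ?expR_ge0//; have := hC x; rewrite hornerM hornerX.
rewrite -mulrA -expRD -[leRHS]mulr1 ler_wpM2l// -[leRHS]expR0 ler_expR.
have := sqr_ge0 x; lra.
Qed.

(** The integrand is the derivative of p exp (- x ^ 2 / 2), which vanishes at
    infinity. *)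
Lemma gauss_stein p : gauss_mean (p^`() - 'X * p) = 0.
Proof.
set q := p^`() - 'X * p.
pose F x := p.[x] * gauss_weight x; pose f x := q.[x] * gauss_weight x.
have iF := integrable_poly_weight q; rewrite -/f in iF.
have dF x : is_derive x (1 : R) F (f x) by exact: is_derive_poly_weight.
have cf : continuous f.
  move=> x; apply: differentiable_continuous; apply/derivable1_diffP.
  by case: (is_derive_poly_weight q x).
have cF : continuous F.
  move=> x; apply: differentiable_continuous; apply/derivable1_diffP.
  by case: (dF x).
have E n : (\int[@lebesgue_measure R]_(x in `[(- n.+1%:R)%R, n.+1%:R]) (f x)%:E =
    (F n.+1%:R - F (- n.+1%:R))%:E)%E.
  have n0 : (0 : R) < n.+1%:R by rewrite ltr0n.
  rewrite (@continuous_FTC2 _ f F)//.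
  - lra.
  - exact: continuous_subspaceT.
  - split.
    + by move=> x _; case: (dF x).
    + exact/cvg_at_right_filter/cF.
    + exact/cvg_at_left_filter/cF.
  - by move=> x _; rewrite derive1E; case: (dF x).
have [C C0 hC] := poly_weight_small p.
have B n : `|F n.+1%:R - F (- n.+1%:R)| <= C *+ 2 * n.+1%:R^-1.
  have n0 : (0 : R) < n.+1%:R by rewrite ltr0n.
  rewrite ler_pdivlMr// mulrC; have := hC n.+1%:R; have := hC (- n.+1%:R).
  rewrite normrN ger0_norm ?ler0n// -/(F _) -/(F (- _)) => h1 h2.
  apply: (@le_trans _ _ (n.+1%:R * (`|F n.+1%:R| + `|F (- n.+1%:R)|))).
    by rewrite ler_wpM2l ?ler0n// ler_normB.
  by rewrite mulrDr mulr2n lerD.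
have L0 : F n.+1%:R - F (- n.+1%:R) @[n --> \oo] --> (0 : R).
  apply/norm_cvg0P.
  apply: (@squeeze_cvgr _ _ _ _ (fun=> 0) (fun n => C *+ 2 * n.+1%:R^-1)).
  - by near=> n; rewrite normr_ge0 B.
  - exact: cvg_cst.
  - rewrite -[X in _ --> X](mulr0 (C *+ 2)); apply: cvgMr.
    exact: cvg_harmonic.
(* Truncation to [-n-1, n+1], where the fundamental theorem of calculus applies. *)
pose g n (x : measurableTypeR R) : \bar R := ((f \_ `[(- n.+1%:R)%R, n.+1%:R]) x)%:E.
have mf : measurable_fun (setT : set (measurableTypeR R)) f.
  by apply: continuous_measurable_fun.
have [_ _ L1] : [/\ lebesgue_measure.-integrable setT (EFin \o f),
   ([sequence (\int[@lebesgue_measure R]_x `|g n x - (EFin \o f) x|)%E]_n @ \oo --> 0%E) &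
   ([sequence (\int[@lebesgue_measure R]_x g n x)%E]_n @ \oo --> (\int[@lebesgue_measure R]_x (EFin \o f) x)%E)].
  apply: (@dominated_convergence _ (measurableTypeR R) R lebesgue_measure setT measurableT g (EFin \o f) (fun x => `|(f x)%:E|%E)).
  - move=> n; apply/measurable_EFinP; apply/(measurable_restrictT _ _).1 => //.
    exact: measurable_funTS.
  - exact/measurable_EFinP.
  - apply: aeW => x _; apply: cvg_near_cst; near=> n.
    rewrite /g patchE mem_set//= in_itv/= -ler_norml.
    near: n; exists (Num.truncn `|x|).+1 => //= n /= xn.
    rewrite (le_trans (ltW (truncnS_gt _)))// ler_nat. exact: leqW.
  - exact: integrable_abse.
  - apply: aeW => x n _; rewrite /g patchE; case: ifP => //= _.
    by rewrite normr0 lee_fin.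
have {}L1 : (F n.+1%:R - F (- n.+1%:R))%:E @[n --> \oo] -->
    (\int[@lebesgue_measure R]_x (f x)%:E)%E.
  apply: cvg_trans L1; apply: near_eq_cvg; near=> n => /=.
  rewrite -E [RHS]integral_mkcond; apply: eq_integral => x _.
  by rewrite /g /= restrict_EFin.
rewrite /gauss_mean /Rintegral -/f.
suff -> : (\int[@lebesgue_measure R]_x (f x)%:E = 0)%E by [].
apply: cvg_unique L1 _ => //.
by apply: cvg_EFin L0; near=> n.
Unshelve. all: by end_near.
Qed.

Lemma gauss_mean_HeM k p : gauss_mean (He k.+1 * p) = gauss_mean (He k * p^`()).
Proof.
have := gauss_stein (He k * p); rewrite derivM HeS => H.
apply/eqP; rewrite eq_sym -subr_eq0 -gauss_meanB -H; apply/eqP; congr gauss_mean.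
ring.
Qed.

(** Each integration by parts lowers both degrees by one. *)
Lemma gauss_mean_He k l :
  gauss_mean ((He k : {poly R}) * He l) = (k == l)%:R * k`!%:R * Num.sqrt (2 * pi).
Proof.
have z0 : gauss_mean (0 : {poly R}) = 0 by rewrite -(subrr (0 : {poly R})) gauss_meanB subrr.
elim: k l => [|k IH] [|l].
- by rewrite He0 mulr1 gauss_mean1 eqxx fact0 !mul1r.
- by rewrite mulrC gauss_mean_HeM He0 -polyC1 derivC mulr0 z0 !mul0r.
- by rewrite gauss_mean_HeM He0 -polyC1 derivC mulr0 z0 !mul0r.
rewrite gauss_mean_HeM deriv_He -scalerAr gauss_meanZ IH eqSS.
have [->|_] := eqVneq k l; last by rewrite !mul0r mulr0.
by rewrite factS natrM; ring.
Qed.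

Variable d : nat.
Local Notation gauss := (@gaussian R d).

(** The constant of the Gaussian density is split evenly among the factors, which
    makes the integral a product of one-dimensional ones. *)
Lemma hermite_tuple_ortho (k l : d.-tuple nat) :
  \int[gauss]_x (hermite_tuple k x * hermite_tuple l x) = (k == l)%:R.
Proof.
pose c j : R := (Num.sqrt (2 * pi))^-1 * (Num.sqrt (tnth k j)`!%:R)^-1 * (Num.sqrt (tnth l j)`!%:R)^-1.
pose p j := c j *: (He (tnth k j) * He (tnth l j)).
have pi0 : (0 : R) < 2 * pi by rewrite mulr_gt0// pi_gt0.
have E (x : d.-tuple R) : hermite_tuple k x * hermite_tuple l x * gauss_density x =
    \prod_(j < d) ((p j).[tnth x j] * gauss_weight (tnth x j)).
  rewrite gauss_densityE (_ : (2 * pi) `^ _ = \prod_(j < d) (Num.sqrt (2 * pi))^-1); last first.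
    rewrite prodr_const card_ord powRN (mulrC d%:R) powRrM powR12_sqrt ?(ltW pi0)//.
    by rewrite powR_mulrn ?sqrtr_ge0// exprVn.
  rewrite /hermite_tuple -!big_split /=; apply: eq_bigr => j _.
  by rewrite !hermiteE /p hornerZ hornerM /c /gauss_weight; ring.
rewrite /Rintegral integral_gaussian; last first.
  by apply: measurable_funM; exact: measurable_hermite_tuple.
under eq_integral do rewrite E.
rewrite (integral_lebesgue_prod (F := fun j y => (p j).[y] * gauss_weight y)).
- rewrite /=.
  transitivity (\prod_(j < d) ((tnth k j == tnth l j)%:R : R)).
    apply: eq_bigr => j _; rewrite -/(gauss_mean (p j)) gauss_meanZ gauss_mean_He /c.
    have [->|_] := eqVneq (tnth k j) (tnth l j); last by rewrite !mul0r mulr0.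
    rewrite mul1r.
    have f0 m : (0 : R) < Num.sqrt m`!%:R by rewrite sqrtr_gt0 ltr0n fact_gt0.
    have s0 : (0 : R) < Num.sqrt (2 * pi) by rewrite sqrtr_gt0.
    move: (f0 (tnth l j)) (sqr_sqrtr (ler0n R (tnth l j)`!)) s0.
    set a := Num.sqrt _; set b := Num.sqrt _ => a0 <- b0.
    by rewrite /= ; field; rewrite !gt_eqF.
  have [->|kl] := eqVneq k l; first by rewrite big1// => j _; rewrite eqxx.
  have [j kj] : exists j, tnth k j != tnth l j.
    apply/existsP; apply: contraNT kl => /existsPn h; apply/eqP/eq_from_tnth => j.
    by have := h j; rewrite negbK => /eqP.
  by rewrite (bigD1 j)//= (negPf kj) mul0r.
- by move=> j; apply: measurable_funM; [exact: measurable_horner|exact: measurable_gauss_weight].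
- by move=> j; exact: integrable_poly_weight.
Qed.

End ortho.

(** * L2 limits of linear combinations and their multipliers *)

Section sqint.
Context d (T : measurableType d) (R : realType) (mu : {measure set T -> \bar R}).
Implicit Types f g G : T -> R.

(** The square of the L2 norm, for plain functions and with values in the extended
    reals, so that no integrability has to be carried around. *)
Definition sqint f : \bar R := (\int[mu]_x ((f x) ^+ 2)%:E)%E.

Lemma measurable_sqr f : measurable_fun setT f ->
  measurable_fun setT (fun x => ((f x) ^+ 2)%:E).
Proof. by move=> mf; apply/measurable_EFinP; exact: measurable_funX. Qed.

Lemma le_sqint f g (C : R) : 0 <= C ->
  measurable_fun setT f -> measurable_fun setT g ->
  (forall x, `|f x| <= C * `|g x|) -> (sqint f <= (C ^+ 2)%:E * sqint g)%E.
Proof.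
move=> C0 mf mg fg; rewrite /sqint -ge0_integralZl//; last 3 first.
- exact: measurable_sqr.
- by move=> x _; rewrite lee_fin sqr_ge0.
- by rewrite lee_fin sqr_ge0.
apply: ge0_le_integral => //.
- by move=> x _; rewrite lee_fin sqr_ge0.
- exact: measurable_sqr.
- by apply: emeasurable_funM => //; exact: measurable_sqr.
- move=> x _; rewrite -EFinM lee_fin -exprMn.
  rewrite -[f x ^+ 2]ger0_norm ?sqr_ge0// -[leRHS]ger0_norm ?sqr_ge0// !normrX.
  by rewrite lerXn2r ?nnegrE// normrM [`|C|]ger0_norm.
Qed.

Lemma sqintD f g : measurable_fun setT f -> measurable_fun setT g ->
  (sqint (fun x => (f x + g x)%R) <= 2%:E * sqint f + 2%:E * sqint g)%E.
Proof.
move=> mf mg; rewrite /sqint -!ge0_integralZl//; try exact: measurable_sqr;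
  try by move=> x _; rewrite lee_fin sqr_ge0.
rewrite -ge0_integralD//; first last.
- by apply: emeasurable_funM => //; exact: measurable_sqr.
- by move=> x _; rewrite -EFinM lee_fin mulr_ge0 ?sqr_ge0.
- by apply: emeasurable_funM => //; exact: measurable_sqr.
- by move=> x _; rewrite -EFinM lee_fin mulr_ge0 ?sqr_ge0.
apply: ge0_le_integral => //.
- by move=> x _; rewrite lee_fin sqr_ge0.
- by apply: measurable_sqr; exact: measurable_funD.
- by apply: emeasurable_funD; apply: emeasurable_funM => //; exact: measurable_sqr.
- move=> x _; rewrite -!EFinM -EFinD lee_fin.
  have := sqr_ge0 (f x - g x); nra.
Qed.

Lemma sqint_dominated (f_ : nat -> T -> R) f G :
  (forall n, measurable_fun setT (f_ n)) -> measurable_fun setT f ->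
  measurable_fun setT G -> (forall x, f_ ^~ x @ \oo --> f x) ->
  (forall n x, `|f_ n x - f x| <= G x) -> (sqint G < +oo)%E ->
  forall e : R, 0 < e -> exists n, (sqint (fun x => (f_ n x - f x)%R) <= e%:E)%E.
Proof.
move=> mf_ mf mG cf hG iG e e0.
have [_ _ L] : [/\ mu.-integrable setT (fun=> 0 : \bar R)%E,
   ([sequence (\int[mu]_x `|((f_ n x - f x) ^+ 2)%:E - 0|)%E]_n @ \oo --> 0%E) &
   ([sequence (\int[mu]_x ((f_ n x - f x) ^+ 2)%:E)%E]_n @ \oo --> (\int[mu]_x 0%E)%E)].
  apply: (@dominated_convergence _ _ _ mu setT measurableT (fun n x => ((f_ n x - f x) ^+ 2)%:E)
      (fun=> 0%E) (fun x => ((G x) ^+ 2)%:E)).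
  - by move=> n; apply: measurable_sqr; exact: measurable_funB.
  - exact: measurable_cst.
  - apply: aeW => x _; apply: cvg_EFin; first by near=> n.
    have : (f_ n x - f x) * (f_ n x - f x) @[n --> \oo] --> (f x - f x) * (f x - f x).
      by apply: cvgM; apply: cvgB; [exact: cf|exact: cvg_cst|exact: cf|exact: cvg_cst].
    by rewrite subrr mul0r; under eq_fun do rewrite -expr2.
  - apply/integrableP; split; first exact: measurable_sqr.
    rewrite (eq_integral (fun x => ((G x) ^+ 2)%:E)) // => x _.
    by rewrite /= ger0_norm ?sqr_ge0.
  - apply: aeW => x n _; rewrite /= lee_fin normrX lerXn2r ?nnegrE//.
    by rewrite (le_trans _ (hG n x)).
move: L; rewrite integral0 => L.
have : \forall n \near \oo, (sqint (fun x => (f_ n x - f x)%R) < e%:E)%E.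
  apply: (L [set y | (y < e%:E)%E]); apply: open_nbhs_nbhs; split.
    exact: open_ereal_lt_ereal.
  by rewrite /= lte_fin.
by case=> N _ /(_ N (leqnn N)) /ltW ?; exists N.
Unshelve. all: by end_near.
Qed.

End sqint.

Section closure.
Context d (T : measurableType d) (R : realType) (mu : {measure set T -> \bar R}).
Context (I : Type) (H : I -> T -> R).
Hypothesis mH : forall i, measurable_fun setT (H i).
Hypothesis fH : forall i, (sqint mu (H i) < +oo)%E.
Implicit Types f g u v : T -> R.

(** The linear span of the family H, built one term at a time: this suits the
    inductions on linear combinations. *)
Inductive lspan : (T -> R) -> Prop :=
| lspan_0 : lspan (fun=> 0)
| lspan_D (a : R) i p : lspan p -> lspan (fun x => a * H i x + p x).

Lemma lspan_gen i : lspan (H i).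
Proof.
have := lspan_D 1 i lspan_0; congr lspan.
by apply/funext => x; rewrite mul1r addr0.
Qed.

Lemma lspanD p q : lspan p -> lspan q -> lspan (fun x => p x + q x).
Proof.
move=> sp sq; elim: sp => [|a i r _ IH].
  by have := sq; congr lspan; apply/funext => x; rewrite add0r.
have := lspan_D a i IH; congr lspan.
by apply/funext => x; rewrite addrA.
Qed.

Lemma lspanZ b p : lspan p -> lspan (fun x => b * p x).
Proof.
elim => [|a i r _ IH].
  by have := lspan_0; congr lspan; apply/funext => x; rewrite mulr0.
have := lspan_D (b * a) i IH; congr lspan.
by apply/funext => x; rewrite mulrDr mulrA.
Qed.

Lemma measurable_lspan p : lspan p -> measurable_fun setT p.
Proof.
elim => [|a i r _ IH]; first exact: measurable_cst.
by apply: measurable_funD => //; apply: measurable_funM => //; exact: measurable_cst.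
Qed.

Lemma lspan_mul v : (forall i, lspan (fun x => H i x * v x)) ->
  forall p, lspan p -> lspan (fun x => p x * v x).
Proof.
move=> hv p; elim => [|a i r _ IH].
  by have := lspan_0; congr lspan; apply/funext => x; rewrite mul0r.
have := lspanD (lspanZ a (hv i)) IH; congr lspan.
by apply/funext => x; rewrite mulrDl mulrA.
Qed.

Definition l2closure f := measurable_fun setT f /\
  forall e : R, 0 < e -> exists2 p, lspan p & (sqint mu (fun x => (f x - p x)%R) <= e%:E)%E.

Lemma l2closure_span p : lspan p -> l2closure p.
Proof.
move=> sp; split; first exact: measurable_lspan.
move=> e e0; exists p => //; rewrite /sqint.
rewrite (eq_integral (fun=> 0%E)) ?integral0 ?lee_fin ?ltW// => x _.
by rewrite subrr expr0n.
Qed.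

Lemma l2closure_lim f : measurable_fun setT f ->
  (forall e : R, 0 < e -> exists2 g, l2closure g & (sqint mu (fun x => (g x - f x)%R) <= e%:E)%E) ->
  l2closure f.
Proof.
move=> mf hf; split=> // e e0.
have e4 : 0 < e / 4 by lra.
have [g [mg Wg] gf] := hf _ e4; have [p sp pg] := Wg _ e4; exists p => //.
have mp := measurable_lspan sp.
have := @sqintD _ _ _ mu (fun x => f x - g x) (fun x => g x - p x).
move=> /(_ (measurable_funB mf mg) (measurable_funB mg mp)).
rewrite (_ : (fun x => _) = (fun x => f x - p x)); last by apply/funext => x; ring.
move=> /le_trans; apply.
have -> : e%:E = (2%:E * (e / 4)%:E + 2%:E * (e / 4)%:E)%E.
  by rewrite -!EFinM -EFinD; congr (_%:E); field.
apply: leeD; apply: lee_wpmul2l; rewrite ?lee_fin//.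
move: gf; rewrite /sqint; under eq_integral do rewrite -sqrrN opprB; by [].
Qed.

Lemma l2closureD f g : l2closure f -> l2closure g -> l2closure (fun x => f x + g x).
Proof.
move=> [mf Wf] [mg Wg]; split=> [|e e0]; first exact: measurable_funD.
have e4 : 0 < e / 4 by lra.
have [p sp hp] := Wf _ e4; have [q sq hq] := Wg _ e4.
exists (fun x => p x + q x); first exact: lspanD.
have mp := measurable_lspan sp; have mq := measurable_lspan sq.
have := @sqintD _ _ _ mu (fun x => f x - p x) (fun x => g x - q x).
move=> /(_ (measurable_funB mf mp) (measurable_funB mg mq)).
rewrite (_ : (fun x => _) = (fun x => f x + g x - (p x + q x))); last by apply/funext => x; ring.
move=> /le_trans; apply.
have -> : e%:E = (2%:E * (e / 4)%:E + 2%:E * (e / 4)%:E)%E.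
  by rewrite -!EFinM -EFinD; congr (_%:E); field.
by apply: leeD; apply: lee_wpmul2l; rewrite ?lee_fin.
Qed.

Lemma l2closure_bounded_mul f u (C : R) : 0 < C -> measurable_fun setT u ->
  (forall x, `|u x| <= C) -> l2closure f ->
  (forall p, lspan p -> l2closure (fun x => p x * u x)) ->
  l2closure (fun x => f x * u x).
Proof.
move=> C0 mu_ uC [mf Wf] hu; apply: l2closure_lim; first exact: measurable_funM.
move=> e e0.
have [|p sp hp] := Wf (e / C ^+ 2); first by rewrite divr_gt0 ?exprn_gt0.
have mp := measurable_lspan sp.
exists (fun x => p x * u x); first exact: hu.
apply: (@le_trans _ _ ((C ^+ 2)%:E * sqint mu (fun x => (f x - p x)%R))%E).
  apply: le_sqint; first exact: ltW.
  - by apply: measurable_funB; exact: measurable_funM.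
  - exact: measurable_funB.
  - by move=> x; rewrite -mulrBl normrM mulrC distrC ler_wpM2r.
apply: le_trans (lee_wpmul2l _ hp) _; first by rewrite lee_fin exprn_ge0 ?ltW.
by rewrite -EFinM lee_fin mulrC divfK// gt_eqF ?exprn_gt0.
Qed.

Lemma l2closureZ b f : l2closure f -> l2closure (fun x => f x * b).
Proof.
have b0 : 0 < `|b| + 1 by rewrite ltr_pwDr.
move=> Wf; apply: (@l2closure_bounded_mul f (fun=> b) (`|b| + 1) b0) => //.
- by move=> x; rewrite lerDl.
- move=> p sp; apply: l2closure_span.
  by have := lspanZ b sp; congr lspan; apply/funext => x; rewrite mulrC.
Qed.

Lemma l2closure_fin f : l2closure f -> (sqint mu f < +oo)%E.
Proof.
move=> [mf Wf]; have [p sp hp] := Wf _ ltr01.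
have mp := measurable_lspan sp.
have fp : (sqint mu p < +oo)%E.
  elim: sp => [|a i r sr IH].
    rewrite /sqint (eq_integral (fun=> 0%E)) ?integral0 ?ltry// => x _.
    by rewrite expr0n.
  apply: le_lt_trans (sqintD mu _ (measurable_lspan sr)) _.
    by apply: measurable_funM => //; exact: measurable_cst.
  apply: lte_add_pinfty; apply: lte_mul_pinfty; rewrite ?lee_fin//.
  apply: le_lt_trans (@le_sqint _ _ _ mu _ (H i) `|a| _ _ (mH i) _) _ => //.
  - by apply: measurable_funM => //; exact: measurable_cst.
  - by move=> x; rewrite normrM.
  - by apply: lte_mul_pinfty => //; rewrite lee_fin exprn_ge0.
have := @sqintD _ _ _ mu (fun x => f x - p x) p (measurable_funB mf mp) mp.
rewrite (_ : (fun x => _) = f); last by apply/funext => x; ring.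
move=> /le_lt_trans; apply.
apply: lte_add_pinfty; apply: lte_mul_pinfty; rewrite ?lee_fin//.
by apply: le_lt_trans hp _; rewrite ltry.
Qed.

(** The bound is a parameter so that [multiplier_lim] can require a uniform one. *)
Definition multiplier (C : R) u := [/\ measurable_fun setT u,
  forall x, `|u x| <= C & forall f, l2closure f -> l2closure (fun x => f x * u x)].

Lemma multiplier_cst (b : R) : multiplier `|b| (fun=> b).
Proof. by split=> // f; exact: l2closureZ. Qed.

Lemma multiplierD C D u v : multiplier C u -> multiplier D v ->
  multiplier (C + D) (fun x => u x + v x).
Proof.
move=> [mu_ uC hu] [mv vD hv]; split; first exact: measurable_funD.
  by move=> x; rewrite (le_trans (ler_normD _ _))// lerD.
move=> f Wf; have := l2closureD (hu _ Wf) (hv _ Wf).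
by congr l2closure; apply/funext => x; rewrite mulrDr.
Qed.

Lemma multiplierM C D u v : multiplier C u -> multiplier D v ->
  multiplier (C * D) (fun x => u x * v x).
Proof.
move=> [mu_ uC hu] [mv vD hv]; split; first exact: measurable_funM.
  by move=> x; rewrite normrM ler_pM.
move=> f Wf; have := hv _ (hu _ Wf).
by congr l2closure; apply/funext => x; rewrite mulrA.
Qed.

Lemma multiplier_le C D u : (forall x, `|u x| <= D) -> multiplier C u -> multiplier D u.
Proof. by move=> uD [mu_ _ hu]; split. Qed.

(** Dominated convergence: the square of f (u_n - u) is at most 4 C ^ 2 f ^ 2. *)
Lemma multiplier_lim C (u_ : nat -> T -> R) u : (forall n, multiplier C (u_ n)) ->
  (forall x, u_ ^~ x @ \oo --> u x) -> multiplier C u.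
Proof.
move=> hu cu.
have mu_ : measurable_fun setT u.
  by apply: (measurable_fun_cvg (h := u_)) => [n|x _]; [case: (hu n)|exact: cu].
have uC x : `|u x| <= C.
  apply: (cvgr_to_le (cvg_norm (cu x))).
  by near=> n; case: (hu n).
split=> // f Wf; have [mf _] := Wf.
apply: l2closure_lim; first exact: measurable_funM.
move=> e e0.
have m_ n : measurable_fun setT (u_ n) by case: (hu n).
have [n hn] : exists n, (sqint mu (fun x => (f x * u_ n x - f x * u x)%R) <= e%:E)%E.
  apply: (@sqint_dominated _ _ _ mu (fun n x => f x * u_ n x) _ (fun x => `|2 * C| * `|f x|)) => //.
  - by move=> n; exact: measurable_funM.
  - exact: measurable_funM.
  - by apply: measurable_funM => //; exact: measurableT_comp.
  - by move=> x; apply: cvgMr; exact: cu.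
  - move=> n x; rewrite -mulrBr normrM mulrC ler_wpM2r//.
    have [_ unC _] := hu n; rewrite (le_trans (ler_normB _ _))//.
    by apply: le_trans (ler_norm _); have := unC x; have := uC x; lra.
  - apply: le_lt_trans (@le_sqint _ _ _ mu _ f `|2 * C| _ _ mf _) _ => //.
    + by apply: measurable_funM => //; exact: measurableT_comp.
    + by move=> x; rewrite normrM !normr_id.
    + by apply: lte_mul_pinfty; rewrite ?lee_fin ?exprn_ge0//; exact: l2closure_fin.
exists (fun x => f x * u_ n x) => //; by case: (hu n) => _ _; apply.
Unshelve. all: by end_near.
Qed.

(** The odd polynomial q(y) = y (3 - y ^ 2) / 2 maps [-1, 1] to itself with fixed
    points -1, 0 and 1, and its iterates converge pointwise to the sign. *)
Lemma multiplier_sgn u : multiplier 1 u -> multiplier 1 (fun x => Num.sg (u x)).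
Proof.
move=> hu.
pose q (y : R) := y * (3 - y ^+ 2) / 2.
have q1 y : `|y| <= 1 -> `|q y| <= 1.
  rewrite !ler_norml /q => /andP[y1 y2].
  have a1 : 0 <= (1 - y) ^+ 2 * (2 + y) by rewrite mulr_ge0 ?sqr_ge0//; lra.
  have a2 : 0 <= (1 + y) ^+ 2 * (2 - y) by rewrite mulr_ge0 ?sqr_ge0//; lra.
  by apply/andP; split; lra.
have hq n : multiplier 1 (fun x => iter n q (u x)).
  elim: n => // n IH.
  have M2 : multiplier (1 * (`|3| + `|-1| * (1 * 1)) * `|2^-1|)
      (fun x => iter n q (u x) * (3 + (-1) * (iter n q (u x) * iter n q (u x))) * 2^-1).
    apply: multiplierM (multiplier_cst _); apply: multiplierM => //.
    apply: multiplierD (multiplier_cst _) _; apply: multiplierM (multiplier_cst _) _.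
    exact: multiplierM.
  have E : (fun x => iter n.+1 q (u x)) = (fun x => iter n q (u x) * (3 + (-1) * (iter n q (u x) * iter n q (u x))) * 2^-1).
    by apply/funext => x; rewrite iterS /q expr2 mulN1r.
  rewrite E; apply: multiplier_le M2 => x; rewrite -[X in `|X|]/(( fun x => _) x) -E iterS.
  by apply: q1; case: IH.
apply: (multiplier_lim hq) => x.
have [_ uC _] := hu.
have qN y : q (- y) = - q y by rewrite /q sqrrN; ring.
have iqN n y : iter n q (- y) = - iter n q y.
  by elim: n => //= n ->; rewrite qN.
(* 1 - q(z) = (1 - z) (1 - (z + z ^ 2) / 2), and the last factor is at most
     1 - y / 2 as long as z >= y, which the iteration preserves. *)
have pos y : 0 < y -> y <= 1 -> iter n q y @[n --> \oo] --> (1 : R).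
  move=> y0 y1; pose r := 1 - y / 2.
  have B n : y <= iter n q y <= 1 /\ 1 - iter n q y <= r ^+ n.
    elim: n => [|n [/andP[h1 h2] h3]] /=; first by rewrite lexx y1 expr0; split=> //; lra.
    set z := iter n q y in h1 h2 h3 *.
    have z0 : 0 < z by apply: lt_le_trans h1.
    have E : 1 - q z = (1 - z) * (1 - (z + z ^+ 2) / 2) by rewrite /q; field.
    have r0 : 0 <= r by rewrite /r; lra.
    split.
      apply/andP; split; first by rewrite /q; nra.
      by rewrite -subr_ge0 E mulr_ge0// ?subr_ge0//; nra.
    have z1 : 0 <= 1 - z by rewrite subr_ge0.
    have zz : 0 <= 1 - (z + z ^+ 2) / 2 by nra.
    have zr : 1 - (z + z ^+ 2) / 2 <= r by rewrite /r; nra.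
    by rewrite E [r ^+ n.+1]exprSr ler_pM.
  apply/cvgrPdist_le => e e0.
  have /cvgrPdist_le/(_ _ e0) : r ^+ n @[n --> \oo] --> (0 : R).
    by apply: cvg_expr; rewrite ltr_norml /r; apply/andP; split; lra.
  apply: filterS => n; rewrite sub0r normrN => h.
  have [/andP[_ h1] h2] := B n.
  rewrite ger0_norm ?subr_ge0// (le_trans h2)// (le_trans _ h)// ler_norm.
  by [].
have := uC x; rewrite ler_norml => /andP[u1 u2].
have [u0|u0|u0] := ltgtP (u x) 0.
- rewrite ltr0_sg//.
  have -> : (fun n => iter n q (u x)) = (fun n => - iter n q (- u x)).
    by apply/funext => n; rewrite iqN opprK.
  by apply: cvgN; apply: pos; lra.
- by rewrite gtr0_sg//; exact: pos.
- rewrite u0 sgr0; have -> : (fun n => iter n q 0) = fun=> 0.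
    by apply/funext; elim=> //= n ->; rewrite /q !mul0r.
  exact: cvg_cst.
Qed.

(** The indicator of the positive reals is (sg + sg ^ 2) / 2. *)
Lemma multiplier_pos C u : multiplier C u -> multiplier 1 \1_[set x | 0 < u x].
Proof.
move=> hu.
have [C1 C10 CC1] : exists2 D : R, 0 < D & C <= D.
  by exists (`|C| + 1); [rewrite ltr_pwDr|have := ler_norm C; lra].
have hv : multiplier 1 (fun x => u x * C1^-1).
  apply: multiplier_le (multiplierM hu (multiplier_cst C1^-1)) => x.
  rewrite normrM [`|C1^-1|]gtr0_norm ?invr_gt0// ler_pdivrMr// mul1r.
  by case: hu => _ /(_ x) h _; exact: le_trans h CC1.
have hs := multiplier_sgn hv.
have := multiplierM (multiplierD hs (multiplierM hs hs)) (multiplier_cst 2^-1).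
rewrite (_ : (fun x => _) = \1_[set x | 0 < u x] :> (T -> R)); last first.
  apply/funext => x; rewrite indicE sgrM [Num.sg C1^-1]gtr0_sg ?invr_gt0// mulr1.
  have [u0|u0|u0] := ltgtP (u x) 0.
  - rewrite ltr0_sg// memNset; last by apply/negP; rewrite -leNgt ltW.
    by rewrite mulr0n mulrNN mulr1 addNr mul0r.
  - by rewrite gtr0_sg// mem_set// mulr1n mulr1; field.
  - rewrite u0 sgr0 memNset; last by rewrite /= u0 ltxx.
    by rewrite mulr0n mulr0 addr0 mul0r.
apply: multiplier_le => x; rewrite indicE; case: (_ \in _) => /=; rewrite ?normr1 ?normr0//.
Qed.


(** Complements are 1 - u, intersections are products, and countable unions are
    pointwise limits of finite ones. *)
Lemma multiplier_sigma_algebra :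
  sigma_algebra [set: T] [set E | multiplier 1 \1_E].
Proof.
have b1 (E : set T) x : `|\1_E x : R| <= 1.
  by rewrite indicE; case: (_ \in _); rewrite ?normr1 ?normr0.
have hC E : multiplier 1 \1_E -> multiplier 1 \1_(~` E).
  move=> hE. have := multiplierD (multiplier_cst 1) (multiplierM (multiplier_cst (-1)) hE).
  rewrite (_ : (fun x => _) = \1_(~` E) :> (T -> R)); first exact: multiplier_le.
  by apply/funext => x; rewrite !indicE in_setC; case: (_ \in _) => /=; ring.
have hI E F : multiplier 1 \1_E -> multiplier 1 \1_F -> multiplier 1 \1_(E `&` F).
  move=> hE hF; have := multiplierM hE hF.
  rewrite (_ : (fun x => _) = \1_(E `&` F) :> (T -> R)); first exact: multiplier_le.
  by apply/funext => x; rewrite !indicE in_setI -natrM mulnb.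
have h0 : multiplier 1 \1_(set0 : set T).
  by rewrite indic0; apply: multiplier_le (multiplier_cst 0) => x; rewrite normr0.
split=> [//|E /= hE|F hF]; first by rewrite setTD; exact: hC.
have hB n : multiplier 1 \1_(\bigcup_(i < n) F i).
  elim: n => [|n IH]; first by rewrite bigcup_mkord big_ord0.
  rewrite bigcup_mkord big_ord_recr /= -bigcup_mkord.
  rewrite -[X in \1_X]setCK setCU.
  by apply: (hC); apply: (hI); apply: (hC); [exact: IH|exact: (hF n)].
apply: (multiplier_lim hB) => x; apply: cvg_near_cst.
have [[i _ Fi]|nF] := pselect ((\bigcup_i F i) x).
  exists i.+1 => // n /= ni; rewrite !indicE !mem_set//; last by exists i.
  by exists i.
apply: nearW => n; rewrite !indicE !memNset// => -[i _ Fi]; apply: nF; by exists i.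
Qed.

Lemma l2closure_sum (J : Type) (s : seq J) (F : J -> T -> R) :
  (forall j, l2closure (F j)) -> l2closure (fun x => \sum_(j <- s) F j x).
Proof.
move=> hF; elim: s => [|j s IH].
  apply: l2closure_span; have := lspan_0; congr lspan.
  by apply/funext => x; rewrite big_nil.
have := l2closureD (hF j) IH; congr l2closure.
by apply/funext => x; rewrite big_cons.
Qed.

Import HBNNSimple.

(** Simple functions are combinations of indicators, and nonnegative functions
    are dominated limits of simple functions. *)
Lemma l2closure_total f : l2closure (fun=> 1) ->
  (forall E, measurable E -> multiplier 1 \1_E) ->
  measurable_fun setT f -> (sqint mu f < +oo)%E -> l2closure f.
Proof.
move=> W1 hE; have WE E : measurable E -> l2closure \1_E.
  move=> mE; have [_ _ /(_ _ W1)] := hE _ mE; congr l2closure.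
  by apply/funext => x; rewrite mul1r.
have pos g : (forall x, 0 <= g x) -> measurable_fun setT g ->
    (sqint mu g < +oo)%E -> l2closure g.
  move=> g0 mg gfin.
  have mE : measurable_fun setT (EFin \o g) by exact/measurable_EFinP.
  pose h := nnsfun_approx measurableT mE.
  have hcvg x : h n x @[n --> \oo] --> g x.
    have : EFin (h n x) @[n --> \oo] --> (EFin \o g) x.
      by apply: cvg_nnsfun_approx => // y _; rewrite lee_fin.
    by move=> /fine_cvgP[].
  have hle n x : h n x <= g x.
    rewrite -(cvg_lim (@Rhausdorff R) (hcvg x)); apply: nondecreasing_cvgn_le.
      by move=> i j ij; have /lefP := nd_nnsfun_approx measurableT mE ij; apply.
    by apply/cvg_ex; exists (g x); exact: hcvg.
  have Wh (k : {nnsfun T >-> R}) : l2closure k.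
    have := @l2closure_sum _ (finmap.enum_fset (fset_set (range k))) (fun y x => \1_(k @^-1` [set y]) x * y).
    move=> /(_ _)[]; last first.
      move=> mk hk; rewrite (_ : (k : T -> R) = fun x => \sum_(y <- finmap.enum_fset (fset_set (range k))) \1_(k @^-1` [set y]) x * y); first by split.
      apply/funext => x; rewrite [LHS](fimfunE k) fsbig_finite//=.
      by apply: eq_bigr => y _; rewrite mulrC.
    by move=> y; apply: l2closureZ; apply: WE; exact: measurable_sfunP.
  apply: l2closure_lim => // e e0.
  have [n hn] : exists n, (sqint mu (fun x => (h n x - g x)%R) <= e%:E)%E.
    apply: (@sqint_dominated _ _ _ mu (fun n => h n) g g) => // n x.
    by rewrite ler0_norm ?subr_le0// opprB lerBlDr lerDl.
  by exists (h n).
move=> mf ff.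
have Wp : l2closure f^\+.
  apply: pos => //; first exact: measurable_funrpos.
  apply: le_lt_trans (@le_sqint _ _ _ mu _ f 1 _ _ mf _) _ => //.
  - exact: measurable_funrpos.
  - move=> x; rewrite mul1r /funrpos; have [f0|f0] := leP (f x) 0; last by [].
    by rewrite normr0.
  - by rewrite expr1n mul1e.
have Wn : l2closure f^\-.
  apply: pos => //; first exact: measurable_funrneg.
  apply: le_lt_trans (@le_sqint _ _ _ mu _ f 1 _ _ mf _) _ => //.
  - exact: measurable_funrneg.
  - move=> x; rewrite mul1r /funrneg; have [f0|f0] := leP (- f x) 0.
      by rewrite normr0.
    by rewrite normrN.
  - by rewrite expr1n mul1e.
have := l2closureD Wp (l2closureZ (-1) Wn); congr l2closure.
by rewrite -[RHS]funrposBneg; apply/funext => x; rewrite mulrN1.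
Qed.

End closure.

(** * Completeness of the Hermite functions *)

Section hermite_dense.
Context {R : realType} (d : nat).
Local Notation gauss := (@gaussian R d).
Local Notation H := (@hermite_tuple R d).
Local Notation hspan := (@lspan _ _ R _ H).
Local Notation hclosure := (@l2closure _ _ _ gauss _ H).

Lemma hermite_tuple_sqint k : (sqint gauss (H k) < +oo)%E.
Proof.
have /integrableP[_] := Lfun2_integrable_sqr (@hermite_tuple_Lfun R d k).
rewrite /sqint; under eq_integral do rewrite /= ger0_norm ?sqr_ge0//.
by [].
Qed.

Definition set_tnth (k : d.-tuple nat) (j : 'I_d) (m : nat) :=
  [tuple (if i == j then m else tnth k i) | i < d].

Lemma hermite_set_tnth k j m x : H (set_tnth k j m) x =
  hermite m (tnth x j) * \prod_(i < d | i != j) hermite (tnth k i) (tnth x i).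
Proof.
rewrite /hermite_tuple (bigD1 j)//= tnth_mktuple eqxx; congr (_ * _).
by apply: eq_bigr => i ij; rewrite tnth_mktuple (negPf ij).
Qed.

Lemma hermite_set_tnth_id k j x : H k x =
  hermite (tnth k j) (tnth x j) * \prod_(i < d | i != j) hermite (tnth k i) (tnth x i).
Proof. by rewrite /hermite_tuple (bigD1 j). Qed.

Lemma hspan_mulX j p : hspan p -> hspan (fun x => p x * tnth x j).
Proof.
apply: lspan_mul => k; case E : (tnth k j) => [|m].
  have := lspan_gen H (set_tnth k j 1); congr lspan; apply/funext => x.
  by rewrite hermite_set_tnth (hermite_set_tnth_id k j) E -mulX_hermite0; ring.
have := lspanD (lspanZ (Num.sqrt m.+2%:R) (lspan_gen H (set_tnth k j m.+2)))
  (lspanZ (Num.sqrt m.+1%:R) (lspan_gen H (set_tnth k j m))).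
congr lspan; apply/funext => x.
rewrite !hermite_set_tnth (hermite_set_tnth_id k j) E.
rewrite mulrA [X in _ + X]mulrA -mulrDl -mulX_hermite; ring.
Qed.

Lemma hspan1 : hspan (fun=> 1).
Proof.
have := lspan_gen H (nseq_tuple d 0); congr lspan; apply/funext => x.
by rewrite /hermite_tuple big1// => i _; rewrite tnth_nseq hermite0.
Qed.

(** The square of the exponential factor is exp (x_j ^ 2 / 4), which the Gaussian
    weight absorbs together with the growth of the polynomial. *)
Lemma hermite_exp_sqint k j :
  (sqint gauss (fun x => (H k x * expR (tnth x j ^+ 2 / 8))%R) < +oo)%E.
Proof.
pose F i (y : R) := hermite (tnth k i) y ^+ 2 *
  (if i == j then expR (y ^+ 2 / 4) else 1) * gauss_weight y.
have F0 i y : 0 <= F i y.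
  rewrite /F mulr_ge0 ?expR_ge0// mulr_ge0 ?sqr_ge0//.
  by case: ifP => _; rewrite ?expR_ge0.
have mexp (c : R) : measurable_fun setT (fun y : R => expR (y ^+ 2 / c)).
  by apply: measurableT_comp => //; apply: measurable_funM => //; exact: measurable_funX.
have mF i : measurable_fun setT (F i).
  apply: measurable_funM; last exact: measurable_gauss_weight.
  apply: measurable_funM; first by apply: measurable_funX; exact: measurable_hermite.
  by case: (i == j) => //; exact: measurable_cst.
have iF i : (\int[@lebesgue_measure R]_x (F i x)%:E < +oo)%E.
  have [p hp] := @hermite_poly R (tnth k i).
  have [C C0 hC] := poly_gauss_bound (p ^+ 2).
  suff bnd y : `|F i y| <= C * expR (- (y ^+ 2 / 8)).
    have /integrableP[_] := integrable_gauss_bound (mF i) bnd.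
    by under eq_integral do rewrite /= ger0_norm//.
  rewrite ger0_norm// /F hp -horner_exp.
  have := hC y; rewrite ger0_norm ?horner_exp ?sqr_ge0// => h.
  apply: (@le_trans _ _ (C * expR (y ^+ 2 / 8) * expR (y ^+ 2 / 4) * gauss_weight y)).
    rewrite ler_wpM2r ?expR_ge0// ler_pM ?sqr_ge0//.
      by case: ifP; rewrite ?expR_ge0.
    by case: ifP => // _; rewrite -[leLHS]expR0 ler_expR divr_ge0// sqr_ge0.
  rewrite -!mulrA ler_wpM2l// -!expRD ler_expR; lra.
have mG : measurable_fun setT (fun x : d.-tuple R => H k x * expR (tnth x j ^+ 2 / 8)).
  apply: measurable_funM; first exact: measurable_hermite_tuple.
  apply: (measurableT_comp (mexp 8)); exact: measurable_tnth.
rewrite /sqint ge0_integral_gaussian; last 2 first.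
- exact: measurable_sqr.
- by move=> x; rewrite lee_fin sqr_ge0.
rewrite (eq_integral (fun x => ((2 * pi) `^ (- (d%:R / 2)))%:E *
    (\prod_(i < d) F i (tnth x i))%:E)%E); last first.
  move=> x _; rewrite gauss_densityE -!EFinM mulrCA; congr (_ * _)%:E.
  rewrite /F big_split /= [X in _ = X * _]big_split /= exprMn -prodrXl; congr (_ * _ * _).
  rewrite (bigD1 j)//= eqxx big1 ?mulr1; last by move=> i /negPf ->.
  by rewrite -expRM_natl; congr expR; field.
rewrite ge0_integralZl//; first last.
- by rewrite lee_fin powR_ge0.
- by move=> x _; rewrite lee_fin prodr_ge0.
- by apply/measurable_EFinP; exact: measurable_prod_tuple.
apply: lte_mul_pinfty; rewrite ?lee_fin ?powR_ge0//.
exact: lebesgue_prod_lty.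
Qed.

(** The Taylor polynomials of exp (- x_j ^ 2 / 8) are bounded by
    exp (x_j ^ 2 / 8), so [hermite_exp_sqint] allows dominated convergence in
    L2 for their products with a Hermite function. *)
Lemma hclosure_mul_gauss p j : hspan p ->
  hclosure (fun x => p x * expR (- (tnth x j ^+ 2 / 8))).
Proof.
have mX : measurable_fun setT (fun x : d.-tuple R => - (tnth x j ^+ 2 / 8)).
  apply: measurableT_comp => //; apply: measurable_funM => //.
  by apply: measurable_funX; exact: measurable_tnth.
have hs p0 n : hspan p0 -> hspan (fun x => p0 x * series (exp_coeff (- (tnth x j ^+ 2 / 8))) n).
  move=> sp; rewrite /series /=; elim: n => [|n IH].
    by have := lspan_0 H; congr lspan; apply/funext => x; rewrite big_geq// mulr0.
  have hpow m : hspan (fun x => p0 x * (- (tnth x j ^+ 2 / 8)) ^+ m).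
    elim: m => [|m IHm]; first by have := sp; congr lspan; apply/funext => x; rewrite expr0 mulr1.
    have := lspanZ (- 8^-1) (hspan_mulX j (hspan_mulX j IHm)); congr lspan.
    by apply/funext => x; rewrite [_ ^+ m.+1]exprSr; field.
  have := lspanD IH (lspanZ (n`!%:R)^-1 (hpow n)); congr lspan.
  by apply/funext => x; rewrite big_nat_recr//= /exp_coeff /= mulrDr [_^-1 * _]mulrC mulrA.
elim => [|a k r _ IH].
  apply: l2closure_span; first exact: measurable_hermite_tuple.
  by have := lspan_0 H; congr lspan; apply/funext => x; rewrite mul0r.
suff W : hclosure (fun x => H k x * expR (- (tnth x j ^+ 2 / 8))).
  have mHt := @measurable_hermite_tuple R d.
  have := l2closureD mHt (l2closureZ mHt a W) IH; congr l2closure.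
  by apply/funext => x; ring.
apply: l2closure_lim.
- exact: measurable_hermite_tuple.
- apply: measurable_funM; first exact: measurable_hermite_tuple.
  exact: measurableT_comp.
move=> e e0.
have ser_le (y : R) n : `|series (exp_coeff y) n| <= expR `|y|.
  rewrite /series /=; apply: le_trans (ler_norm_sum _ _ _) _.
  rewrite (_ : \sum_(0 <= i < n) _ = series (exp_coeff `|y|) n); last first.
    apply: eq_bigr => i _; rewrite /exp_coeff /= normrM normrX; congr (_ * _).
    by rewrite ger0_norm ?invr_ge0.
  apply: nondecreasing_cvgn_le; last exact: is_cvg_series_exp_coeff.
  by apply: nondecreasing_series => i _; rewrite /exp_coeff /= divr_ge0 ?exprn_ge0.
have [n hn] : exists n, (sqint gauss (fun x => (H k x * series (exp_coeff (- (tnth x j ^+ 2 / 8))) n -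
    H k x * expR (- (tnth x j ^+ 2 / 8)))%R) <= e%:E)%E.
  have mexp : measurable_fun setT (fun x : d.-tuple R => H k x * expR (tnth x j ^+ 2 / 8)).
    apply: measurable_funM; first exact: measurable_hermite_tuple.
    apply: measurableT_comp => //; apply: measurable_funM => //.
    by apply: measurable_funX; exact: measurable_tnth.
  apply: (@sqint_dominated _ _ _ gauss (fun n x => H k x * series (exp_coeff (- (tnth x j ^+ 2 / 8))) n)
     _ (fun x => 2 * `|H k x * expR (tnth x j ^+ 2 / 8)|)) => //.
  - move=> n; have := hs _ n (lspan_gen H k); apply: measurable_lspan.
    exact: measurable_hermite_tuple.
  - apply: measurable_funM; first exact: measurable_hermite_tuple.
    exact: measurableT_comp.
  - by apply: measurable_funM => //; exact: measurableT_comp.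
  - by move=> x; apply: cvgMr; exact: is_cvg_series_exp_coeff.
  - move=> n x; rewrite -mulrBr !normrM mulrCA ler_wpM2l//.
    have y0 : 0 <= tnth x j ^+ 2 / 8 by rewrite divr_ge0// sqr_ge0.
    apply: le_trans (ler_normB _ _) _.
    rewrite mulr_natl mulr2n [`|expR (_ / 8)|]ger0_norm ?expR_ge0// lerD//.
      by apply: le_trans (ser_le _ _) _; rewrite normrN ger0_norm.
    by rewrite ger0_norm ?expR_ge0// ler_expR; lra.
  - apply: le_lt_trans (@le_sqint _ _ _ gauss _ _ 2 _ _ mexp _) _ => //.
    + by apply: measurable_funM => //; exact: measurableT_comp.
    + by move=> x; rewrite normrM normr_id ger0_norm.
    + by apply: lte_mul_pinfty; rewrite ?lee_fin//; exact: hermite_exp_sqint.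
exists (fun x => H k x * series (exp_coeff (- (tnth x j ^+ 2 / 8))) n) => //.
apply: l2closure_span; first exact: measurable_hermite_tuple.
exact/hs/lspan_gen.
Qed.

End hermite_dense.

Section hermite_complete.
Context {R : realType} (d : nat).
Local Notation gauss := (@gaussian R d).
Local Notation H := (@hermite_tuple R d).
Local Notation hspan := (@lspan _ _ R _ H).
Local Notation hclosure := (@l2closure _ _ _ gauss _ H).
Local Notation hmult := (@multiplier _ _ _ gauss _ H).
Let mH := @measurable_hermite_tuple R d.
Let fH := @hermite_tuple_sqint R d.

(** These multipliers have the sign of x_j - s, so that [multiplier_pos] reaches
    the half-spaces. *)
Lemma multiplier_affine_gauss j s : exists C,
  hmult C (fun x => (tnth x j - s) * expR (- (tnth x j ^+ 2 / 8))).
Proof.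
pose u (x : d.-tuple R) := (tnth x j - s) * expR (- (tnth x j ^+ 2 / 8)).
have uC x : `|u x| <= 2 + `|s|.
  rewrite /u normrM [`|expR _|]ger0_norm ?expR_ge0// expRN ler_pdivrMr ?expR_gt0//.
  set y := tnth x j.
  have e1 := expR_ge1Dx (y ^+ 2 / 8).
  have y0 : 0 <= y ^+ 2 / 8 by rewrite divr_ge0// sqr_ge0.
  apply: le_trans (ler_normB _ _) _.
  (* This is (|y| - 2) ^ 2 >= 0 up to constants, and 1 + y ^ 2 / 8 is at most
     exp (y ^ 2 / 8). *)
  have y1 : `|y| <= 2 * (1 + y ^+ 2 / 8).
    have := sqr_ge0 (`|y| - 2); rewrite -[y ^+ 2]real_normK ?num_real//; nra.
  have s0 := normr_ge0 s.
  rewrite mulrDl lerD//; first by apply: le_trans y1 _; lra.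
  by rewrite ler_peMr//; lra.
have mu_ : measurable_fun setT u.
  apply: measurable_funM; first by apply: measurable_funB => //; exact: measurable_tnth.
  apply: measurableT_comp => //; apply: measurableT_comp => //.
  by apply: measurable_funM => //; apply: measurable_funX; exact: measurable_tnth.
exists (2 + `|s|); split=> // f Wf.
apply: (l2closure_bounded_mul mH _ mu_ uC Wf) => [|p sp]; first by rewrite ltr_pwDl.
have := hclosure_mul_gauss j (lspanD (hspan_mulX j sp) (lspanZ (- s) sp)).
by congr l2closure; apply/funext => x; rewrite /u; ring.
Qed.

(** Half-spaces generate the product sigma-algebra. *)
Lemma multiplier_measurable (E : set (d.-tuple R)) : measurable E -> hmult 1 \1_E.
Proof.
have [S0 SC SU] := multiplier_sigma_algebra mH fH.
set S := [set E | hmult 1 \1_E] in S0 SC SU *.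
have ray j (B : set R) : measurable B -> S ((fun x : d.-tuple R => tnth x j) @^-1` B).
  move=> mB0; have mB : (@ocitv R).-sigma.-measurable B by exact: mB0.
  rewrite RGenOInfty.measurableE in mB.
  apply: (smallest_sub (C := sigma_algebra setT) (X := [set B | S ((fun x : d.-tuple R => tnth x j) @^-1` B)]) _ _ mB).
    split=> /= [|A SA|F SF].
    - by rewrite preimage_set0.
    - by have := SC _ SA; rewrite !setTD preimage_setC.
    - by rewrite preimage_bigcup; exact: SU.
  move=> _ [s ->] /=; have [C hC] := multiplier_affine_gauss j s.
  have := multiplier_pos mH fH hC; rewrite /S /=; congr (hmult 1 \1_ _).
  apply/seteqP; split=> x /=; rewrite in_itv/= andbT pmulr_lgt0 ?expR_gt0// subr_gt0//.
apply: (smallest_sub (C := sigma_algebra setT) (X := S)) => //.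
elim/big_ind: _ => //= [A B hA hB|j _].
  by rewrite subUset.
by move=> _ [B mB <-]; rewrite setTI; exact: ray.
Qed.

Lemma hermite_dense (f : d.-tuple R -> R) : measurable_fun setT f ->
  (sqint gauss f < +oo)%E -> hclosure f.
Proof.
apply: (l2closure_total mH); last exact: multiplier_measurable.
by apply: (l2closure_span _ mH); exact: hspan1.
Qed.

End hermite_complete.

(** * Parseval's identity *)

Section inner_product.
Context d (T : measurableType d) (R : realType) (mu : {measure set T -> \bar R}).
Local Notation L := (LspaceType mu (lee1n 2)).
Local Notation F := (LfunType mu (lee1n 2)).

Lemma measurable_Lspace (f : L) : measurable_fun setT (f : T -> R).
Proof. by have := Lspace_Lfun f; rewrite inE => /andP[]; rewrite inE. Qed.

Definition Lspace_ip (f g : L) : R := \int[mu]_x ((f : T -> R) x * (g : T -> R) x).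

Lemma integrable_Lspace_mul (f g : L) :
  mu.-integrable setT (EFin \o (fun x => (f : T -> R) x * (g : T -> R) x)).
Proof.
apply/Lfun1_integrable; apply: Lfun2_mul_Lfun1; exact: Lspace_Lfun.
Qed.

Lemma Lspace_ipC (f g : L) : Lspace_ip f g = Lspace_ip g f.
Proof. by apply: eq_Rintegral => x _; rewrite mulrC. Qed.

Lemma Lspace_ip_class (g : F) (h : L) :
  Lspace_ip (Lclass g) h = \int[mu]_x ((g : T -> R) x * (h : T -> R) x).
Proof.
congr fine; apply: ae_eq_integral => //.
- exact: measurable_int (integrable_Lspace_mul (Lclass g) h).
- apply/measurable_EFinP; apply: measurable_funM; last exact: measurable_Lspace.
  exact: (@measurable_funPT _ _ _ _ (g : {mfun T >-> R})).
- by have := LclassK g; apply: filterS => x /= gx _; rewrite gx.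
Qed.

Lemma Lspace_ipD (f g h : L) : Lspace_ip (f + g) h = Lspace_ip f h + Lspace_ip g h.
Proof.
have -> : f + g = Lclass (Lrepr f + Lrepr g) by [].
rewrite Lspace_ip_class /Lspace_ip -RintegralD//; try exact: integrable_Lspace_mul.
by apply: eq_Rintegral => x _; rewrite /= mulrDl.
Qed.

Lemma Lspace_ipZ a (f h : L) : Lspace_ip (a *: f) h = a * Lspace_ip f h.
Proof.
have -> : a *: f = Lclass (a *: Lrepr f) by [].
rewrite Lspace_ip_class /Lspace_ip -RintegralZl//; try exact: integrable_Lspace_mul.
by apply: eq_Rintegral => x _; rewrite /= mulrA.
Qed.

Lemma Lspace_norm_sqint (f : L) : ((Lspace_norm f) ^+ 2)%:E = sqint mu (f : T -> R).
Proof.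
have ff : ('N[mu]_2%:E[EFin \o (f : T -> R)] \is a fin_num)%E.
  rewrite ge0_fin_numE ?Lnorm_ge0//.
  by have := Lspace_Lfun f; rewrite inE => /andP[_]; rewrite inE.
have n0 : 0 <= fine ('N[mu]_2%:E[EFin \o (f : T -> R)])%E by rewrite fine_ge0// Lnorm_ge0.
have := @poweR_Lnorm _ _ _ mu (EFin \o (f : T -> R)) 2.
rewrite -[X in (X `^ _)%E](fineK ff) poweR_EFin powR_mulrn// => ->; last by rewrite pnatr_eq0.
apply: eq_integral => x _ /=.
by rewrite powR_mulrn// -normrX ger0_norm// sqr_ge0.
Qed.

Lemma Lspace_norm_ip (f : L) : (Lspace_norm f) ^+ 2 = Lspace_ip f f.
Proof. by rewrite -[LHS]/(fine ((_ ^+ 2)%:E)) Lspace_norm_sqint /sqint /Lspace_ip /Rintegral; under eq_integral do rewrite expr2. Qed.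

End inner_product.

Section parseval.
Context {R : realType} (d : nat).
Local Notation gauss := (@gaussian R d).
Local Notation L := (LspaceType gauss (lee1n 2)).
Local Notation H := (@hermite_tuple R d).

Definition hermite_class (k : d.-tuple nat) : L :=
  Lclass (Lfun_Sub (lee1n 2) (@hermite_tuple_Lfun R d k)).

Lemma hermite_coefE (f : L) k : hermite_coef f k = Lspace_ip f (hermite_class k).
Proof.
rewrite Lspace_ipC Lspace_ip_class.
by apply: eq_Rintegral => x _; rewrite /= mulrC.
Qed.

Lemma hermite_coef_class_ortho k l :
  hermite_coef (hermite_class k) l = (k == l)%:R.
Proof. by rewrite hermite_coef_class hermite_tuple_ortho. Qed.

Lemma hermite_coef_comb (s : seq (d.-tuple nat)) (a : d.-tuple nat -> R) l :
  uniq s -> hermite_coef (\sum_(k <- s) a k *: hermite_class k) l =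
  if l \in s then a l else 0.
Proof.
have coef0 : hermite_coef (0 : L) l = 0.
  by rewrite -(scale0r (0 : L)) hermite_coefZ mul0r.
elim: s => [|k s IH]; first by rewrite big_nil.
move=> /= /andP[ks us]; rewrite big_cons hermite_coefD hermite_coefZ IH//.
rewrite hermite_coef_class_ortho in_cons eq_sym.
have [->|_] := eqVneq l k; first by rewrite (negPf ks) addr0 mulr1.
by rewrite mulr0 add0r.
Qed.

(** Among the combinations over s, the partial sum of the Hermite series is the
    closest to f. *)
Lemma norm_sub_comb (f : L) (s : seq (d.-tuple nat)) (a : d.-tuple nat -> R) :
  uniq s -> Lspace_norm (f - \sum_(k <- s) a k *: hermite_class k) ^+ 2 =
  Lspace_norm f ^+ 2 - \sum_(k <- s) hermite_coef f k ^+ 2 +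
    \sum_(k <- s) (a k - hermite_coef f k) ^+ 2.
Proof.
move=> us; set p := \sum_(k <- s) _.
have ipsum (g : L) : Lspace_ip p g = \sum_(k <- s) a k * hermite_coef g k.
  rewrite /p; elim: (s) => [|k t IH].
    by rewrite !big_nil -(scale0r (0 : L)) Lspace_ipZ mul0r.
  by rewrite !big_cons Lspace_ipD Lspace_ipZ IH Lspace_ipC -hermite_coefE.
have -> : f - p = f + (-1) *: p by rewrite scaleN1r.
rewrite !Lspace_norm_ip Lspace_ipD Lspace_ipZ ![Lspace_ip _ (f + _)]Lspace_ipC.
rewrite !Lspace_ipD !Lspace_ipZ ![Lspace_ip f p]Lspace_ipC !ipsum.
have -> : \sum_(k <- s) a k * hermite_coef p k = \sum_(k <- s) a k * a k.
  rewrite big_seq [RHS]big_seq; apply: eq_bigr => k ks.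
  by rewrite hermite_coef_comb// ks.
have -> : \sum_(k <- s) (a k - hermite_coef f k) ^+ 2 = \sum_(k <- s) a k * a k -
    2 * (\sum_(k <- s) a k * hermite_coef f k) + \sum_(k <- s) hermite_coef f k ^+ 2.
  rewrite mulr_sumr -sumrB -big_split /=; apply: eq_bigr => k _; ring.
ring.
Qed.

Lemma lspan_comb p : lspan H p -> exists (s : seq (d.-tuple nat)) (a : d.-tuple nat -> R),
  uniq s /\ p = fun x => \sum_(k <- s) a k * H k x.
Proof.
elim => [|b i r _ [s [a [us ->]]]].
  by exists [::], (fun=> 0); split=> //; apply/funext => x; rewrite big_nil.
have [si|si] := boolP (i \in s).
  exists s, (fun k => a k + (k == i)%:R * b); split=> //; apply/funext => x.
  under [RHS]eq_bigr do rewrite mulrDl.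
  rewrite big_split /= addrC; congr (_ + _).
  rewrite (bigD1_seq i)//= eqxx mul1r big1 ?addr0// => k /negPf ->.
  by rewrite !mul0r.
exists (i :: s), (fun k => if k == i then b else a k); split; first by rewrite /= si.
apply/funext => x; rewrite big_cons eqxx; congr (_ + _).
rewrite big_seq [RHS]big_seq; apply: eq_bigr => k ks.
by case: eqP => // ki; rewrite -ki ks in si.
Qed.

Lemma hermite_comb_class (s : seq (d.-tuple nat)) (a : d.-tuple nat -> R) :
  ((\sum_(k <- s) a k *: hermite_class k : L) : d.-tuple R -> R) =
  (fun x => \sum_(k <- s) a k * H k x) %[ae gauss].
Proof.
pose g k := Lfun_Sub (lee1n 2) (@hermite_tuple_Lfun R d k).
have -> : \sum_(k <- s) a k *: hermite_class k = Lclass (\sum_(k <- s) a k *: g k).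
  elim: s => [|k s IH]; first by rewrite !big_nil.
  by rewrite !big_cons IH LclassD LclassZ.
apply: (ae_eq_trans (LclassK _)).
have E x : ((\sum_(k <- s) a k *: g k : LfunType gauss (lee1n 2)) : d.-tuple R -> R) x = \sum_(k <- s) a k * H k x.
  elim: s => [|k s IH]; first by rewrite !big_nil.
  by rewrite !big_cons /= -IH.
by apply: aeW => x _; rewrite E.
Qed.

Lemma bessel (f : L) (s : seq (d.-tuple nat)) : uniq s ->
  \sum_(k <- s) hermite_coef f k ^+ 2 <= Lspace_norm f ^+ 2.
Proof.
move=> us; have := norm_sub_comb f (hermite_coef f) us.
have -> : \sum_(k <- s) (hermite_coef f k - hermite_coef f k) ^+ 2 = 0.
  by apply: big1 => k _; rewrite subrr expr0n.
by rewrite addr0 -subr_ge0 => <-; rewrite sqr_ge0.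
Qed.

(** One inequality is Bessel's.  For the other, a combination within e of f in
    square norm can only be improved by taking the Hermite coefficients of f. *)
Theorem parseval (f : L) : ((Lspace_norm f) ^+ 2)%:E =
  (\esum_(k in [set: d.-tuple nat]) ((hermite_coef f k) ^+ 2)%:E)%E.
Proof.
apply/eqP; rewrite eq_le; apply/andP; split; last first.
  apply: ge_ereal_sup => _ [X [finX _] <-].
  rewrite fsbig_finite//= sumEFin lee_fin bessel//.
  exact: finmap.fset_uniq.
have fin : (sqint gauss (f : d.-tuple R -> R) < +oo)%E.
  by rewrite -Lspace_norm_sqint ltry.
have mf := measurable_Lspace f.
have [_ dens] := hermite_dense mf fin.
apply/lee_addgt0Pr => e e0; have [p /lspan_comb[s [a [us pE]]] hp] := dens _ e0.
have := norm_sub_comb f a us; set P := \sum_(k <- s) _ => N.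
have mp : measurable_fun setT p.
  rewrite pE; apply: measurable_sum => k; apply: measurable_funM => //.
  exact: measurable_hermite_tuple.
have le_e : Lspace_norm (f - P) ^+ 2 <= e.
  rewrite -lee_fin Lspace_norm_sqint; apply: le_trans hp.
  rewrite le_eqVlt; apply/orP; left; apply/eqP; apply: ae_eq_integral => //.
  - by apply: measurable_sqr; exact: measurable_Lspace.
  - by apply: measurable_sqr; exact: measurable_funB.
  - have -> : f - P = Lclass (Lrepr f - Lrepr P).
      by rewrite LclassD -[X in _ + X]Lclass_opp !LreprK.
    have h1 := LclassK (Lrepr f - Lrepr P); have h2 := hermite_comb_class s a.
    move: h1 h2; apply: filterS2 => x /= h1 h2 _.
    by rewrite h1// pE -(h2 Logic.I).
apply: (@le_trans _ _ ((\sum_(k <- s) hermite_coef f k ^+ 2)%:E + e%:E)%E).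
  rewrite -EFinD lee_fin.
  have : 0 <= \sum_(k <- s) (a k - hermite_coef f k) ^+ 2.
    by apply: sumr_ge0 => k _; exact: sqr_ge0.
  lra.
rewrite leeD2r// -sumEFin fsbig_seq//.
apply: ereal_sup_ubound; exists [set` s]; last by [].
by split => //; exact: finite_seq.
Qed.

End parseval.

(** * Dimension counting and seminorms *)

Section linear_algebra.
Context {R : fieldType}.

(** All the lower bounds below produce their extremal vector from this. *)
Lemma exists_left_kernel n r (B : 'I_n -> 'I_r -> R) : (r < n)%N ->
  exists2 a : 'I_n -> R, (exists i, a i != 0) & forall j, \sum_i a i * B i j = 0.
Proof.
move=> rn; pose M := \matrix_(i, j) B i j.
have : kermx M != 0.
  by rewrite -mxrank_eq0 mxrank_ker subn_eq0 -ltnNge (leq_ltn_trans (rank_leq_col _)).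
case/rowV0Pn => v /sub_kermxP vM v0; exists (fun i => v ord0 i).
  by have /rV0Pn := v0.
move=> j; have /matrixP/(_ ord0 j) := vM; rewrite !mxE => E.
by rewrite -[RHS]E; apply: eq_bigr => i _; rewrite mxE.
Qed.

End linear_algebra.

Section finite_rank.
Context {R : realType} {Z Y : lmodType R}.
Variables (F : {linear Z -> Y}).

(** A largest independent family of values of F has at most m members, and by
    maximality it spans the range. *)
Lemma range_has_dim m (w : 'I_m -> Y) :
  (forall z, exists b : 'I_m -> R, F z = \sum_i b i *: w i) ->
  exists2 r, (r < m.+1)%N & has_dim (range F) r.
Proof.
move=> Fw.
pose P r := exists v : 'I_r -> Z,
  forall a : 'I_r -> R, \sum_i a i *: F (v i) = 0 -> forall i, a i = 0.
have Pm r : P r -> (r <= m)%N.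
  move=> [v iv]; rewrite leqNgt; apply/negP => mr.
  have /choice[B FB] := fun j => Fw (v j).
  have [a [i /negP ai] aB] := exists_left_kernel B mr; apply: ai; apply/eqP/iv.
  under eq_bigr do rewrite FB scaler_sumr.
  rewrite exchange_big /= big1// => j _.
  under eq_bigr do rewrite scalerA.
  by rewrite -scaler_suml aB scale0r.
have exP : exists r, `[< P r >].
  by exists 0%N; apply/asboolP; exists (fun=> 0) => a _ [].
have ubP r : `[< P r >] -> (r <= m)%N by move=> /asboolP/Pm.
case: (ex_maxnP exP ubP) => r /asboolP[v iv] rmax.
exists r; first by rewrite ltnS; apply: Pm; exists v.
exists (F \o v); split=> //; apply/seteqP; split=> y; last first.
  by move=> [b _ <-]; exists (\sum_i b i *: v i) => //; rewrite linear_sum; apply: eq_bigr => i _; rewrite linearZ.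
move=> [z _ <-].
pose v' (i : 'I_r.+1) := if unlift ord0 i is Some j then v j else z.
have nP : ~ (forall a : 'I_r.+1 -> R, \sum_i a i *: F (v' i) = 0 -> forall i, a i = 0).
  move=> h; suff : (r.+1 <= r)%N by rewrite ltnn.
  by apply: rmax; apply/asboolP; exists v'.
move: nP => /existsNP[a /not_implyP[a0 /existsNP[i ai]]].
have {}a0 : a ord0 *: F z + \sum_(j < r) a (lift ord0 j) *: F (v j) = 0.
  rewrite -[RHS]a0 big_ord_recl /v' unlift_none; congr (_ + _).
  by apply: eq_bigr => j _; rewrite liftK.
have an0 : a ord0 != 0.
  apply/eqP => az; rewrite az scale0r add0r in a0.
  have aa := iv (fun j => a (lift ord0 j)) a0; apply: ai.
  by case: (unliftP ord0 i) => [j|] ->; [exact: aa|].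
have FE : \sum_j (- (a ord0)^-1 * a (lift ord0 j)) *: F (v j) = F z.
  under eq_bigr do rewrite -scalerA.
  rewrite -scaler_sumr scaleNr -scalerN.
  rewrite (_ : - _ = a ord0 *: F z) ?scalerA ?mulVf ?scale1r//.
  by apply/esym/eqP; rewrite -addr_eq0 a0.
by exists (fun j => - (a ord0)^-1 * a (lift ord0 j)).
Qed.

End finite_rank.

Section seminorm.
Context {R : realType}.
Implicit Types X Y Z : snormedSpace R.

Lemma snorm0 X : snorm (0 : X) = 0.
Proof. by rewrite -(scale0r (0 : X)) snormZ normr0 mul0r. Qed.

Lemma snormN X (x : X) : snorm (- x) = snorm x.
Proof. by rewrite -scaleN1r snormZ normrN1 mul1r. Qed.

Lemma snorm_ge0 X (x : X) : 0 <= snorm x.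
Proof.
have := snormD x (- x); rewrite subrr snorm0 snormN; lra.
Qed.

Lemma opnorm_on_ge X Y (M : set X) (f : X -> Y) (x : X) (tau : R) :
  (forall a, M (a *: x)) -> (forall a, snorm (f (a *: x)) = `|a| * snorm (f x)) ->
  0 < snorm x -> tau * snorm x <= snorm (f x) -> (tau%:E <= opnorm_on M f)%E.
Proof.
move=> Mx fx x0 h; apply: (@le_trans _ _ (snorm (f ((snorm x)^-1 *: x)))%:E).
  rewrite lee_fin fx ger0_norm ?invr_ge0 ?snorm_ge0//.
  by rewrite mulrC ler_pdivlMr.
apply: ereal_sup_ubound; exists ((snorm x)^-1 *: x) => //; split=> //.
by rewrite /unit_ball /= snormZ ger0_norm ?invr_ge0 ?snorm_ge0// mulVf ?gt_eqF.
Qed.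

Lemma opnorm_on_le X Y (M : set X) (f : X -> Y) (tau : R) :
  (forall x, M x -> snorm x <= 1 -> snorm (f x) <= tau) -> (opnorm_on M f <= tau%:E)%E.
Proof.
move=> h; apply: ge_ereal_sup => _ [x [Mx x1] <-]; rewrite lee_fin.
exact: h.
Qed.

(** An operator of rank less than n vanishes at some nonzero combination of the
    n vectors z_i, and there the approximation error is the value of S. *)
Lemma approximation_number_ge Z Y (S : {linear Z -> Y}) n (z : 'I_n -> Z) (tau : R) :
  (forall a : 'I_n -> R, (exists i, a i != 0) -> 0 < snorm (\sum_i a i *: z i) /\
     tau * snorm (\sum_i a i *: z i) <= snorm (S (\sum_i a i *: z i))) ->
  (tau%:E <= approximation_number S n)%E.
Proof.
move=> h; apply: le_ereal_inf_tmp => _ [A [_ [r rn [v [_ rA]]]] <-].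
have /choice[B AB] : forall i, exists b : 'I_r -> R, A (z i) = \sum_j b j *: v j.
  move=> i; have Ri : range A (A (z i)) by exists (z i).
  by move: Ri; rewrite rA => -[b _ <-]; exists b.
have [a a0 aB] := exists_left_kernel B rn; have [x0 hx] := h a a0.
have Ax : A (\sum_i a i *: z i) = 0.
  rewrite linear_sum /=; under eq_bigr do rewrite linearZ /= AB scaler_sumr.
  rewrite exchange_big /= big1// => j _.
  under eq_bigr do rewrite scalerA.
  by rewrite -scaler_suml aB scale0r.
apply: (opnorm_on_ge (x := \sum_i a i *: z i)) => //.
  by move=> b; rewrite !linearZ_LR -scalerDr snormZ.
by rewrite Ax subr0.
Qed.

End seminorm.

(** * Diagonal operators *)

Section diagonal.
Context {R : realType}.

(** T is the identity on coefficients, from a weighted to an unweighted space of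
    square summable families: c gives the coefficients in the target and e the
    basis of the source.  Weights at least 1 make T a contraction. *)
Record diagonal_system (X Y : snormedSpace R) (T : {linear X -> Y}) (I : choiceType)
  (c : Y -> I -> R) (e : I -> X) (rho : I -> R) : Prop := DiagonalSystem {
  diag_coefD : forall y z i, c (y + z) i = c y i + c z i;
  diag_coefZ : forall a y i, c (a *: y) i = a * c y i;
  diag_coef_basis : forall i j, c (T (e i)) j = (i == j)%:R;
  diag_target : forall y, ((snorm y) ^+ 2)%:E = (\esum_(i in [set: I]) ((c y i) ^+ 2)%:E)%E;
  diag_source : forall x, ((snorm x) ^+ 2)%:E =
    (\esum_(i in [set: I]) (rho i * (c (T x) i) ^+ 2)%:E)%E;
  diag_weight : forall i, 1 <= rho i }.

Context {X Y : snormedSpace R} (T : {linear X -> Y}) (I : choiceType).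
Context (c : Y -> I -> R) (e : I -> X) (rho : I -> R).
Hypothesis D : diagonal_system T c e rho.
Let cD := diag_coefD D.
Let cZ := diag_coefZ D.
Let ce := diag_coef_basis D.
Let nY := diag_target D.
Let nX := diag_source D.
Let rho1 := diag_weight D.

Let rho_ge0 i : 0 <= rho i. Proof. exact: le_trans (rho1 i). Qed.
Let rho_gt0 i : 0 < rho i. Proof. exact: lt_le_trans (rho1 i). Qed.

Lemma diag_coef0 i : c 0 i = 0.
Proof. by rewrite -(scale0r (0 : Y)) cZ mul0r. Qed.

Lemma diag_coef_sum (J : Type) (s : seq J) (F : J -> Y) i :
  c (\sum_(j <- s) F j) i = \sum_(j <- s) c (F j) i.
Proof.
elim: s => [|j s IH]; first by rewrite !big_nil diag_coef0.
by rewrite !big_cons cD IH.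
Qed.

Lemma diag_coefB y z i : c (y - z) i = c y i - c z i.
Proof. by rewrite -scaleN1r cD cZ mulN1r. Qed.

Section family.
Context (n : nat) (k : 'I_n -> I).
Hypothesis kinj : injective k.

Definition diag_comb (a : 'I_n -> R) : X := \sum_i a i *: e (k i).

Lemma coef_diag_comb a i : c (T (diag_comb a)) (k i) = a i.
Proof.
rewrite linear_sum diag_coef_sum (bigD1 i)//= linearZ /= cZ ce eqxx mulr1.
rewrite big1 ?addr0// => j ji; rewrite linearZ /= cZ ce (_ : (k j == k i) = false) ?mulr0//.
by apply/negP => /eqP/kinj/eqP; rewrite (negPf ji).
Qed.

Lemma coef_diag_comb_out a l : (forall i, k i <> l) -> c (T (diag_comb a)) l = 0.
Proof.
move=> kl; rewrite linear_sum diag_coef_sum big1// => j _.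
rewrite linearZ /= cZ ce (_ : (k j == l) = false) ?mulr0//.
by apply/negP => /eqP /kl.
Qed.

Let image_sum (f : I -> \bar R) :
  (\sum_i f (k i) = \sum_(l \in [set` [seq k i | i <- enum 'I_n]]) f l)%E.
Proof.
rewrite -fsbig_seq; first by rewrite big_map big_enum.
by rewrite map_inj_uniq// enum_uniq.
Qed.

Let image_mem l : (l \in [seq k i | i <- enum 'I_n]) = `[< exists i, k i = l >].
Proof.
apply/mapP/asboolP => -[i]; first by move=> _ ->; exists i.
by move=> <-; exists i => //; rewrite mem_enum.
Qed.

Lemma sum_le_esum (f : I -> R) : (forall i, 0 <= f i) ->
  ((\sum_i f (k i))%:E <= \esum_(i in [set: I]) (f i)%:E)%E.
Proof.
move=> f0; rewrite -sumEFin (image_sum (fun i => (f i)%:E)).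
apply: ereal_sup_ubound; exists [set` [seq k i | i <- enum 'I_n]] => //.
Qed.

Lemma esum_family (f : I -> R) : (forall i, 0 <= f i) ->
  (forall l, (forall i, k i <> l) -> f l = 0) ->
  (\esum_(i in [set: I]) (f i)%:E = (\sum_i f (k i))%:E)%E.
Proof.
move=> f0 fout; rewrite -sumEFin (image_sum (fun i => (f i)%:E)).
rewrite -esum_fset; last 2 first.
- exact: finite_seq.
- by move=> i _; rewrite lee_fin.
rewrite [RHS]esum_mkcond.
apply: eq_esum => l _; rewrite mem_setE image_mem; case: asboolP => // nl.
by rewrite fout// => i kl; apply: nl; exists i.
Qed.

Lemma diag_bessel y : \sum_i (c y (k i)) ^+ 2 <= snorm y ^+ 2.
Proof. by rewrite -lee_fin nY; apply: (sum_le_esum (f := fun i => (c y i) ^+ 2)) => i; exact: sqr_ge0. Qed.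

Lemma target_norm_comb a : snorm (T (diag_comb a)) ^+ 2 = \sum_i a i ^+ 2.
Proof.
apply: EFin_inj; rewrite nY (esum_family (f := fun i => (c (T (diag_comb a)) i) ^+ 2)).
- by congr (_%:E); apply: eq_bigr => i _; rewrite coef_diag_comb.
- by move=> i; exact: sqr_ge0.
- by move=> l kl; rewrite coef_diag_comb_out// expr0n.
Qed.

Lemma source_norm_comb a : snorm (diag_comb a) ^+ 2 = \sum_i rho (k i) * a i ^+ 2.
Proof.
apply: EFin_inj; rewrite nX (esum_family (f := fun i => rho i * (c (T (diag_comb a)) i) ^+ 2)).
- by congr (_%:E); apply: eq_bigr => i _; rewrite coef_diag_comb.
- by move=> i; rewrite mulr_ge0 ?sqr_ge0.
- by move=> l kl; rewrite coef_diag_comb_out// expr0n mulr0.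
Qed.

Lemma diag_tail (t : R) x : 0 <= t -> (forall l, (forall i, k i <> l) -> t <= rho l) ->
  (forall i, c (T x) (k i) = 0) -> t * snorm (T x) ^+ 2 <= snorm x ^+ 2.
Proof.
move=> t0 ht xk; rewrite -lee_fin EFinM nY nX -esumZl_EFin//; last first.
  by move=> i; rewrite lee_fin sqr_ge0.
apply: le_esum => l _; rewrite -EFinM lee_fin.
have [[i <-]|nl] := pselect (exists i, k i = l); first by rewrite xk expr0n !mulr0.
by rewrite ler_wpM2r ?sqr_ge0// ht// => i kl; apply: nl; exists i.
Qed.

Lemma source_sub_proj x :
  snorm (x - diag_comb (fun i => c (T x) (k i))) ^+ 2 <= snorm x ^+ 2.
Proof.
rewrite -lee_fin !nX; apply: le_esum => l _; rewrite lee_fin ler_wpM2l//.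
rewrite linearB diag_coefB.
have [[i <-]|nl] := pselect (exists i, k i = l).
  by rewrite coef_diag_comb subrr expr0n sqr_ge0.
by rewrite coef_diag_comb_out ?subr0// => i kl; apply: nl; exists i.
Qed.

(** The coefficients removed by the projection are those of small weight. *)
Lemma diag_error (t : R) x : 0 <= t -> (forall l, (forall i, k i <> l) -> t <= rho l) ->
  t * snorm (T x - T (diag_comb (fun i => c (T x) (k i)))) ^+ 2 <= snorm x ^+ 2.
Proof.
move=> t0 ht; rewrite -linearB; apply: le_trans (source_sub_proj x).
apply: diag_tail => // i; by rewrite linearB diag_coefB coef_diag_comb subrr.
Qed.

End family.

End diagonal.

Section ell2_coordinates.
Context {R : realType}.
Local Notation cnt := (@counting nat R).
Local Notation L := (LspaceType cnt (lee1n 2)).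

(** Elements of ell2 are classes of functions, but a null set of the counting
    measure is empty, so coordinates are well defined and linear. *)
Lemma counting_ae (P : nat -> Prop) : {ae cnt, forall i, P i} -> forall i, P i.
Proof.
move=> [A [mA A0 PA]] i; apply: contrapT => nPi.
have Ai : A i by apply: PA.
have : (1 <= cnt A)%E.
  apply: (@le_trans _ _ (cnt [set i])); last first.
    by apply: le_measure; rewrite ?inE// => x /= ->.
  rewrite /counting; case: asboolP => [fA|[]]; last exact: finite_set1.
  by rewrite fset_set1 finmap.cardfs1.
by rewrite A0 lee_fin ler10.
Qed.

Definition ell2_coord (z : ell2 R) (i : nat) : R := ((z : L) : nat -> R) i.

Lemma ell2_coordD (y z : ell2 R) i : ell2_coord (y + z) i = ell2_coord y i + ell2_coord z i.
Proof.
have /counting_ae h := LclassK (Lrepr (y : L) + Lrepr (z : L)).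
exact: (h i Logic.I).
Qed.

Lemma ell2_coordZ a (z : ell2 R) i : ell2_coord (a *: z) i = a * ell2_coord z i.
Proof.
have /counting_ae h := LclassK (a *: Lrepr (z : L)).
exact: (h i Logic.I).
Qed.

Lemma ell2_coord0 i : ell2_coord 0 i = 0.
Proof. by rewrite -(scale0r (0 : ell2 R)) ell2_coordZ mul0r. Qed.

Lemma ell2_norm (z : ell2 R) :
  ((snorm z) ^+ 2)%:E = (\sum_(0 <= i <oo) ((ell2_coord z i) ^+ 2)%:E)%E.
Proof.
rewrite Lspace_norm_sqint /sqint ge0_integral_count// => i.
by rewrite lee_fin sqr_ge0.
Qed.

Lemma ell2_bessel n (z : ell2 R) : \sum_(i < n) (ell2_coord z i) ^+ 2 <= snorm z ^+ 2.
Proof.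
rewrite -lee_fin ell2_norm -sumEFin -(big_mkord predT (fun i => ((ell2_coord z i) ^+ 2)%:E)).
by apply: nneseries_lim_ge => i _ _; rewrite lee_fin sqr_ge0.
Qed.

Lemma delta_Lfun (i : nat) : (fun j : nat => (i == j)%:R : R) \in Lfun cnt 2%:E.
Proof.
rewrite inE; apply/andP; split; rewrite inE/=; first by [].
rewrite /finite_norm unlock /Lnorm; apply: poweR_lty.
rewrite ge0_integral_count; last by move=> j; rewrite poweR_ge0.
rewrite (@nneseries_split _ _ 0 i.+1)//; last by move=> j _; rewrite poweR_ge0.
rewrite eseries0 ?adde0; last first.
  move=> j /= ij _; rewrite add0n in ij.
  by rewrite (_ : (i == j) = false) ?normr0 ?powR0//; lia.
by rewrite add0n; under eq_bigr do rewrite /=; rewrite sumEFin ltry.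
Qed.

Definition ell2_delta (i : nat) : ell2 R := Lclass (Lfun_Sub (lee1n 2) (delta_Lfun i)).

Lemma ell2_coord_delta i j : ell2_coord (ell2_delta i) j = (i == j)%:R.
Proof.
have /counting_ae h := LclassK (Lfun_Sub (lee1n 2) (delta_Lfun i)).
exact: (h j Logic.I).
Qed.

Lemma ell2_coord_comb n (a : 'I_n -> R) j :
  ell2_coord (\sum_i a i *: ell2_delta i) j = \sum_i a i * (i == j :> nat)%:R.
Proof.
elim/big_rec2: _ => [|i y z _ <-]; first by rewrite ell2_coord0.
by rewrite ell2_coordD ell2_coordZ ell2_coord_delta.
Qed.

Lemma ell2_coord_comb_ord n (a : 'I_n -> R) (j : 'I_n) :
  ell2_coord (\sum_i a i *: ell2_delta i) j = a j.
Proof.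
rewrite ell2_coord_comb (bigD1 j)//= eqxx mulr1 big1 ?addr0// => i /negPf ij.
by rewrite (_ : (i == j :> nat) = false) ?mulr0.
Qed.

Lemma ell2_norm_comb n (a : 'I_n -> R) :
  snorm (\sum_i a i *: ell2_delta i) ^+ 2 = \sum_i a i ^+ 2.
Proof.
apply: EFin_inj; rewrite ell2_norm (@nneseries_split _ _ 0 n); last first.
  by move=> j _; rewrite lee_fin sqr_ge0.
rewrite eseries0 ?adde0; last first.
  move=> j /= ij _; rewrite ell2_coord_comb big1 ?expr0n// => i _.
  by rewrite (_ : (i == j :> nat) = false) ?mulr0//; have := ltn_ord i; lia.
rewrite add0n big_mkord sumEFin; congr (_%:E); apply: eq_bigr => i _.
by rewrite ell2_coord_comb_ord.
Qed.

End ell2_coordinates.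

Lemma ler_of_sqr {R : realType} (a b : R) : 0 <= b -> a ^+ 2 <= b ^+ 2 -> a <= b.
Proof.
move=> b0 h; have [a0|a0] := leP 0 a; last by apply: le_trans b0; exact: ltW.
by rewrite -(@ler_pXn2r _ 2) ?nnegrE.
Qed.

(** * Approximation, Bernstein, Gelfand, Kolmogorov and Weyl numbers *)

Section diagonal_s_numbers.
Context {R : realType} {X Y : snormedSpace R} (T : {linear X -> Y}) (I : choiceType).
Context (c : Y -> I -> R) (e : I -> X) (rho : I -> R).
Hypothesis D : diagonal_system T c e rho.
Context (m : nat) (k : 'I_m.+1 -> I) (t : R).
Hypotheses (kinj : injective k) (t0 : 0 < t).
Hypothesis rho_le : forall i, rho (k i) <= t.
Let k' (i : 'I_m) := k (widen_ord (leqnSn m) i).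
Hypothesis rho_ge : forall l, (forall i, k' i <> l) -> t <= rho l.

Let tau := (Num.sqrt t)^-1.
Let tau0 : 0 < tau. Proof. by rewrite invr_gt0 sqrtr_gt0. Qed.
Let tau2 : tau ^+ 2 = t^-1. Proof. by rewrite exprVn sqr_sqrtr// ltW. Qed.
Let k'inj : injective k'.
Proof. by move=> i j /kinj /(congr1 val) /= ij; exact: val_inj. Qed.

Let comb := @diag_comb R X I e.

Let sum_sq_gt0 n (a : 'I_n -> R) : (exists i, a i != 0) -> 0 < \sum_i a i ^+ 2.
Proof.
move=> [i ai]; rewrite (bigD1 i)//= ltr_pwDl ?exprn_even_gt0//.
by apply: sumr_ge0 => j _; rewrite sqr_ge0.
Qed.

Let comb_norm_gt0 (a : 'I_m.+1 -> R) : (exists i, a i != 0) -> 0 < snorm (comb k a).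
Proof.
move=> a0; rewrite lt_neqAle snorm_ge0 andbT eq_sym; apply/eqP => z.
have := source_norm_comb D kinj a; rewrite z expr0n /= => /esym/eqP; apply/negP.
rewrite gt_eqF//; apply: lt_le_trans (sum_sq_gt0 a0) _; apply: ler_sum => i _.
by rewrite ler_peMl ?sqr_ge0// (diag_weight D).
Qed.

Let comb_lower (a : 'I_m.+1 -> R) : tau * snorm (comb k a) <= snorm (T (comb k a)).
Proof.
apply: ler_of_sqr; first exact: snorm_ge0.
rewrite exprMn tau2 (target_norm_comb D kinj) (source_norm_comb D kinj).
rewrite ler_pdivrMl// mulr_sumr; apply: ler_sum => i _.
by rewrite ler_wpM2r ?sqr_ge0.
Qed.

Let error_le x :
  snorm (T x - T (comb k' (fun i => c (T x) (k' i)))) <= tau * snorm x.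
Proof.
apply: ler_of_sqr; first by rewrite mulr_ge0 ?snorm_ge0// ltW.
rewrite exprMn tau2 ler_pdivlMl//.
exact: (diag_error D k'inj x (ltW t0) rho_ge).
Qed.

Let tail_le x : (forall i, c (T x) (k' i) = 0) -> snorm (T x) <= tau * snorm x.
Proof.
move=> xk; apply: ler_of_sqr; first by rewrite mulr_ge0 ?snorm_ge0// ltW.
rewrite exprMn tau2 ler_pdivlMl//.
exact: (diag_tail D (ltW t0) rho_ge).
Qed.

Let proj_le x : snorm (T (comb k' (fun i => c (T x) (k' i)))) <= snorm x.
Proof.
apply: ler_of_sqr; first exact: snorm_ge0.
rewrite (target_norm_comb D k'inj); apply: le_trans (diag_bessel D k'inj _) _.
rewrite -lee_fin (diag_target D) (diag_source D); apply: le_esum => i _.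
by rewrite lee_fin ler_peMl ?sqr_ge0// (diag_weight D).
Qed.

(** Composition with a contraction A serves twice: the identity gives the
    approximation numbers and the contractions from ell2 give the Weyl numbers. *)
Lemma approximation_number_comp_le (Z : snormedSpace R) (A : {linear Z -> X})
    (S : {linear Z -> Y}) : (forall z, S z = T (A z)) ->
  (forall z, snorm (A z) <= snorm z) -> (approximation_number S m.+1 <= tau%:E)%E.
Proof.
move=> SE A1.
pose F z : Y := \sum_i c (S z) (k' i) *: T (e (k' i)).
have linF : linear F.
  move=> a y z; rewrite /F scaler_sumr -big_split; apply: eq_bigr => i _ /=.
  by rewrite linearP (diag_coefD D) (diag_coefZ D) scalerDl scalerA.
pose F' : {linear Z -> Y} := HB.pack F (GRing.isLinear.Build R Z Y _ F linF).
have FE z : F z = T (comb k' (fun i => c (T (A z)) (k' i))).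
  by rewrite linear_sum /F SE; apply: eq_bigr => i _; rewrite linearZ.
apply: (@le_trans _ _ (opnorm (fun z => S z - F' z))).
  apply: ereal_inf_lbound; exists F' => //; split.
    by exists 1 => z; rewrite mul1r /= FE; apply: le_trans (proj_le _) (A1 z).
  have [r rm hr] := @range_has_dim R Z Y F' m (fun i => T (e (k' i))) (fun z => ex_intro _ _ erefl).
  by exists r.
apply: opnorm_on_le => z _ z1; rewrite /= FE SE.
apply: le_trans (error_le _) _; rewrite -[leRHS]mulr1 ler_wpM2l ?(ltW tau0)//.
exact: le_trans (A1 z) z1.
Qed.

Lemma diag_approximation_number : approximation_number T m.+1 = tau%:E.
Proof.
apply/eqP; rewrite eq_le; apply/andP; split.
  by apply: (@approximation_number_comp_le X idfun T).
apply: (approximation_number_ge (z := fun i => e (k i))) => a a0.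
by split; [exact: comb_norm_gt0|exact: comb_lower].
Qed.

(** Lower bound: the values of T at the combinations of the n basis vectors fill
    an n-dimensional space of coefficients, so one of them is orthogonal to the
    n coefficients of every element of an (n - 1)-dimensional subspace L. *)
Lemma diag_kolmogorov_number : kolmogorov_number T m.+1 = tau%:E.
Proof.
apply/eqP; rewrite eq_le; apply/andP; split.
  apply: (@le_trans _ _ (ereal_sup [set
      ereal_inf [set (snorm (T x - y))%:E | y in range (fun a : 'I_m -> R => \sum_i a i *: T (e (k' i)))]
    | x in @unit_ball _ X])).
    apply: ereal_inf_lbound.
    exists (range (fun a : 'I_m -> R => \sum_i a i *: T (e (k' i)))) => //.
    exists (fun i => T (e (k' i))); split=> // a a0 i.
    have := coef_diag_comb D k'inj a i; rewrite linear_sum /=.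
    under eq_bigr do rewrite linearZ /=.
    by rewrite a0 (diag_coef0 D).
  apply: ge_ereal_sup => _ [x x1 <-].
  apply: (@le_trans _ _ (snorm (T x - T (comb k' (fun i => c (T x) (k' i)))))%:E).
    apply: ereal_inf_lbound; exists (T (comb k' (fun i => c (T x) (k' i)))) => //.
    exists (fun i => c (T x) (k' i)) => //.
    by rewrite linear_sum; apply: eq_bigr => i _; rewrite linearZ.
  rewrite lee_fin; apply: le_trans (error_le _) _.
  by rewrite -[leRHS]mulr1 ler_wpM2l ?(ltW tau0).
apply: le_ereal_inf_tmp => _ [L [v [_ LE]] <-].
have [a a0 aB] := exists_left_kernel (fun i j => c (v j) (k i)) (ltnSn m).
have x0 := comb_norm_gt0 a0.
pose x := (snorm (comb k a))^-1 *: comb k a.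
apply: (@le_trans _ _ (ereal_inf [set (snorm (T x - y))%:E | y in L])); last first.
  apply: ereal_sup_ubound; exists x => //.
  by rewrite /unit_ball /x /= snormZ ger0_norm ?invr_ge0 ?snorm_ge0// mulVf ?gt_eqF.
apply: le_ereal_inf_tmp => _ [y Ly <-]; rewrite lee_fin.
apply: (@le_trans _ _ (snorm (T x))).
  by rewrite /x linearZ snormZ ger0_norm ?invr_ge0 ?snorm_ge0// mulrC ler_pdivlMr//.
apply: ler_of_sqr; first exact: snorm_ge0.
apply: le_trans (diag_bessel D kinj _).
set u := (snorm (comb k a))^-1 in x *.
have Tx i : c (T x) (k i) = u * a i.
  by rewrite /x linearZ /= (diag_coefZ D) (coef_diag_comb D kinj).
have -> : snorm (T x) ^+ 2 = \sum_i (u * a i) ^+ 2.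
  rewrite /x linearZ snormZ exprMn real_normK ?num_real// (target_norm_comb D kinj).
  by rewrite mulr_sumr; apply: eq_bigr => i _; rewrite exprMn.
have y0 : \sum_i a i * c y (k i) = 0.
  move: Ly; rewrite LE => -[b _ <-].
  under eq_bigr do rewrite (diag_coef_sum D) mulr_sumr.
  rewrite exchange_big /= big1// => j _.
  under eq_bigr do rewrite (diag_coefZ D) mulrCA.
  by rewrite -mulr_sumr aB mulr0.
under [leRHS]eq_bigr do rewrite (diag_coefB D) Tx.
have -> : \sum_i (u * a i - c y (k i)) ^+ 2 = \sum_i (u * a i) ^+ 2 -
    (2 * u) * (\sum_i a i * c y (k i)) + \sum_i (c y (k i)) ^+ 2.
  by rewrite mulr_sumr -sumrB -big_split /=; apply: eq_bigr => i _; ring.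
by rewrite y0 mulr0 subr0 lerDl sumr_ge0// => i _; rewrite sqr_ge0.
Qed.

(** A subspace of codimension less than n contains a nonzero combination of the n
    basis vectors. *)
Lemma diag_gelfand_number : gelfand_number T m.+1 = tau%:E.
Proof.
apply/eqP; rewrite eq_le; apply/andP; split.
  pose M := [set x | forall i, c (T x) (k' i) = 0].
  apply: (@le_trans _ _ (opnorm_on M T)).
    apply: ereal_inf_lbound; exists M => //; exists m => //; split.
      split; first by move=> i; rewrite linear0 (diag_coef0 D).
      move=> a x y Mx My i.
      by rewrite linearP (diag_coefD D) (diag_coefZ D) Mx My mulr0 addr0.
    exists (fun i => e (k' i)); split.
      move=> a Ma i; have := coef_diag_comb D k'inj a i.
      by rewrite /diag_comb Ma.
    move=> x; exists (fun i => c (T x) (k' i)) => i.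
    by rewrite linearB (diag_coefB D) (coef_diag_comb D k'inj) subrr.
  apply: opnorm_on_le => x Mx x1; apply: le_trans (tail_le Mx) _.
  by rewrite -[leRHS]mulr1 ler_wpM2l ?(ltW tau0).
apply: le_ereal_inf_tmp => _ [M [r rm [[M0 Mlin] [v [_ Mv]]]] <-].
have /choice[B MB] := fun i => Mv (e (k i)).
have [a a0 aB] := exists_left_kernel B rm.
have Mx : M (comb k a).
  have -> : comb k a = \sum_i a i *: (e (k i) - \sum_j B i j *: v j).
    rewrite /comb /diag_comb; under [RHS]eq_bigr do rewrite scalerBr scaler_sumr.
    rewrite sumrB [X in _ = _ - X]exchange_big /= [X in _ = _ - X]big1 ?subr0// => j _.
    under eq_bigr do rewrite scalerA.
    by rewrite -scaler_suml aB scale0r.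
  elim/big_ind: _ => // [x y Mx My|i _].
    by rewrite -[x]scale1r; exact: Mlin.
  by rewrite -[X in M X]addr0; exact: Mlin.
apply: (opnorm_on_ge (x := comb k a)).
- by move=> b; rewrite -[X in M X]addr0; exact: Mlin.
- by move=> b; rewrite linearZ snormZ.
- exact: comb_norm_gt0.
- exact: comb_lower.
Qed.

(** An n-dimensional subspace contains a nonzero vector whose n - 1 coefficients
    of smallest weight vanish. *)
Lemma diag_bernstein_number : bernstein_number T m.+1 = tau%:E.
Proof.
apply/eqP; rewrite eq_le; apply/andP; split; last first.
  apply: (@le_trans _ _ (ereal_inf [set (snorm (T x) / snorm x)%:E |
      x in range (comb k) `\ 0])).
    apply: le_ereal_inf_tmp => _ [x [[a _ <-] x0] <-].
    have a0 : exists i, a i != 0.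
      apply: contrapT => /forallNP na; apply: x0.
      by apply: big1 => i _; have /negP := na i; rewrite negbK => /eqP ->; rewrite scale0r.
    rewrite lee_fin ler_pdivlMr; first exact: comb_lower.
    exact: comb_norm_gt0.
  apply: ereal_sup_ubound; exists (range (comb k)) => //.
  exists (fun i => e (k i)); split=> // a a0 i.
  have := coef_diag_comb D kinj a i; rewrite /diag_comb a0 linear0 (diag_coef0 D).
  by move=> <-.
apply: ge_ereal_sup => _ [L [v [iv LE]] <-].
have [a [i ai] aB] := exists_left_kernel (fun i j => c (T (v i)) (k' j)) (ltnSn m).
pose x := \sum_i a i *: v i.
apply: (@le_trans _ _ (snorm (T x) / snorm x)%:E).
  apply: ereal_inf_lbound; exists x => //; split.
    by rewrite LE; exists a.
  by move=> /= /iv /(_ i) ai0; rewrite ai0 eqxx in ai.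
have xk j : c (T x) (k' j) = 0.
  rewrite linear_sum (diag_coef_sum D) -[RHS](aB j); apply: eq_bigr => l _.
  by rewrite linearZ /= (diag_coefZ D).
have [x0|x0] := eqVneq (snorm x) 0.
  by rewrite x0 invr0 mulr0 lee_fin ltW.
have x1 : 0 < snorm x by rewrite lt_neqAle eq_sym x0 snorm_ge0.
by rewrite lee_fin ler_pdivrMr//; exact: tail_le.
Qed.

(** The lower bound is attained at the partial isometry sending the first n unit
    vectors of ell2 to the n normalized basis vectors. *)
Lemma diag_weyl_number : weyl_number T m.+1 = tau%:E.
Proof.
apply/eqP; rewrite eq_le; apply/andP; split.
  apply: ge_ereal_sup => _ [A [[C bA] A1] <-].
  apply: (@approximation_number_comp_le (ell2 R) A) => // z.
  have [z0|z0] := eqVneq (snorm z) 0.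
    by have := bA z; rewrite z0 mulr0.
  have z1 : 0 < snorm z by rewrite lt_neqAle eq_sym z0 snorm_ge0.
  have : ((snorm (A ((snorm z)^-1 *: z)))%:E <= 1)%E.
    apply: le_trans A1; apply: ereal_sup_ubound; exists ((snorm z)^-1 *: z) => //; split=> //.
    change (snorm ((snorm z)^-1 *: z) <= 1).
    by rewrite snormZ ger0_norm ?invr_ge0 ?snorm_ge0// mulVf.
  rewrite lee_fin linearZ snormZ ger0_norm ?invr_ge0 ?snorm_ge0// ler_pdivrMl//.
  by rewrite mulr1.
pose w i := (Num.sqrt (rho (k i)))^-1.
have rho_gt0 i : 0 < rho (k i) by apply: lt_le_trans (diag_weight D _).
have w2 i : w i ^+ 2 = (rho (k i))^-1 by rewrite exprVn sqr_sqrtr// ltW.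
pose A (z : ell2 R) : X := comb k (fun i => w i * ell2_coord z i).
have linA : linear A.
  move=> a y z; rewrite /A /comb /diag_comb scaler_sumr -big_split.
  apply: eq_bigr => i _ /=.
  by rewrite ell2_coordD ell2_coordZ scalerA -scalerDl; congr (_ *: _); ring.
pose A' : {linear ell2 R -> X} := HB.pack A (GRing.isLinear.Build R (ell2 R) X _ A linA).
have A1 z : snorm (A z) <= snorm z.
  apply: ler_of_sqr; first exact: snorm_ge0.
  rewrite (source_norm_comb D kinj); apply: le_trans (ell2_bessel m.+1 z).
  apply: ler_sum => i _; rewrite exprMn w2 mulVKf// gt_eqF//.
apply: (@le_trans _ _ (approximation_number (T \o A') m.+1)); last first.
  apply: ereal_sup_ubound; exists A' => //; split.
    by exists 1 => z; rewrite mul1r.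
  by apply: opnorm_on_le => z _ z1; apply: le_trans (A1 z) z1.
apply: (approximation_number_ge (z := fun i => ell2_delta (val i))) => a a0.
set z := \sum_i _; have zn : snorm z ^+ 2 = \sum_i a i ^+ 2 by exact: ell2_norm_comb.
split.
  rewrite lt_neqAle snorm_ge0 andbT eq_sym; apply/eqP => z0.
  by have := sum_sq_gt0 a0; rewrite -zn z0 expr0n ltxx.
apply: ler_of_sqr; first exact: snorm_ge0.
rewrite exprMn tau2 zn /= (target_norm_comb D kinj) mulr_sumr; apply: ler_sum => i _.
rewrite ell2_coord_comb_ord exprMn w2 ler_wpM2r ?sqr_ge0//.
by rewrite lef_pV2 ?posrE.
Qed.

Theorem diag_s_number s : s <> s_e -> s_number s T m.+1 = tau%:E.
Proof.
case: s => //= _.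
- exact: diag_approximation_number.
- exact: diag_bernstein_number.
- exact: diag_gelfand_number.
- exact: diag_kolmogorov_number.
- exact: diag_weyl_number.
Qed.

End diagonal_s_numbers.

(** * Entropy numbers of diagonal operators *)

(** The weight 4 ^ (number of agreements with b0) is a product over coordinates,
    each contributing 4 + 1.  A set of sign patterns that mostly agree with b0
    is therefore small. *)
Lemma hamming_count N (b0 : {ffun 'I_N -> bool}) :
  (\sum_(b : {ffun 'I_N -> bool}) 4 ^ #|[set i | b i == b0 i]%SET| = 5 ^ N)%N.
Proof.
transitivity (\sum_(b : {ffun 'I_N -> bool}) \prod_i (if b i == b0 i then 4 else 1))%N.
  apply: eq_bigr => b _; rewrite -big_mkcond prod_nat_const; congr (4 ^ _)%N.
  by rewrite -sum1dep_card -sum1_card.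
rewrite -(bigA_distr_bigA (fun i v => if v == b0 i then 4 else 1)%N) /=.
rewrite (eq_bigr (fun=> 5%N)) ?prod_nat_const ?card_ord// => i _.
by rewrite big_bool; case: (b0 i).
Qed.

Lemma pigeonhole (A : finType) p (f : A -> 'I_p) q :
  (p * q < #|A|)%N -> exists j, (q < #|[set a | f a == j]%SET|)%N.
Proof.
move=> pq; apply/existsP; apply: contraTT pq => /existsPn h; rewrite -leqNgt.
rewrite -sum1_card (partition_big f predT)//=.
apply: (@leq_trans (\sum_(j < p) q)); last by rewrite sum_nat_const card_ord.
by apply: leq_sum => j _; rewrite sum1dep_card leqNgt h.
Qed.

Section diagonal_entropy.
Context {R : realType} {X Y : snormedSpace R} (T : {linear X -> Y}) (I : choiceType).
Context (c : Y -> I -> R) (e : I -> X) (rho : I -> R).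
Hypothesis D : diagonal_system T c e rho.

(** The 2 ^ (4 n) signed sums of 4 n basis vectors, scaled into the unit ball,
    are covered by 2 ^ (n - 1) balls, so one ball contains more than 2 ^ (3 n) of
    them.  If the radius is too small, any two of these agree in at least
    7 n / 2 places, and by [hamming_count] there are at most 5 ^ (4 n) / 2 ^ (7 n)
    of them.  As 5 ^ 4 <= 2 ^ 10, this is a contradiction. *)
Lemma diag_entropy_ge n (k : 'I_(4 * n) -> I) (t : R) : (0 < n)%N -> injective k ->
  0 < t -> (forall i, rho (k i) <= t) ->
  ((Num.sqrt (8 * t))^-1%:E <= entropy_number T n)%E.
Proof.
move=> n0 kinj t0 rho_le.
apply: le_ereal_inf_tmp => _ [eps [e0 [y hy]] <-]; rewrite lee_fin leNgt; apply/negP => small.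
have N0 : (0 : R) < (4 * n)%:R by rewrite ltr0n muln_gt0.
pose s := (Num.sqrt ((4 * n)%:R * t))^-1.
have s2 : s ^+ 2 = ((4 * n)%:R * t)^-1 by rewrite exprVn sqr_sqrtr// ltW// mulr_gt0.
pose x (b : {ffun 'I_(4 * n) -> bool}) := diag_comb e k (fun i => (-1) ^+ b i * s).
have x1 b : unit_ball (x b).
  apply: ler_of_sqr => //; rewrite (source_norm_comb D kinj) expr1n.
  apply: (@le_trans _ _ (\sum_(i < 4 * n) t * s ^+ 2)).
    apply: ler_sum => i _; rewrite exprMn sqrr_sign mul1r ler_wpM2r ?sqr_ge0//.
  rewrite sumr_const card_ord s2 le_eqVlt; apply/orP; left; apply/eqP; rewrite -[LHS]mulr_natr.
  by field; rewrite !gt_eqF ?ltr0n.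
have /choice[f hf] := fun b => hy (x b) (x1 b).
have [j jf] : exists j, (2 ^ (3 * n) < #|[set b | f b == j]%SET|)%N.
  apply: pigeonhole; rewrite card_ffun card_bool card_ord -expnD ltn_exp2l//.
  by move: n0; case: (n) => // n' _ /=; lia.
have /card_gt0P[b0] : (0 < #|[set b | f b == j]%SET|)%N by exact: leq_ltn_trans jf.
rewrite inE => /eqP fb0.
pose agree (b : {ffun 'I_(4 * n) -> bool}) := #|[set i | b i == b0 i]%SET|.
have close b : b \in [set b | f b == j]%SET -> (7 * n <= 2 * agree b)%N.
  rewrite inE => /eqP fb.
  have dist : snorm (T (x b) - T (x b0)) <= 2 * eps.
    have -> : T (x b) - T (x b0) = (T (x b) - y j) + - (T (x b0) - y j).
      by rewrite opprB addrA subrK.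
    apply: le_trans (snormD _ _) _; rewrite snormN mulr_natl mulr2n lerD//.
      by rewrite -fb.
    by rewrite -fb0.
  have distE : snorm (T (x b) - T (x b0)) ^+ 2 = 4 * s ^+ 2 * (4 * n - agree b)%:R.
    have -> : T (x b) - T (x b0) = T (diag_comb e k (fun i => (-1) ^+ b i * s - (-1) ^+ b0 i * s)).
      rewrite -linearB /x /diag_comb -sumrB; congr (T _); apply: eq_bigr => i _.
      by rewrite -scalerBl.
    rewrite (target_norm_comb D kinj).
    rewrite (eq_bigr (fun i => if b i == b0 i then 0 else 4 * s ^+ 2)); last first.
      by move=> i _; case: (b i) (b0 i) => [] []; rewrite /= ?expr0 ?expr1; ring.
    rewrite (eq_bigr (fun i => if b i != b0 i then 4 * s ^+ 2 else 0)); last first.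
      by move=> i _; case: eqP.
    rewrite -big_mkcond sumr_const /= [RHS]mulr_natr; congr (_ *+ _).
    have := cardsC [set i | b i == b0 i]%SET; rewrite card_ord => E.
    set Z := #|_|; suff : (agree b + Z = 4 * n)%N by lia.
    by rewrite -[RHS]E; congr (_ + _)%N; apply: eq_card => i; rewrite !inE.
  have h1 : 4 * s ^+ 2 * (4 * n - agree b)%:R <= 4 * eps ^+ 2.
    rewrite -distE (_ : 4 * eps ^+ 2 = (2 * eps) ^+ 2); last by ring.
    by rewrite lerXn2r ?nnegrE ?snorm_ge0// mulr_ge0// ltW.
  have h2 : eps ^+ 2 < (8 * t)^-1.
    have t8 : 0 < 8 * t by rewrite mulr_gt0.
    by rewrite -[X in _ < X^-1](sqr_sqrtr (ltW t8)) -exprVn ltr_pXn2r// ?nnegrE ?(ltW e0)//.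
  have h3 : (4 * n - agree b)%:R * 2 < (n%:R : R).
    have : 4 * s ^+ 2 * (4 * n - agree b)%:R < 4 * (8 * t)^-1.
      by apply: le_lt_trans h1 _; rewrite ltr_pM2l.
    move=> H; have : 4 * s ^+ 2 * (4 * n - agree b)%:R * t < 4 * (8 * t)^-1 * t.
      by rewrite ltr_pM2r.
    rewrite s2 natrM.
    have n0' : (0 : R) < n%:R by rewrite ltr0n.
    have -> : 4 * (4 * n%:R * t)^-1 * (4 * n - agree b)%:R * t = (4 * n - agree b)%:R * 2 / (2 * n%:R).
      by field; rewrite !gt_eqF.
    have -> : 4 * (8 * t)^-1 * t = 2^-1 by field; rewrite gt_eqF.
    rewrite ltr_pdivrMr ?mulr_gt0//; lra.
  move: h3; rewrite -natrM ltr_nat; lia.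
have := hamming_count b0; rewrite (bigID (mem [set b | f b == j]%SET))/=.
have h7 : (2 ^ (3 * n) * 2 ^ (7 * n) < \sum_(b in [set b | f b == j]%SET) 4 ^ agree b)%N.
  apply: (@leq_trans (\sum_(b in [set b | f b == j]%SET) 2 ^ (7 * n)))%N.
    by rewrite sum_nat_const ltn_pmul2r ?expn_gt0.
  apply: leq_sum => b bf; rewrite (_ : 4 = 2 ^ 2)%N// -expnM leq_exp2l//.
  exact: close.
have h5 : (5 ^ (4 * n) <= 2 ^ (3 * n) * 2 ^ (7 * n))%N.
  rewrite -expnD -mulnDl !expnM; by rewrite leq_exp2r.
move=> E; have : (2 ^ (3 * n) * 2 ^ (7 * n) < 5 ^ (4 * n))%N.
  by rewrite -E; apply: leq_trans h7 _; exact: leq_addr.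
by rewrite ltnNge h5.
Qed.

(** The m coefficients with weight at most t are rounded towards 0 to multiples of
    del = (t m) ^ (- 1 / 2).  The rounding error and the neglected coefficients
    have norm at most t ^ (- 1 / 2) each.  The integers r_i obtained satisfy
    sum a_i r_i <= m with a_i = (rho_i / t) ^ (1 / 2) in ]0, 1], and the number of
    such signed r is at most exp m times the product of the sums of
    exp (- a_i r), which are geometric. *)
Lemma diag_entropy_le n m (k : 'I_m -> I) (t : R) : (0 < m)%N -> injective k ->
  0 < t -> (forall i, rho (k i) <= t) ->
  (forall l, (forall i, k i <> l) -> t <= rho l) ->
  expR m%:R * \prod_(i < m) (4 * Num.sqrt (t / rho (k i))) <= 2 ^+ n.-1 ->
  (entropy_number T n <= (2 * (Num.sqrt t)^-1)%:E)%E.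
Proof.
move=> m0 kinj t0 rho_le rho_ge count.
have m0' : (0 : R) < m%:R by rewrite ltr0n.
have rho_gt0 l : 0 < rho l by apply: lt_le_trans (diag_weight D l).
pose tau := (Num.sqrt t)^-1.
have tau0 : 0 < tau by rewrite invr_gt0 sqrtr_gt0.
have tau2 : tau ^+ 2 = t^-1 by rewrite exprVn sqr_sqrtr// ltW.
pose del := (Num.sqrt (t * m%:R))^-1.
have tm0 : 0 < t * m%:R by rewrite mulr_gt0.
have del0 : 0 < del by rewrite invr_gt0 sqrtr_gt0.
have del2 : del ^+ 2 = (t * m%:R)^-1 by rewrite exprVn sqr_sqrtr// ltW.
pose a i := Num.sqrt (rho (k i) / t).
have a0 i : 0 < a i by rewrite sqrtr_gt0 divr_gt0.
have a2 i : a i ^+ 2 = rho (k i) / t by rewrite sqr_sqrtr// ltW// divr_gt0.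
have a1 i : a i <= 1.
  by apply: ler_of_sqr => //; rewrite a2 expr1n ler_pdivrMr// mul1r.
have aV i : (a i)^-1 = Num.sqrt (t / rho (k i)) by rewrite -sqrtrV ?invf_div// ltW// divr_gt0.
pose Q := (Num.truncn del^-1).+1.
pose S := [set q : {ffun 'I_m -> bool * 'I_Q} | \sum_i a i * (q i).2%:R <= m%:R]%SET.
pose cen (q : {ffun 'I_m -> bool * 'I_Q}) := diag_comb e k (fun i => (-1) ^+ (q i).1 * (del * (q i).2%:R)).
have cardS : (#|S| <= 2 ^ n.-1)%N.
  rewrite -(ler_nat R) natrX; apply: le_trans count.
  rewrite -sum1_card natr_sum.
  pose w (i : 'I_m) (p : bool * 'I_Q) : R := expR (- (a i * p.2%:R)).
  apply: (@le_trans _ _ (\sum_(q : {ffun 'I_m -> bool * 'I_Q}) expR m%:R * \prod_i w i (q i))).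
    rewrite big_mkcond; apply: ler_sum => q _; rewrite inE; case: ifP => [Sq|_].
      rewrite /w -expR_sum -expRD -[leLHS]expR0 ler_expR sumrN subr_ge0//.
    by rewrite mulr_ge0 ?expR_ge0// prodr_ge0// => i _; rewrite expR_ge0.
  rewrite -mulr_sumr -(bigA_distr_bigA w) ler_wpM2l ?expR_ge0//.
  apply: ler_prod => i _; apply/andP; split.
    by apply: sumr_ge0 => p _; exact: expR_ge0.
  rewrite -aV -(pair_bigA _ (fun (b : bool) (j : 'I_Q) => expR (- (a i * j%:R)))) /=.
  rewrite sumr_const card_bool.
  (* exp (- a) <= 1 / (1 + a) <= 1 - a / 2 for a in [0, 1], so the geometric sum
     is at most 2 / a; the sign doubles it. *)
  pose r := expR (- a i).
  have r1 : r < 1 by rewrite /r -expR0 ltr_expR oppr_lt0.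
  have rle : r <= 1 - a i / 2.
    rewrite /r expRN; have ea := expR_ge1Dx (a i).
    have ea0 : 0 < 1 + a i by rewrite ltr_pwDl// ltW.
    apply: (@le_trans _ _ (1 + a i)^-1); first by rewrite lef_pV2// posrE ?expR_gt0.
    rewrite -[leLHS]mul1r ler_pdivrMr//; have := a1 i; have := a0 i; nra.
  have -> : \sum_(j < Q) expR (- (a i * j%:R)) = \sum_(j < Q) r ^+ j.
    by apply: eq_bigr => j _; rewrite /r -expRM_natl mulrN mulrC.
  have sumr : (\sum_(j < Q) r ^+ j) * (1 - r) <= 1.
    have rQ : 0 <= r ^+ Q by rewrite exprn_ge0// expR_ge0.
    by have := subrX1 r Q; nra.
  have G0 : 0 <= \sum_(j < Q) r ^+ j by apply: sumr_ge0 => j _; rewrite exprn_ge0// expR_ge0.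
  rewrite ler_pdivlMr// -[_ *+ _]mulr_natr; nra.
have cover x : unit_ball x -> exists2 q, q \in S & snorm (T x - T (cen q)) <= 2 * tau.
  move=> x1; pose u i := c (T x) (k i).
  have x2 : snorm x ^+ 2 <= 1.
    by rewrite -(expr1n R 2) lerXn2r ?nnegrE ?snorm_ge0.
  have usum : \sum_i rho (k i) * u i ^+ 2 <= 1.
    apply: le_trans x2; rewrite -lee_fin (diag_source D).
    apply: (sum_le_esum kinj (f := fun l => rho l * c (T x) l ^+ 2)) => l.
    by rewrite mulr_ge0 ?sqr_ge0// ltW.
  have u1 i : `|u i| <= 1.
    apply: ler_of_sqr => //; rewrite real_normK ?num_real// expr1n.
    apply: le_trans usum; rewrite (bigD1 i)//=.
    rewrite -[leLHS]addr0 lerD//; first by rewrite ler_peMl ?sqr_ge0// (diag_weight D).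
    by apply: sumr_ge0 => j _; rewrite mulr_ge0 ?sqr_ge0// ltW.
  pose N i := Num.truncn (`|u i| / del).
  have v0 i : 0 <= `|u i| / del by rewrite divr_ge0// ltW.
  have NQ i : (N i < Q)%N.
    rewrite ltnS; apply: le_truncn; rewrite ler_pdivrMr// mulVf ?gt_eqF//.
  pose q := [ffun i => (u i < 0, Ordinal (NQ i))] : {ffun 'I_m -> bool * 'I_Q}.
  have Nle i : (N i)%:R <= `|u i| / del by rewrite truncn_le.
  have Ngt i : `|u i| / del < (N i).+1%:R by apply: truncnS_gt.
  exists q.
    rewrite inE; pose v i := a i * (`|u i| / del).
    (* The unit ball gives sum v_i ^ 2 <= m, hence sum v_i <= m by v <= (v ^ 2 + 1) / 2. *)
    apply: (@le_trans _ _ (\sum_i (v i ^+ 2 + 1) / 2)).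
      apply: ler_sum => i _; rewrite ffunE /=.
      apply: (@le_trans _ _ (v i)); first by rewrite ler_wpM2l ?(ltW (a0 i)).
      have := sqr_ge0 (v i - 1); nra.
    rewrite -mulr_suml big_split /= sumr_const card_ord ler_pdivrMr// mulr_natr mulr2n lerD//.
    rewrite (eq_bigr (fun i => m%:R * (rho (k i) * u i ^+ 2))); last first.
      move=> i _; rewrite /v exprMn a2 exprMn real_normK ?num_real// exprVn del2.
      by field; rewrite !gt_eqF.
    by rewrite -mulr_sumr -[leRHS]mulr1 ler_wpM2l// ler0n.
  have -> : T x - T (cen q) = (T x - T (diag_comb e k u)) +
      T (diag_comb e k (fun i => u i - (-1) ^+ (q i).1 * (del * (q i).2%:R))).
    have -> : diag_comb e k (fun i => u i - (-1) ^+ (q i).1 * (del * (q i).2%:R)) =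
       diag_comb e k u - cen q.
      rewrite /cen /diag_comb -sumrB; apply: eq_bigr => i _; by rewrite -scalerBl.
    by rewrite linearB addrA subrK.
  apply: le_trans (snormD _ _) _; rewrite mulr_natl mulr2n lerD//.
    apply: ler_of_sqr; first exact: ltW.
    rewrite tau2 -[leRHS]mulr1 ler_pdivlMl//.
    exact: le_trans (diag_error D kinj x (ltW t0) rho_ge) x2.
  apply: ler_of_sqr; first exact: ltW.
  rewrite tau2 (target_norm_comb D kinj).
  apply: (@le_trans _ _ (\sum_(i < m) del ^+ 2)).
    apply: ler_sum => i _; rewrite ffunE /=.
    rewrite -[leLHS]real_normK ?num_real// lerXn2r ?nnegrE ?(ltW del0)//.
    have -> : u i - (-1) ^+ (u i < 0)%R * (del * (N i)%:R) = (-1) ^+ (u i < 0)%R * (`|u i| - del * (N i)%:R).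
      by rewrite mulrBr mulr_sign_norm.
    rewrite normrMsign.
    have h1 := Nle i; have h2 := Ngt i; rewrite ler_pdivlMr// in h1; rewrite ltr_pdivrMr// -natr1 in h2.
    rewrite ler_norml; apply/andP; split; lra.
  rewrite sumr_const card_ord del2 -[leLHS]mulr_natr le_eqVlt; apply/orP; left; apply/eqP.
  by field; rewrite !gt_eqF.
have S0 : (0 < 2 ^ n.-1)%N by rewrite expn_gt0.
pose q0 : {ffun 'I_m -> bool * 'I_Q} := [ffun => (false, ord0)].
apply: ereal_inf_lbound; exists (2 * tau) => //; split; first by rewrite mulr_gt0.
exists (fun j : 'I_(2 ^ n.-1) => T (cen (nth q0 (enum S) j))) => x /cover[q qS hq].
have iq : (index q (enum S) < 2 ^ n.-1)%N.
  by apply: leq_trans cardS; rewrite cardE index_mem mem_enum.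
by exists (Ordinal iq); rewrite /= nth_index// mem_enum.
Qed.

End diagonal_entropy.

(** * The embedding of the Hermite space *)

Lemma powR_prod (R : realType) (J : finType) (F : J -> R) (r : R) :
  (forall j, 0 <= F j) -> (\prod_j F j) `^ r = \prod_j F j `^ r.
Proof.
move=> F0.
suff [_ ->] : 0 <= \prod_j F j /\ (\prod_j F j) `^ r = \prod_j F j `^ r by [].
elim/big_rec2: _ => [|j x y _ [x0 <-]]; first by rewrite powR1.
by rewrite powRM// mulr_ge0.
Qed.

Section hermite_diagonal.
Context {R : realType} (d : nat) (alpha : R).
Hypothesis alpha0 : 0 < alpha.
Local Notation X := (hermite_snormed d alpha).

Lemma hermite_weightE (k : d.-tuple nat) :
  hermite_weight alpha k = (hprod k)%:R `^ alpha.
Proof.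
by rewrite /hermite_weight /hprod natr_prod powR_prod.
Qed.

Lemma hermite_weight_ge1 (k : d.-tuple nat) : 1 <= hermite_weight alpha k.
Proof.
have p1 : 1 `^ alpha = 1 :> R by rewrite powR1.
rewrite hermite_weightE -[leLHS]p1; apply: ge0_ler_powR; first exact: ltW.
- by rewrite nnegrE.
- by rewrite nnegrE.
- by rewrite ler1n hprod_gt0.
Qed.

Lemma hermite_class_pred (k : d.-tuple nat) : hermite_class k \in @hermite_pred R d alpha.
Proof.
rewrite /in_mem /= /hermite_pred /hermite_energy.
rewrite (@esum_family _ _ 1 (fun=> k) _ (fun l => hermite_weight alpha l * `|hermite_coef (hermite_class k) l| ^+ 2)).
- by rewrite ltry.
- by move=> i j _; rewrite !ord1.
- by move=> l; rewrite mulr_ge0 ?hermite_weight_ge0.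
- move=> l kl; rewrite hermite_coef_class_ortho.
  have /negPf -> : k != l by apply/eqP; exact: (kl ord0).
  by rewrite normr0 expr0n mulr0.
Qed.

Definition hermite_basis (k : d.-tuple nat) : X := HermiteSpace (hermite_class_pred k).

Lemma hermite_diagonal_system :
  diagonal_system (embedding d alpha) (@hermite_coef R d) hermite_basis
    (hermite_weight alpha).
Proof.
split.
- exact: hermite_coefD.
- exact: hermite_coefZ.
- by move=> i j; exact: hermite_coef_class_ortho.
- exact: parseval.
- move=> x; rewrite /= /hermite_norm.
  have E0 := hermite_energy_ge0 alpha (hermite_val x).
  rewrite sqr_sqrtr ?fine_ge0// fineK; last first.
    by rewrite ge0_fin_numE//; exact: hermite_valP.
  by apply: eq_esum => k _; rewrite real_normK ?num_real.
- exact: hermite_weight_ge1.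
Qed.

End hermite_diagonal.

Section hermite_numbers.
Context {R : realType} (d : nat) (alpha : R).
Hypothesis alpha0 : 0 < alpha.
Let D := @hermite_diagonal_system R d.+1 alpha alpha0.

Let weight_le (k : d.+1.-tuple nat) T : (hprod k <= T)%N ->
  hermite_weight alpha k <= T%:R `^ alpha.
Proof.
by move=> kT; rewrite hermite_weightE ge0_ler_powR ?nnegrE ?ler_nat// ltW.
Qed.

Let weight_ge (k : d.+1.-tuple nat) T : (T <= hprod k)%N ->
  T%:R `^ alpha <= hermite_weight alpha k.
Proof.
by move=> kT; rewrite hermite_weightE ge0_ler_powR ?nnegrE ?ler_nat// ltW.
Qed.

Lemma sqrt_powR_inv (T : nat) : (Num.sqrt (T%:R `^ alpha))^-1 = T%:R `^ (- (alpha / 2)) :> R.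
Proof. by rewrite -powR12_sqrt ?powR_ge0// -powRrM powRN. Qed.

Let x0 : d.+1.-tuple nat := nseq_tuple d.+1 0.

(** The enumeration kap lists the cross of parameter T_n - 1 first, which has
    fewer than n elements, and then the other multi-indices with pi(k) = T_n. *)
Theorem hermite_s_number s n : s <> s_e -> (0 < n)%N ->
  s_number s (embedding d.+1 alpha) n = ((hthr d n)%:R `^ (- (alpha / 2)))%:E.
Proof.
case: n => // m se _; pose T := hthr d m.+1.
have T0 : (0 < T)%N by exact: hthr_gt0.
pose s1 := hcross d.+1 T.-1.
pose s2 := [seq k <- hcross d.+1 T | k \notin s1].
have us : uniq (s1 ++ s2).
  rewrite cat_uniq hcross_uniq filter_uniq ?hcross_uniq// andbT.
  by apply/hasPn => k; rewrite mem_filter => /andP[].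
have mem_s k : (k \in s1 ++ s2) = (hprod k <= T)%N.
  rewrite mem_cat mem_filter !mem_hcross; case: leqP => //= h; lia.
have size_s : size (s1 ++ s2) = hcount d.+1 T.
  apply/eqP; rewrite -(uniq_size_uniq (hcross_uniq d.+1 T)) ?us// => k.
  by rewrite mem_s mem_hcross.
have ms : (m < size (s1 ++ s2))%N by rewrite size_s; exact: hthrP.
pose kap (i : 'I_m.+1) := nth x0 (s1 ++ s2) i.
have si (i : 'I_m.+1) : (i < size (s1 ++ s2))%N.
  by apply: leq_ltn_trans ms; rewrite -ltnS ltn_ord.
have kinj : injective kap.
  move=> i j /eqP; rewrite nth_uniq//.
  by move=> /eqP ij; exact: val_inj.
have T0' : (0 : R) < T%:R `^ alpha by rewrite powR_gt0// ltr0n.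
rewrite (@diag_s_number _ _ _ _ _ _ _ _ D m kap (T%:R `^ alpha))//.
- by rewrite sqrt_powR_inv.
- by move=> i; apply: weight_le; rewrite -mem_s mem_nth.
- move=> l hl; apply: weight_ge; rewrite leqNgt; apply/negP => lT.
  have l1 : l \in s1 by rewrite mem_hcross; lia.
  have il : (index l s1 < m)%N.
    apply: (@leq_trans (size s1)); first by rewrite index_mem.
    by rewrite -ltnS; exact: hthr_pred.
  apply: (hl (Ordinal il)); rewrite /kap /= nth_cat index_mem l1.
  exact: nth_index.
Qed.

Lemma hermite_entropy_ge n : (0 < n)%N ->
  (((Num.sqrt 8)^-1 * (hthr d (4 * n))%:R `^ (- (alpha / 2)))%:E <=
   entropy_number (embedding d.+1 alpha) n)%E.
Proof.
move=> n0; pose T := hthr d (4 * n).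
have T0 : (0 < T)%N by rewrite hthr_gt0// muln_gt0.
pose kap (i : 'I_(4 * n)) := nth x0 (hcross d.+1 T) i.
have si (i : 'I_(4 * n)) : (i < size (hcross d.+1 T))%N.
  by apply: leq_trans (ltn_ord i) _; exact: hthrP.
have kinj : injective kap.
  move=> i j /eqP; rewrite nth_uniq ?hcross_uniq//.
  by move=> /eqP ij; exact: val_inj.
have T0' : (0 : R) < T%:R `^ alpha by rewrite powR_gt0// ltr0n.
rewrite -sqrt_powR_inv -invfM -sqrtrM//.
apply: (diag_entropy_ge D n0 kinj T0') => i; apply: weight_le.
by rewrite -mem_hcross mem_nth.
Qed.

Let A := (4 + (Num.truncn alpha).+1)%N.

(** The constant collects exp m <= 4 ^ m, the factor 4 ^ m of [diag_entropy_le] and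
    the bound 4 ^ m on the product of the T / pi(k), raised to the power
    alpha / 2. *)
Lemma hermite_entropy_le n T : (0 < T)%N -> (A * hcount d.+1 T <= n.-1)%N ->
  (entropy_number (embedding d.+1 alpha) n <= (2 * T%:R `^ (- (alpha / 2)))%:E)%E.
Proof.
move=> T0 hA; set m := hcount d.+1 T in hA.
pose kap (i : 'I_m) := nth x0 (hcross d.+1 T) i.
have kinj : injective kap.
  move=> i j /eqP; rewrite nth_uniq ?hcross_uniq//.
  by move=> /eqP ij; exact: val_inj.
have T0' : (0 : R) < T%:R `^ alpha by rewrite powR_gt0// ltr0n.
rewrite -sqrt_powR_inv.
have m0 : (0 < m)%N by apply: leq_trans (hcount_ge d T).
apply: (diag_entropy_le D m0 kinj T0').
- by move=> i; apply: weight_le; rewrite -mem_hcross mem_nth.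
- move=> l hl; apply: weight_ge; rewrite leqNgt; apply/negP => lT.
  have ls : l \in hcross d.+1 T by rewrite mem_hcross ltnW.
  have il : (index l (hcross d.+1 T) < m)%N by rewrite /m /hcount index_mem.
  by apply: (hl (Ordinal il)); exact: nth_index.
(* exp (- 1 / 2) >= 1 / 2. *)
have e4 : expR (1 : R) <= 4.
  have h2 := @expR_ge1Dx R (- (1 / 2)).
  have h3 : expR (1 : R) * expR (- (1 / 2)) ^+ 2 = 1.
    by rewrite -expRM_natl -expRD (_ : 1 + _ = 0) ?expR0//; field.
  have := expR_gt0 (1 : R); have : 1 / 4 <= expR (- (1 / 2 : R)) ^+ 2 by nra.
  nra.
have em : expR m%:R <= 4 ^+ m :> R.
  by rewrite -[m%:R]mulr1 expRM_natl lerXn2r ?nnegrE ?expR_ge0.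
pose w (i : 'I_m) : R := T%:R / (hprod (kap i))%:R.
have w0 i : 0 <= w i by rewrite divr_ge0 ?ler0n.
have sq i : Num.sqrt (T%:R `^ alpha / hermite_weight alpha (kap i)) = w i `^ (alpha / 2).
  have hp : (0 : R) < (hprod (kap i))%:R by rewrite ltr0n hprod_gt0.
  have -> : T%:R `^ alpha / hermite_weight alpha (kap i) = w i `^ alpha.
    have TE : T%:R = w i * (hprod (kap i))%:R by rewrite /w divfK// gt_eqF.
    by rewrite hermite_weightE {1}TE powRM// ?ler0n// mulfK// gt_eqF// powR_gt0.
  by rewrite -powR12_sqrt ?powR_ge0// -powRrM.
under eq_bigr do rewrite sq.
rewrite big_split /= prodr_const card_ord -powR_prod//.
have wprod : \prod_(i < m) w i <= 4 ^+ m.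
  rewrite /w prodf_div prodr_const card_ord ler_pdivrMr; last first.
    by apply: prodr_gt0 => i _; rewrite ltr0n hprod_gt0.
  have := prod_hcross d T; rewrite -/m (big_nth x0) big_mkord => h.
  by rewrite -natr_prod -!natrX -natrM ler_nat.
have wpow : (\prod_(i < m) w i) `^ (alpha / 2) <= 2 ^+ (m * (Num.truncn alpha).+1).
  have a2 : 0 <= alpha / 2 by rewrite divr_ge0 ?ltW.
  apply: (@le_trans _ _ ((4 ^+ m) `^ (alpha / 2))).
    by rewrite ge0_ler_powR ?nnegrE ?exprn_ge0// prodr_ge0.
  have m1 : (1 : R) <= 4 ^+ m by rewrite exprn_ege1// ler1n.
  apply: (@le_trans _ _ ((4 ^+ m) `^ ((Num.truncn alpha).+1%:R / 2))).
    by rewrite ler_powR// ler_wpM2r ?invr_ge0 ?ler0n// ltW// truncnS_gt.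
  rewrite (_ : 4 = 2 ^+ 2); last by rewrite -natrX.
  rewrite exprAC -(powR_mulrn 2) ?exprn_ge0// -powRrM mulrCA mulfV ?mulr1 ?pnatr_eq0//.
  by rewrite powR_mulrn ?exprn_ge0// -exprM.
apply: (@le_trans _ _ (4 ^+ m * (4 ^+ m * 2 ^+ (m * (Num.truncn alpha).+1)))).
  by rewrite ler_pM ?expR_ge0 ?mulr_ge0 ?exprn_ge0 ?powR_ge0 ?ler_wpM2l ?exprn_ge0.
rewrite -!natrX -!natrM ler_nat (_ : 4 = 2 ^ 2)%N// -expnM -!expnD leq_exp2l//.
by apply: leq_trans hA; rewrite /A; lia.
Qed.

End hermite_numbers.

(** * Asymptotics *)

Section rate.
Context {R : realType} (d : nat) (alpha : R).
Hypothesis alpha0 : 0 < alpha.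

Definition rate n : R := n%:R `^ (- (alpha / 2)) * ln n%:R `^ (alpha * d%:R / 2).
Definition singular_value n : R := (hthr d n)%:R `^ (- (alpha / 2)).

Lemma cvg_powR (u : nat -> R) (l r : R) : 0 < l -> u n @[n --> \oo] --> l ->
  u n `^ r @[n --> \oo] --> l `^ r.
Proof.
move=> l0 ul.
have upos : \forall n \near \oo, 0 < u n by exact: (cvgr_gt _ ul).
have -> : l `^ r = expR (r * ln l) by rewrite /powR gt_eqF.
have : expR (r * ln (u n)) @[n --> \oo] --> expR (r * ln l).
  apply: continuous_cvg; first exact: continuous_expR.
  by apply: cvgMr; apply: continuous_cvg => //; exact: continuous_ln.
apply: cvg_trans; apply: near_eq_cvg; near=> n.
by rewrite /powR gt_eqF//; near: n.
Unshelve. all: by end_near.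
Qed.

Lemma ln_nat_gt0 n : (1 < n)%N -> 0 < ln n%:R :> R.
Proof. by move=> n1; rewrite ln_gt0// ltr1n. Qed.

Lemma rate_gt0 n : (1 < n)%N -> 0 < rate n.
Proof.
by move=> n1; rewrite mulr_gt0// powR_gt0// ?ln_nat_gt0// ltr0n; lia.
Qed.

Lemma singular_value_rate : singular_value n / rate n @[n --> \oo] --> ((1 / d`!%:R) `^ (alpha / 2) : R).
Proof.
have l0 : 0 < (1 / d`!%:R : R) by rewrite div1r invr_gt0 ltr0n fact_gt0.
have H : (n%:R / ((hthr d n)%:R * ln n%:R ^+ d)) `^ (alpha / 2) @[n --> \oo] -->
    ((1 / d`!%:R) `^ (alpha / 2) : R).
  by apply: cvg_powR => //; rewrite div1r; exact: hthr_limit.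
apply: cvg_trans H; apply: near_eq_cvg; near=> n.
have n1 : (1 < n)%N by near: n; exists 2%N.
have n0 : 0 < n%:R :> R by rewrite ltr0n; lia.
have L0 := ln_nat_gt0 n1.
have T0 : 0 < (hthr d n)%:R :> R by rewrite ltr0n hthr_gt0; lia.
have powRV x : 0 <= x -> x^-1 `^ (alpha / 2) = (x `^ (alpha / 2))^-1 :> R.
  by move=> x0; rewrite -[x^-1]powR_inv1// -powRrM mulN1r powRN.
have Ld : (ln n%:R ^+ d) `^ (alpha / 2) = ln n%:R `^ (alpha * d%:R / 2) :> R.
  by rewrite -powR_mulrn ?(ltW L0)// -powRrM; congr (_ `^ _); rewrite mulrCA mulrA.
have Ld0 : 0 <= ln n%:R ^+ d :> R by rewrite exprn_ge0// ltW.
rewrite /singular_value /rate powRM ?invr_ge0 ?ler0n ?mulr_ge0 ?ler0n//.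
rewrite powRV ?mulr_ge0 ?ler0n// powRM ?ler0n// Ld !powRN.
by rewrite !invfM invrK mulrCA.
Unshelve. all: by end_near.
Qed.

Lemma rate_bounds : exists2 c : R, 0 < c &
  \forall n \near \oo, c * rate n <= singular_value n /\ singular_value n <= c^-1 * rate n.
Proof.
set l := ((1 / d`!%:R) `^ (alpha / 2) : R).
have l0 : 0 < l by rewrite powR_gt0// div1r invr_gt0 ltr0n fact_gt0.
pose c := Num.min (l / 2) (l + 1)^-1.
have c0 : 0 < c by rewrite lt_min; apply/andP; split; [lra|rewrite invr_gt0; lra].
exists c => //.
have SR := singular_value_rate; rewrite -/l in SR.
have l1 : l / 2 < l by lra.
have l2 : l < l + 1 by lra.
have h1 : \forall n \near \oo, l / 2 < singular_value n / rate n by exact: (cvgr_gt _ SR).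
have h2 : \forall n \near \oo, singular_value n / rate n < l + 1 by exact: (cvgr_lt _ SR).
near=> n; have r0 : 0 < rate n by apply: rate_gt0; near: n; exists 2%N.
have g1 : l / 2 < singular_value n / rate n by near: n.
have g2 : singular_value n / rate n < l + 1 by near: n.
rewrite ltr_pdivlMr// in g1; rewrite ltr_pdivrMr// in g2; split.
  apply: (@le_trans _ _ (l / 2 * rate n)); last exact: ltW.
  by rewrite ler_wpM2r ?(ltW r0)// ge_min lexx.
apply: (@le_trans _ _ ((l + 1) * rate n)); first exact: ltW.
rewrite ler_wpM2r ?(ltW r0)// -[leLHS]invrK lef_pV2 ?posrE ?invr_gt0//; last by lra.
by rewrite ge_min lexx orbT.
Unshelve. all: by end_near.
Qed.

Lemma rate_quotient K m n : (0 < K)%N -> (1 < m)%N -> (m <= n)%N -> (n <= K * m)%N ->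
  rate m <= K%:R `^ (alpha / 2) * rate n.
Proof.
move=> K0 m1 mn nK; rewrite /rate mulrA; apply: ler_pM; rewrite ?powR_ge0//.
  have m0 : 0 < m%:R :> R by rewrite ltr0n; lia.
  have n0 : 0 < n%:R :> R by rewrite ltr0n; lia.
  rewrite !powRN ler_pdivlMr ?powR_gt0// mulrC ler_pdivrMr ?powR_gt0//.
  rewrite -powRM ?ler0n// ge0_ler_powR ?nnegrE ?ler0n//.
    by rewrite divr_ge0// ltW.
  by rewrite -natrM ler_nat.
rewrite ge0_ler_powR ?nnegrE//.
- by rewrite divr_ge0// mulr_ge0// ltW.
- by rewrite ltW// ln_nat_gt0.
- by rewrite ltW// ln_nat_gt0//; lia.
- by rewrite ler_ln ?posrE ?ltr0n ?ler_nat//; lia.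
Qed.

(** The logarithmic factor of the rate increases, so only the power of n costs a
    constant. *)
Lemma rate_dilate n : (1 < n)%N -> 4 `^ (- (alpha / 2)) * rate n <= rate (4 * n).
Proof.
move=> n1; rewrite /rate mulrA -powRM ?ler0n// -natrM ler_wpM2l ?powR_ge0//.
rewrite ge0_ler_powR ?nnegrE//.
- by rewrite divr_ge0// mulr_ge0// ltW.
- by rewrite ltW// ln_nat_gt0.
- by rewrite ltW// ln_nat_gt0//; lia.
- by rewrite ler_ln ?posrE ?ltr0n ?ler_nat//; lia.
Qed.

End rate.

Section final.
Context {R : realType} (d : nat) (alpha : R).
Hypothesis alpha0 : 0 < alpha.
Local Notation rate := (@rate R d alpha).
Local Notation singular_value := (@singular_value R d alpha).

Lemma s_number_asymp s : s <> s_e ->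
  asymp (s_number s (embedding d.+1 alpha)) (fun n => (rate n)%:E).
Proof.
move=> se; have [c c0 hc] := rate_bounds d alpha0.
split.
  exists c^-1; first by rewrite invr_gt0.
  near=> n; have n0 : (0 < n)%N by near: n; exists 1%N.
  rewrite hermite_s_number// -EFinM lee_fin.
  by have [] : c * rate n <= singular_value n /\ singular_value n <= c^-1 * rate n by near: n.
exists c^-1; first by rewrite invr_gt0.
near=> n; have n0 : (0 < n)%N by near: n; exists 1%N.
rewrite hermite_s_number// -EFinM lee_fin ler_pdivlMl//.
by have [] : c * rate n <= singular_value n /\ singular_value n <= c^-1 * rate n by near: n.
Unshelve. all: by end_near.
Qed.

(** From above, apply [hermite_entropy_le] to T_j - 1 with j close to n / K: the
    cross of parameter T_j - 1 has fewer than j elements.  From below, the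
    entropy number is compared with the singular value of index 4 n. *)
Lemma entropy_number_asymp :
  asymp (entropy_number (embedding d.+1 alpha)) (fun n => (rate n)%:E).
Proof.
have [c c0 [N _ hc]] := rate_bounds d alpha0.
pose K := (4 + (Num.truncn alpha).+1)%N.
split.
  pose C := 2 * (2 `^ (alpha / 2) * (c^-1 * K%:R `^ (alpha / 2))).
  exists C.
    by rewrite !mulr_gt0 ?powR_gt0 ?invr_gt0.
  near=> n.
  (* K * (j - 1) <= n - 1 < K * j. *)
  pose j := (n.-1 %/ K).+1.
  have jbig : (maxn N (hcount d.+1 2).+2 <= j)%N.
    rewrite /j ltnW// ltnS leq_divRL//.
    suff : (maxn N (hcount d.+1 2).+2 * K < n)%N by lia.
    by near: n; exists (maxn N (hcount d.+1 2).+2 * K).+1.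
  have n0 : (0 < n)%N by near: n; exists 1%N.
  have jN : (N <= j)%N by apply: leq_trans jbig; exact: leq_maxl.
  have j2 : (hcount d.+1 2 < j)%N.
    by apply: leq_trans jbig; apply: leq_trans (leq_maxr _ _).
  have j1 : (1 < j)%N by apply: leq_trans jbig; apply: leq_trans (leq_maxr _ _).
  have T2 := hthr_large j2; set T := hthr d j in T2.
  have jn : (j <= n)%N by rewrite /j; have := leq_div n.-1 K; lia.
  have nj : (n <= K * j)%N.
    rewrite /j mulnC; have := ltn_ceil n.-1 (isT : (0 < K)%N); lia.
  have hA : (K * hcount d.+1 T.-1 <= n.-1)%N.
    have := hthr_pred d (ltnW j1); rewrite -/T ltnS => h.
    by rewrite mulnC; apply: leq_trans (leq_trunc_div n.-1 K); rewrite leq_mul2r h orbT.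
  have T1 : (0 < T.-1)%N by lia.
  apply: le_trans (hermite_entropy_le alpha0 T1 hA) _.
  rewrite -EFinM lee_fin /C -!mulrA ler_wpM2l//.
  apply: (@le_trans _ _ (2 `^ (alpha / 2) * singular_value j)).
    have h2 : 0 < T.-1%:R :> R by rewrite ltr0n.
    have h3 : 0 < T%:R :> R by rewrite ltr0n; lia.
    rewrite /singular_value -/T !powRN ler_pdivlMr ?powR_gt0// mulrC ler_pdivrMr ?powR_gt0//.
    rewrite -powRM// ?ler0n// ge0_ler_powR ?nnegrE ?ler0n//.
      by rewrite divr_ge0// ltW.
    by rewrite -natrM ler_nat; lia.
  rewrite ler_wpM2l ?powR_ge0//.
  have [_ h] := hc j jN; apply: le_trans h _.
  rewrite ler_wpM2l ?invr_ge0 ?(ltW c0)//.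
  exact: (rate_quotient d alpha0 (isT : (0 < K)%N) j1 jn nj).
pose c2 := (Num.sqrt 8)^-1 * (c * 4 `^ (- (alpha / 2))) : R.
have c20 : 0 < c2 by rewrite !mulr_gt0 ?invr_gt0 ?sqrtr_gt0 ?powR_gt0.
exists c2^-1; first by rewrite invr_gt0.
near=> n; have n1 : (1 < n)%N by near: n; exists 2%N.
have nN : (N <= n)%N by near: n; exists N.
have low := hermite_entropy_ge d alpha0 (ltnW n1).
have : (c2%:E * (rate n)%:E <= entropy_number (embedding d.+1 alpha) n)%E.
  apply: le_trans low; rewrite -EFinM lee_fin /c2 -!mulrA ler_wpM2l ?invr_ge0 ?sqrtr_ge0//.
  have [h _] : c * rate (4 * n) <= singular_value (4 * n) /\ _ := hc (4 * n)%N (leq_trans nN (leq_pmull n (isT : (0 < 4)%N))).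
  apply: le_trans h; rewrite ler_wpM2l ?(ltW c0)//.
  exact: rate_dilate.
have c2i : (0 <= (c2^-1)%:E)%E by rewrite lee_fin invr_ge0 ltW.
by move=> /(lee_wpmul2l c2i); rewrite -!EFinM mulrA mulVf ?gt_eqF// mul1r.
Unshelve. all: by end_near.
Qed.

End final.

Theorem theorem4p2 (R : realType) (d : nat) (alpha : R) (s : s_kind)
    (hd : (0 < d)%N) (halpha : 0 < alpha) :
  asymp (s_number s (embedding d alpha))
    (fun n : nat =>
      (n%:R `^ (- (alpha / 2)) * ln n%:R `^ (d.-1%:R * alpha / 2))%:E) /\
  (s <> s_e ->
   (s_number s (embedding d alpha) n *
      (n%:R `^ (- (alpha / 2)) * ln n%:R `^ (alpha * d.-1%:R / 2))^-1%:E)%E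
     @[n --> \oo] --> ((1 / (d.-1)`!%:R) `^ (alpha / 2))%:E).
Proof.
case: d hd => // d _; rewrite succnK; split.
  rewrite (_ : (fun n : nat => _) = (fun n => (rate d alpha n)%:E)); last first.
    by apply/funext => n; rewrite /rate [d%:R * alpha]mulrC.
  have [->|se] : s = s_e \/ s <> s_e by case: s; [right|right|right|right|left|right].
    exact: entropy_number_asymp.
  exact: s_number_asymp.
move=> se.
have H : (singular_value d alpha n / rate d alpha n)%:E @[n --> \oo] --> ((1 / d`!%:R) `^ (alpha / 2))%:E.
  by apply: cvg_EFin; [near=> n|exact: singular_value_rate].
apply: cvg_trans H; apply: near_eq_cvg; near=> n.
have n0 : (0 < n)%N by near: n; exists 1%N.
by rewrite hermite_s_number// -EFinM.
Unshelve. all: by end_near.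
Qed.
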